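(* Let $H\in(0,1)$ and $K\in(0,1]$ with $2HK\geq 1$, let $T>0$, and let $(B^{H,K}_t)_{t\in[0,T]}$ be a one-dimensional bifractional Brownian motion with parameters $H,K$. Let $f:\mathbb{R}\to\mathbb{R}$ be a function of class $C^2$. Then for every $t\in[0,T]$, almost surely, $$f\left(B^{H,K}_{t}\right)=f(0)+\int_{0}^{t}f'\left(B^{H,K}_{s}\right)\delta B^{H,K}_{s}+HK\int_{0}^{t}f''\left(B^{H,K}_{s}\right)s^{2HK-1}\,ds,$$ where the stochastic integral is the divergence (Skorohod) integral of $f'(B^{H,K}_\cdot)1_{(0,t]}$ with respect to $B^{H,K}$.
   Context: Bifractional Brownian motion: for $H\in(0,1)$, $K\in(0,1]$, $B^{H,K}$ is the centered Gaussian process with continuous paths, starting from $0$, with covariance $R(t,s)=2^{-K}\left((t^{2H}+s^{2H})^K-|t-s|^{2HK}\right)$. Divergence integral: let $\mathcal{H}$ be the completion of the linear span of the indicators $1_{[0,t]}$, $t\in[0,T]$, under the inner product $\langle 1_{[0,t]},1_{[0,s]}\rangle_{\mathcal{H}}=R(t,s)$. The map $1_{[0,t]}\mapsto B^{H,K}_t$ extends to an isometry $\varphi\mapsto B(\varphi)$ from $\mathcal{H}$ into the Gaussian space of $B^{H,K}$. When $2HK\ge 1$, $L^2([0,T])\subset\mathcal{H}$, so square-integrable functions on $[0,T]$ are regarded as elements of $\mathcal{H}$. For $F=g(B(\varphi_1),\dots,B(\varphi_n))$ with $g\in C_b^\infty(\mathbb{R}^n)$, $\varphi_i\in\mathcal{H}$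 (the class $\mathcal{S}$ of smooth functionals), the Malliavin derivative is $DF=\sum_i\partial_i g(B(\varphi_1),\dots,B(\varphi_n))\varphi_i$. The divergence $\delta$ is the adjoint of $D$: $u\in L^2(\Omega;\mathcal{H})$ is in $\mathrm{Dom}(\delta)$ if $|E\langle DF,u\rangle_{\mathcal{H}}|\le c\|F\|_{L^2(\Omega)}$ for all $F\in\mathcal{S}$, and then $\delta(u)$ is characterized by $E(F\delta(u))=E\langle DF,u\rangle_{\mathcal{H}}$. One writes $\int_0^t u_s\,\delta B^{H,K}_s=\delta(u1_{(0,t]})$. For general $f\in C^2$ (with no growth condition) the integral is understood by localization: on the event $\{\sup_{s\le T}|B^{H,K}_s|\le k\}$ it equals $\int_0^t f_k'(B^{H,K}_s)\,\delta B^{H,K}_s$, where $f_k$ is a compactly supported $C^2$ function coinciding with $f$ on $[-k,k]$. *)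

(* Defs.v *)
From HB Require Import structures.
From mathcomp Require Import all_boot all_order all_algebra.
From mathcomp Require Import all_classical all_reals all_analysis.
Set Implicit Arguments.
Unset Strict Implicit.
Unset Printing Implicit Defensive.
Import Order.TTheory GRing.Theory Num.Theory.
Import numFieldNormedType.Exports.
Local Open Scope classical_set_scope.
Local Open Scope ring_scope.

Definition bif_cov (R : realType) (H K t s : R) : R :=
  2 `^ (- K) *
  ((t `^ (2 * H) + s `^ (2 * H)) `^ K - `|t - s| `^ (2 * H * K)).

(* [normal_prob m 0] is not a point mass in the library, hence the case split. *)
Definition gaussian d (Omega : measurableType d) (R : realType)
    (P : probability Omega R) (X : Omega -> R) : Prop :=
  exists m sigma : R, forall A : set R, measurable A ->
    P (X @^-1` A) =
    (if sigma == 0 then \d_m A else normal_prob m sigma A).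

(* Only the times in [0, T] matter; the values of [B] elsewhere are
   unconstrained. *)
Record is_bifBm d (Omega : measurableType d) (R : realType)
    (P : probability Omega R) (H K T : R) (B : R -> {RV P >-> R}) : Prop := {
  bifBm_gaussian : forall (n : nat) (a ti : 'I_n -> R),
    (forall i, ti i \in `[0, T]) ->
    gaussian P (fun w => \sum_(i < n) a i * B (ti i) w) ;
  bifBm_centered : forall t, t \in `[0, T] -> ('E_P[B t] = 0)%E ;
  bifBm_cov : forall t s, t \in `[0, T] -> s \in `[0, T] ->
    covariance P (B t) (B s) = (bif_cov H K t s)%:E ;
  bifBm_start : forall w, B 0 w = 0 ;
  bifBm_continuous : forall w, {within `[0, T], continuous (fun t => B t w)}
}.

(* A list of pairs (a, t) codes the formal combination of the indicators
   1_[0,t] with coefficients a. *)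
Definition times_in (R : realType) (T : R) (c : seq (R * R)) : Prop :=
  forall p, p \in c -> p.2 \in `[0, T].

Definition step_fun (R : realType) (c : seq (R * R)) (x : R) : R :=
  \sum_(p <- c) p.1 * \1_(`[0, p.2]) x.

Definition step_elt (R : realType) (V : lmodType R) (e : R -> V)
    (c : seq (R * R)) : V :=
  \sum_(p <- c) p.1 *: e p.2.

(* A completion of the span of the indicators 1_[0,t], t in [0, T], for the
   inner product <1_[0,t], 1_[0,s]> = bif_cov H K t s: a Hilbert space with
   elements [ind t] having these inner products and a dense span.  These
   properties determine it up to a unique isometry, and the functions 1_[0,t]
   are linearly independent, so every step function has a well-defined image. *)
Record bif_hilbert (R : realType) (H K T : R) := {
  hspace :> completeNormedModType R ;
  dot : {dot hspace for idfun} ;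
  ind : R -> hspace ;
  dot_norm : forall x : hspace, dot x x = `|x| ^+ 2 ;
  dot_ind : forall t s, t \in `[0, T] -> s \in `[0, T] ->
    dot (ind t) (ind s) = bif_cov H K t s ;
  ind_dense : closure [set h | exists2 c, times_in T c & h = step_elt ind c]
              = [set: hspace]
}.

(* [represents phi h]: [h] is the image of the function [phi] in L^2([0,T])
   under the continuous extension of 1_[0,t] |-> ind t.  *)
Definition represents (R : realType) (H K T : R) (V : bif_hilbert H K T)
    (phi : R -> R) (h : V) : Prop :=
  measurable_fun `[0, T] phi /\
  exists c : nat -> seq (R * R),
    [/\ forall n, times_in T (c n),
        (\int[lebesgue_measure]_(x in `[0%R, T])
            ((phi x - step_fun (c n) x) ^+ 2)%:E)%E @[n --> \oo] --> 0%E
      & step_elt (ind V) (c n) @[n --> \oo] --> h].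

Definition toH (R : realType) (H K T : R) (V : bif_hilbert H K T)
    (phi : R -> R) : V :=
  xget 0 [set h | represents phi h].

(* [W h] is a chosen version of the Gaussian variable B(h). *)
Record is_isonormal d (Omega : measurableType d) (R : realType)
    (P : probability Omega R) (H K T : R) (B : R -> {RV P >-> R})
    (V : bif_hilbert H K T) (W : V -> {RV P >-> R}) : Prop := {
  isonormal_ind : forall t, t \in `[0, T] ->
    {ae P, forall w, W (ind V t) w = B t w} ;
  isonormal_linear : forall (a : R) (h1 h2 : V),
    {ae P, forall w, W (a *: h1 + h2) w = a * W h1 w + W h2 w} ;
  isonormal_isometry : forall h1 h2 : V,
    ('E_P[fun w => (W h1 w * W h2 w)%R] = (dot V h1 h2)%:E)%E
}.

Definition partial (R : realType) n (g : 'rV[R]_n -> R) (i : 'I_n) :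
    'rV[R]_n -> R :=
  fun x => 'D_(delta_mx 0 i) g x.

Definition Cb_infty (R : realType) n (g : 'rV[R]_n -> R) : Prop :=
  forall s : seq 'I_n, let gs := foldl (@partial R n) g s in
    [/\ continuous gs,
        forall i x, derivable gs x (delta_mx 0 i)
      & exists M : R, forall x, `|gs x| <= M].

Section Malliavin.
Context d (Omega : measurableType d) (R : realType) (P : probability Omega R).
Context (H K T : R) (B : R -> {RV P >-> R}).
Context (V : bif_hilbert H K T) (W : V -> {RV P >-> R}).

(* The sigma-algebra generated by (B_t), t in [0, T].  L^2(Omega) and
   L^2(Omega; V) are taken with respect to it: the smooth functionals are dense
   in this L^2(Omega), so that the divergence is unique. *)
Definition sigmaB : set (set Omega) :=
  <<s [set A | exists2 t, t \in `[0, T] &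
         exists2 Y : set R, measurable Y & A = B t @^-1` Y] >>.

Definition L2_real (Z : Omega -> R) : Prop :=
  (forall Y : set R, measurable Y -> sigmaB (Z @^-1` Y)) /\
  ('N[P]_2%:E[EFin \o Z] < +oo)%E.

Definition L2_hilbert (u : Omega -> V) : Prop :=
  (forall U : set V, open U -> sigmaB (u @^-1` U)) /\
  ('E_P[fun w => (`|u w| ^+ 2)%R] < +oo)%E.

Definition smooth n (g : 'rV[R]_n -> R) (phi : 'I_n -> V) (w : Omega) : R :=
  g (\row_i W (phi i) w).

Definition malliavinD n (g : 'rV[R]_n -> R) (phi : 'I_n -> V) (w : Omega) : V :=
  \sum_(i < n) partial g i (\row_j W (phi j) w) *: phi i.

Definition Dom_delta (u : Omega -> V) : Prop :=
  L2_hilbert u /\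
  exists c : R, forall n (g : 'rV[R]_n -> R) (phi : 'I_n -> V), Cb_infty g ->
    (`| 'E_P[fun w => dot V (malliavinD g phi w) (u w)] |
     <= c%:E * 'N[P]_2%:E[EFin \o smooth g phi])%E.

Definition is_divergence (u : Omega -> V) (Z : Omega -> R) : Prop :=
  L2_real Z /\
  forall n (g : 'rV[R]_n -> R) (phi : 'I_n -> V), Cb_infty g ->
    ('E_P[fun w => (smooth g phi w * Z w)%R] =
     'E_P[fun w => dot V (malliavinD g phi w) (u w)])%E.

(* Meaningful for [u] in [Dom_delta]; defined up to almost sure equality. *)
Definition divergence (u : Omega -> V) : Omega -> R :=
  xget (cst 0) [set Z | is_divergence u Z].

Definition integrand (h : R -> R) (t : R) (w : Omega) : V :=
  toH V (fun s => h (B s w) * \1_(`]0, t]) s).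

End Malliavin.

Definition C2 (R : realType) (f : R -> R) : Prop :=
  [/\ forall x, derivable f x 1, forall x, derivable (derive1 f) x 1
    & continuous (derive1 (derive1 f))].

Definition compact_support (R : realType) (f : R -> R) : Prop :=
  compact (closure [set x | f x <> 0]).

(* [Z] is (a version of) the integral of f'(B_s) 1_(0,t](s) against B,
   understood by localization. *)
Definition is_skorohod_integral d (Omega : measurableType d) (R : realType)
    (P : probability Omega R) (H K T : R) (B : R -> {RV P >-> R})
    (V : bif_hilbert H K T) (W : V -> {RV P >-> R}) (f : R -> R) (t : R)
    (Z : {RV P >-> R}) : Prop :=
  forall (k : nat) (fk : R -> R), C2 fk -> compact_support fk ->
    (forall x, x \in `[- k%:R, k%:R] -> fk x = f x) ->
    Dom_delta B W (integrand B V (derive1 fk) t) /\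
    {ae P, forall w, sup [set `|B s w| | s in `[0, T]] <= k%:R ->
       Z w = divergence B W (integrand B V (derive1 fk) t) w}.

(* Main.v *)
Require Import Defs.
From HB Require Import structures.
From mathcomp Require Import all_boot all_order all_algebra.
From mathcomp Require Import all_classical all_reals all_analysis.
From mathcomp Require Import measurable_realfun ring lra.
Set Implicit Arguments.
Unset Strict Implicit.
Unset Printing Implicit Defensive.
Import Order.TTheory GRing.Theory Num.Theory.
Import numFieldNormedType.Exports.
Local Open Scope classical_set_scope.
Local Open Scope ring_scope.

(* For g of class C^2 with compact support, the candidate for the divergence of
   g'(B) 1_(0,t] is Z = g(B_t) - g(0) - HK int_0^t g''(B_s) s^(2HK-1) ds, and the
   point is the duality E[F Z] = E<DF, g'(B) 1_(0,t]> for smooth functionals F.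
   Over a grid of [0, t], E[F (g(B_s') - g(B_s))] is expanded by Gaussian
   integration by parts.  Writing I = 1_(s,s'], the terms of first order are
   E[g'(B_s) <DF, I>] and E[F g''(B_s)] (<1_[0,s], I> + |I|^2 / 2), where the last
   factor is (s'^(2HK) - s^(2HK)) / 2.  The remainders vanish in the limit because
   |step function|_H^2 <= C int (step function)^2 when 2HK >= 1, which is Schur's
   test on the matrix of covariances of the increments; the same bound identifies
   the Riemann sums of g'(B) 1_(0,t] in H.  The divergence is unique because an
   integrable X with E[X cos B(h)] = E[X sin B(h)] = 0 for all h integrates to 0
   over every event of the sigma-algebra of B.  The general case is obtained from
   cutoffs of f. *)

(** * Calculus *)

(** The hypothesis on [B] concerns only one-dimensional laws of finite linear combinations.
    Independence of [W y] from the variables orthogonal to it is recovered from characteristic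
    functions, by the same annihilator argument that gives uniqueness of the divergence, and
    integration by parts is then reduced to one real variable.

    The increment of [g(B)] is expanded inside the expectation, along s |-> E[F g(W h + s W y)], and
    moduli of continuity have the form e + k (y - x)^2. In this way the remainders only involve
    second moments of the Gaussian variables, which are norms in the Hilbert space.

    The obstacle is in the first order errors: they carry a factor <phi i, I> with [phi i] an
    arbitrary element of the Hilbert space. Estimating it by |phi i| |I| on each interval costs the
    square root of the mesh, too much to be summed over the grid. The errors are therefore added up
    as one vector, whose norm the L^2 bound controls. The second order errors can be summed one by
    one, since <1_[0,s], I> and |I|^2 are at most of the order of the length of I. *)

Section calculus_tools.
Context (R : realType).
Implicit Types (f g : R -> R) (x y : R).

Lemma derivM f g x a b : is_derive x 1 f a -> is_derive x 1 g b ->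
  is_derive x 1 (fun y => f y * g y) (a * g x + f x * b).
Proof.
move=> h1 h2; have := is_deriveM h1 h2; rewrite /GRing.scale/= => h.
by apply: is_derive_eq; rewrite addrC mulrC [X in _ + X]mulrC mulrC [X in X + _]mulrC.
Qed.

Lemma derivD f g x a b : is_derive x 1 f a -> is_derive x 1 g b ->
  is_derive x 1 (fun y => f y + g y) (a + b).
Proof. by move=> h1 h2; have := is_deriveD h1 h2. Qed.

Lemma derivB f g x a b : is_derive x 1 f a -> is_derive x 1 g b ->
  is_derive x 1 (fun y => f y - g y) (a - b).
Proof. by move=> h1 h2; have := is_deriveB h1 h2. Qed.

Lemma derivZ (c : R) f x a : is_derive x 1 f a ->
  is_derive x 1 (fun y => c * f y) (c * a).
Proof. by move=> h; have := is_deriveZ c h. Qed.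

Lemma deriv_cst (c x : R) : is_derive x 1 (fun=> c) 0.
Proof. exact: is_derive_cst. Qed.

Lemma deriv_id x : is_derive x 1 (fun y => y) 1.
Proof. exact: is_derive_id. Qed.

Lemma deriv_comp f g x a b : is_derive (g x) 1 f a -> is_derive x 1 g b ->
  is_derive x 1 (fun y => f (g y)) (a * b).
Proof. by move=> h1 h2; have := is_derive1_comp h1 h2. Qed.

Lemma deriv_affine (a b x : R) : is_derive x 1 (fun y => a + y * b) b.
Proof.
have h := derivD (deriv_cst a x) (derivM (deriv_id x) (deriv_cst b x)).
by apply: (is_derive_eq h); ring.
Qed.

Lemma deriv_continuous f x a : is_derive x 1 f a -> {for x, continuous f}.
Proof.
move=> h; apply/differentiable_continuous/derivable1_diffP.
by have [] := h.
Qed.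

Lemma deriv_sqr (m x : R) : is_derive x 1 (fun y => (y - m) ^+ 2) (2 * (x - m)).
Proof.
have hm : is_derive x 1 (fun y => y - m) 1.
  by apply: (is_derive_eq (derivB (deriv_id x) (deriv_cst m x))); ring.
have h := derivM hm hm.
under eq_fun do rewrite expr2.
by apply: (is_derive_eq h); ring.
Qed.

Lemma mean_value f (f' : R -> R) x y : (forall z : R, is_derive z 1 f (f' z)) ->
  exists2 c, f y - f x = f' c * (y - x) & `|c - x| <= `|y - x|.
Proof.
move=> df.
have H (a b : R) : a <= b -> exists2 c, c \in `[a, b] & f b - f a = f' c * (b - a).
  move=> ab; apply: (MVT_segment ab).
  by apply: continuous_subspaceT => z; exact: deriv_continuous (df z).
have [xy|/ltW yx] := leP x y.
- have [c] := H x y xy; rewrite in_itv /= => /andP[xc cy] e.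
  by exists c => //; rewrite !ger0_norm ?subr_ge0// lerD2r.
- have [c] := H y x yx; rewrite in_itv /= => /andP[xc cy] e.
  exists c; first by rewrite -opprB e; ring.
  by rewrite !ler0_norm ?subr_le0// !opprB lerD2l lerN2.
Qed.

Lemma deriv_lip f (f' : R -> R) (M : R) : (forall z : R, is_derive z 1 f (f' z)) ->
  (forall z, `|f' z| <= M) -> forall x y, `|f y - f x| <= M * `|y - x|.
Proof.
move=> df M' x y; have [c -> _] := mean_value x y df.
by rewrite normrM ler_wpM2r.
Qed.

(** The mean value theorem followed by the Lipschitz bound on [f'], whence the constant [M] in place
    of [M / 2]. *)
Lemma deriv_taylor2 f (f' f'' : R -> R) (M : R) :
  (forall z : R, is_derive z 1 f (f' z)) -> (forall z : R, is_derive z 1 f' (f'' z)) ->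
  (forall z, `|f'' z| <= M) ->
  forall x y, `|f y - f x - f' x * (y - x)| <= M * (y - x) ^+ 2.
Proof.
move=> df df' M' x y; have [c -> cx] := mean_value x y df.
rewrite -mulrBl normrM -[in leRHS](real_normK (num_real (y - x))) expr2 mulrA.
rewrite ler_wpM2r//; apply: le_trans (deriv_lip df' M' x c) _.
by rewrite ler_wpM2l// (le_trans _ (M' x)).
Qed.

(** The tool for differentiating expectations in a parameter: a pathwise second order bound, once
    integrated, is exactly this hypothesis. *)
Lemma is_derive_quadratic_bound f x a (C : R) :
  (forall y, `|f y - f x - a * (y - x)| <= C * (y - x) ^+ 2) ->
  is_derive x 1 f a.
Proof.
move=> fC.
have C0 : 0 <= C.
  have := fC (1 + x); rewrite addrK expr1n !mulr1.
  by apply: le_trans.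
have Cp : 0 < C + 1 by rewrite ltr_wpDl.
have H : h^-1 *: ((f \o shift x) (h *: 1) - f x) @[h --> 0^'] --> a.
  apply/cvgrPdist_le => /= e e0; near=> h.
  have h0 : h != 0 by near: h; exact: nbhs_dnbhs_neq.
  rewrite /GRing.scale /= mulr1.
  have := fC (h + x); rewrite addrK => hC.
  have -> : a - h^-1 * (f (h + x) - f x) = - (h^-1 * (f (h + x) - f x - a * h)).
    by field.
  rewrite normrN normrM normfV ler_pdivrMl ?normr_gt0//.
  apply: (le_trans hC); rewrite -(real_normK (num_real h)) expr2 mulrA mulrC.
  rewrite ler_wpM2l// (@le_trans _ _ ((C + 1) * `|h|))//.
    by rewrite ler_wpM2r// lerDl.
  rewrite -ler_pdivlMl// mulrC.
  near: h; apply: dnbhs0_le; exact: divr_gt0.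
have := @DeriveDef R R^o R^o x 1 f a.
apply; first by apply/cvg_ex; exists a.
exact: cvg_lim H.
Unshelve. all: by end_near. Qed.

End calculus_tools.

(** * Expectations *)

Section expectation_tools.
Context d (T : measurableType d) (R : realType) (P : probability T R).
Implicit Types (X Y : T -> R) (M : R).

Definition integ X := P.-integrable setT (EFin \o X).

Lemma integ_meas X : integ X -> measurable_fun setT X.
Proof. by move=> /measurable_int /measurable_EFinP. Qed.

Lemma integ_le Y X : measurable_fun setT X -> integ Y ->
  (forall w, `|X w| <= Y w) -> integ X.
Proof.
move=> mX iY XY; apply: (le_integrable measurableT _ _ iY).
  exact/measurable_EFinP.
by move=> w _ /=; rewrite lee_fin (le_trans (XY w))// ler_norm.
Qed.

Lemma integ_cst (a : R) : integ (fun=> a).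
Proof.
by apply: finite_measure_integrable_cst.
Qed.

Lemma integ_bounded X M : measurable_fun setT X ->
  (forall w, `|X w| <= M) -> integ X.
Proof. by move=> mX XM; apply: (integ_le mX (integ_cst M)). Qed.

Lemma integD X Y : integ X -> integ Y -> integ (fun w => X w + Y w).
Proof.
by move=> iX iY; have := integrableD measurableT iX iY; apply: eq_integrable.
Qed.

Lemma integZ (a : R) X : integ X -> integ (fun w => a * X w).
Proof.
by move=> iX; have := integrableZl measurableT a iX; apply: eq_integrable.
Qed.

Lemma integB X Y : integ X -> integ Y -> integ (fun w => X w - Y w).
Proof.
by move=> iX iY; have := integrableB measurableT iX iY; apply: eq_integrable.
Qed.

Lemma integ_sum (I : Type) (s : seq I) (X : I -> T -> R) :
  (forall i, integ (X i)) -> integ (fun w => \sum_(i <- s) X i w).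
Proof.
move=> iX; elim: s => [|a s ih].
  by under eq_fun do rewrite big_nil; exact: integ_cst.
by under eq_fun do rewrite big_cons; exact: integD.
Qed.

Lemma integMb M X Y : integ X -> measurable_fun setT Y ->
  (forall w, `|Y w| <= M) -> integ (fun w => X w * Y w).
Proof.
move=> iX mY YM; have mX := integ_meas iX.
apply: (@integ_le (fun w => M * `|X w|)).
- exact: measurable_funM.
- by apply: integZ; have := integrable_abse iX; apply: eq_integrable.
- by move=> w; rewrite normrM mulrC ler_wpM2r.
Qed.

Lemma integ_norm X : integ X -> integ (fun w => `|X w|).
Proof. by move=> iX; have := integrable_abse iX; apply: eq_integrable. Qed.

Lemma integ_mul X Y : measurable_fun setT X -> measurable_fun setT Y ->
  integ (fun w => X w ^+ 2) -> integ (fun w => Y w ^+ 2) ->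
  integ (fun w => X w * Y w).
Proof.
move=> mX mY iX iY; apply: (@integ_le (fun w => X w ^+ 2 + Y w ^+ 2)).
- exact: measurable_funM.
- exact: integD.
- move=> w /=; rewrite normrM -(real_normK (num_real (X w))).
  rewrite -[Y w ^+ 2](real_normK (num_real (Y w))).
  have : 0 <= (`|X w| - `|Y w|) ^+ 2 by exact: sqr_ge0.
  have := normr_ge0 (X w); have := normr_ge0 (Y w); nra.
Qed.

Lemma integ_sqr X : measurable_fun setT X -> integ (fun w => X w ^+ 2) ->
  integ X.
Proof.
move=> mX iX; apply: (@integ_le (fun w => 1 + X w ^+ 2)) => //.
  by apply: integD => //; exact: integ_cst.
move=> w /=; rewrite -(real_normK (num_real (X w))).
have : 0 <= (`|X w| - 1) ^+ 2 by exact: sqr_ge0.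
have := normr_ge0 (X w); nra.
Qed.

Local Notation E X := (\int[P]_w (X w)).

Lemma expE_fin X : integ X -> ('E_P[X] = (E X)%:E)%E.
Proof.
move=> iX; rewrite unlock /Rintegral fineK//.
exact: integrable_fin_num.
Qed.

Lemma E_cst (a : R) : E (fun=> a) = a.
Proof. by rewrite Rintegral_cst//= [X in fine X](_ : _ = 1%E) ?mulr1//; exact: probability_setT. Qed.

Lemma E_D X Y : integ X -> integ Y -> E (fun w => X w + Y w) = E X + E Y.
Proof. exact: RintegralD. Qed.

Lemma E_B X Y : integ X -> integ Y -> E (fun w => X w - Y w) = E X - E Y.
Proof. exact: RintegralB. Qed.

Lemma E_Z (a : R) X : integ X -> E (fun w => a * X w) = a * E X.
Proof. exact: RintegralZl. Qed.

Lemma E_Zr (a : R) X : integ X -> E (fun w => X w * a) = E X * a.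
Proof. exact: RintegralZr. Qed.

Lemma E_sum (I : Type) (s : seq I) (X : I -> T -> R) :
  (forall i, integ (X i)) ->
  E (fun w => \sum_(i <- s) X i w) = \sum_(i <- s) E (X i).
Proof.
move=> iX; elim: s => [|a s ih].
  by under eq_Rintegral do rewrite big_nil; rewrite E_cst big_nil.
under eq_Rintegral do rewrite big_cons.
by rewrite E_D ?big_cons ?ih//; exact: integ_sum.
Qed.

Lemma E_le X Y : integ X -> integ Y -> (forall w, X w <= Y w) -> E X <= E Y.
Proof. by move=> iX iY XY; apply: le_Rintegral. Qed.

Lemma E_ge0 X : (forall w, 0 <= X w) -> 0 <= E X.
Proof. by move=> X0; apply: Rintegral_ge0. Qed.

Lemma E_abs X : integ X -> `|E X| <= E (fun w => `|X w|).
Proof. exact: le_normr_Rintegral. Qed.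

Lemma E_abs_le X Y : measurable_fun setT X -> integ Y ->
  (forall w, `|X w| <= Y w) -> `|E X| <= E Y.
Proof.
move=> mX iY XY; have iX := integ_le mX iY XY.
by apply: (le_trans (E_abs iX)); apply: E_le => //; exact: integ_norm.
Qed.

Lemma E_ae X Y : measurable_fun setT X -> measurable_fun setT Y ->
  {ae P, forall w, X w = Y w} -> E X = E Y.
Proof.
move=> mX mY XY; congr fine; apply: ae_eq_integral => //.
- exact/measurable_EFinP.
- exact/measurable_EFinP.
- by apply: filterS XY => w /= -> _.
Qed.

Lemma integ_ae X Y : measurable_fun setT Y ->
  {ae P, forall w, X w = Y w} -> integ X -> integ Y.
Proof.
move=> mY XY iX; have mX := integ_meas iX.
have /integrableP[_ Xoo] := iX.
apply/integrableP; split; first exact/measurable_EFinP.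
rewrite -(_ : (\int[P]_w `|(X w)%:E|)%E = (\int[P]_w `|(Y w)%:E|)%E)//.
apply: ae_eq_integral => //.
- by apply: measurableT_comp => //; exact/measurable_EFinP.
- by apply: measurableT_comp => //; exact/measurable_EFinP.
- by apply: filterS XY => w /= -> _.
Qed.

Lemma E_dct (X_ : nat -> T -> R) X Y : (forall n, measurable_fun setT (X_ n)) ->
  (forall w, X_ n w @[n --> \oo] --> X w) -> integ Y ->
  (forall n w, `|X_ n w| <= Y w) ->
  integ X /\ E (X_ n) @[n --> \oo] --> E X.
Proof.
move=> mX XX iY XY.
have mX' : measurable_fun setT X.
  by apply: (measurable_fun_cvg mX) => w _; exact: XX.
have mX_ n : measurable_fun setT (EFin \o X_ n) by exact/measurable_EFinP.
have mXE : measurable_fun setT (EFin \o X) by exact/measurable_EFinP.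
have cX : {ae P, forall w, setT w -> (EFin \o X_ n) w @[n --> \oo] --> (EFin \o X) w}.
  by apply: aeW => w _; apply: cvg_EFin; [exact: nearW|exact: XX].
have bX : {ae P, forall w n, setT w -> (`|(EFin \o X_ n) w| <= (EFin \o Y) w)%E}.
  by apply: aeW => w n _; rewrite lee_fin.
have [iX _ cE] := dominated_convergence measurableT mX_ mXE cX iY bX.
split => //.
apply: fine_cvg; rewrite fineK//; exact: integrable_fin_num.
Qed.


End expectation_tools.
Notation "''E' P X" := (\int[P]_w (X w))%R (at level 10, P, X at level 8, only parsing) : ring_scope.

(** * Normal laws and Stein's identity *)

Section stein.
Context (R : realType).
Local Notation mu := (@lebesgue_measure R).

(** The Radon-Nikodym derivative agrees almost everywhere with [normal_pdf], because both have the
    integral [normal_prob m s] over every measurable set. *)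
Lemma integral_normal_prob (m s : R) (f : R -> \bar R) :
  measurable_fun setT f ->
  (\int[normal_prob m s]_x `|f x| < +oo)%E ->
  (\int[normal_prob m s]_x f x =
   \int[mu]_x (f x * (normal_pdf m s x)%:E))%E.
Proof.
move=> mf finf.
have dom := normal_prob_dominates m s.
rewrite -(Radon_Nikodym_change_of_variables dom)//=; last first.
  by apply/integrableP; split.
apply: ae_eq_integral => //.
- exact: emeasurable_funM.
- apply: emeasurable_funM => //=; apply/measurable_EFinP.
  exact: measurable_normal_pdf.
- apply: ae_eqe_mul2l => /=.
  rewrite Radon_NikodymE//=.
  case: cid => /= h [h1 h2 h3].
  apply: integral_ae_eq => //=.
  - apply/measurable_EFinP; exact: measurable_normal_pdf.
  - by move=> E _ mE; rewrite -h3.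
Qed.

Lemma is_derive_normal_pdf (m s x : R) : s != 0 ->
  is_derive x 1 (normal_pdf m s) (- ((x - m) / s ^+ 2) * normal_pdf m s x).
Proof.
move=> s0; rewrite normal_pdfE//.
have h1 : is_derive x 1 (fun y : R => - (y - m) ^+ 2 / (s ^+ 2 *+ 2))
    (- ((x - m) / s ^+ 2)).
  have -> : (fun y : R => - (y - m) ^+ 2 / (s ^+ 2 *+ 2)) =
      (fun y => (- (s ^+ 2 *+ 2)^-1) * (y - m) ^+ 2).
    by apply/funext => y; rewrite mulNr mulrC mulNr.
  apply: (is_derive_eq (derivZ _ (deriv_sqr m x))).
  by rewrite -mulr_natr; field.
have h2 := derivZ (normal_peak s) (deriv_comp (is_derive_expR _) h1).
apply: (is_derive_eq h2); rewrite /normal_fun.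
by ring.
Qed.

(** With y = (x - m)^2 / (2 s^2) this is y exp(-y) <= 1, a consequence of 1 + y <= exp(y). *)
Lemma normal_pdf_decay (m s x : R) : s != 0 ->
  (x - m) ^+ 2 * normal_pdf m s x <= normal_peak s * (s ^+ 2 *+ 2).
Proof.
move=> s0; rewrite normal_pdfE// /normal_fun.
have s2 : 0 < s ^+ 2 *+ 2 by rewrite mulrn_wgt0// exprn_even_gt0.
rewrite mulrCA ler_wpM2l ?normal_peak_ge0//.
set y := (x - m) ^+ 2 / (s ^+ 2 *+ 2).
rewrite (_ : - (x - m) ^+ 2 / _ = - y) ?mulNr//.
have -> : (x - m) ^+ 2 = (s ^+ 2 *+ 2) * y by rewrite /y mulrC divfK ?gt_eqF.
have y0 : 0 <= y by rewrite /y divr_ge0 ?sqr_ge0// ltW.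
rewrite -mulrA ler_piMr ?(ltW s2)//.
rewrite expRN ler_pdivrMr ?expR_gt0// mul1r.
by apply: le_trans (expR_ge1Dx _); rewrite lerDr.
Qed.


Section stein_law.
Context d (T : measurableType d) (P : probability T R).
Variables (X : {RV P >-> R}) (m s : R).
Hypothesis s0 : s != 0.
Hypothesis lawX : forall A : set R, measurable A ->
  P (X @^-1` A) = normal_prob m s A.
Hypothesis iX2 : integ P (fun w => X w ^+ 2).

Let mX : measurable_fun setT X.
Proof. exact: measurable_funPT. Qed.

Lemma normal_law_integral (f : R -> R) : measurable_fun setT f ->
  integ P (fun w => f (X w)) ->
  mu.-integrable setT (fun x => (f x * normal_pdf m s x)%:E) /\
  \int[P]_w f (X w) = \int[mu]_x (f x * normal_pdf m s x).
Proof.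
move=> mf ifX.
have mEf : measurable_fun setT (EFin \o f) by exact/measurable_EFinP.
pose mixX := isMeasurableFun.Build _ _ T (measurableTypeR R) X mX.
pose X' : {mfun T >-> measurableTypeR R} := HB.pack (X : T -> measurableTypeR R) mixX.
have E1 (g : R -> \bar R) : measurable_fun setT g ->
    P.-integrable setT (g \o X) ->
    (\int[normal_prob m s]_x g x = \int[P]_w g (X w))%E.
  move=> mg ig; rewrite -[RHS](@integral_distribution _ _ _ (measurableTypeR R) _ P X' g mg ig).
  have H A : measurable A -> A `<=` setT -> normal_prob m s A = distribution P X' A.
    by move=> mA _; rewrite -lawX.
  exact: (@eq_measure_integral _ _ R setT (distribution P X') (normal_prob m s) g H).
have absfin : (\int[normal_prob m s]_x `|(EFin \o f) x| < +oo)%E.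
  rewrite (E1 (abse \o (EFin \o f)))//.
  - by have /integrableP[] := ifX.
  - exact: measurableT_comp.
  - by have := integrable_abse ifX.
have D1 := integral_normal_prob mEf absfin.
have D2 : (\int[normal_prob m s]_x `|(EFin \o f) x| =
    \int[mu]_x (`|(EFin \o f) x| * (normal_pdf m s x)%:E))%E.
  apply: integral_normal_prob; first exact: measurableT_comp.
  by under eq_integral do rewrite abse_id.
split.
  apply/integrableP; split.
    apply/measurable_EFinP; apply: measurable_funM => //.
    exact: measurable_normal_pdf.
  rewrite D2 in absfin; apply: le_lt_trans absfin.
  rewrite le_eqVlt; apply/orP; left; apply/eqP; apply: eq_integral => x _ /=.
  by rewrite normrM EFinM [X in (_ * X%:E)%E = _]ger0_norm// normal_pdf_ge0.
rewrite /Rintegral; congr fine.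
by rewrite -(E1 (EFin \o f))// D1; apply: eq_integral => x _; rewrite -EFinM.
Qed.

(** The density g satisfies g' = - (x - m) / s^2 g, so (psi g)' = psi' g - s^-2 psi (x - m) g, and
    the identity says that this derivative has integral 0. Since [psi'] is bounded, [psi] grows at
    most linearly, and the second moment of [X] makes the left-hand side integrable. *)
Lemma stein_normal (psi psi' : R -> R) (M : R) :
  (forall x : R, is_derive x 1 psi (psi' x)) ->
  continuous psi' -> (forall x, `|psi' x| <= M) ->
  \int[P]_w (psi (X w) * (X w - m)) = s ^+ 2 * \int[P]_w psi' (X w).
Proof.
move=> dpsi cpsi' psiM.
have cpsi : continuous psi by move=> x; exact: deriv_continuous (dpsi x).
have M0 : 0 <= M by exact: le_trans (psiM 0).
have mpsi : measurable_fun setT psi by exact: continuous_measurable_fun.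
have mpsi' : measurable_fun setT psi' by exact: continuous_measurable_fun.
have psilin x : `|psi x| <= `|psi m| + M * `|x - m|.
  rewrite -[X in `|X|](subrK (psi m)) addrC (le_trans (ler_normD _ _))//.
  by rewrite lerD2l; exact: (deriv_lip dpsi psiM m x).
have ipsi' : integ P (fun w => psi' (X w)).
  by apply: (@integ_bounded _ _ _ _ _ M) => //; exact: measurableT_comp.
have iX : integ P X by exact: integ_sqr.
have iXm : integ P (fun w => (X w - m) ^+ 2).
  have -> : (fun w => (X w - m) ^+ 2) =
      (fun w => X w ^+ 2 + ((- (2 * m)) * X w + m ^+ 2)).
    by apply/funext => w; ring.
  by apply: integD => //; apply: integD; [exact: integZ|exact: integ_cst].
have ipsi : integ P (fun w => psi (X w) * (X w - m)).
  apply: integ_mul => //.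
  - exact: measurableT_comp.
  - exact: measurable_funB.
  - apply: (@integ_le _ _ _ _ (fun w => 2 * `|psi m| ^+ 2 + 2 * M ^+ 2 * ((X w - m) ^+ 2))).
    + by apply: measurable_funX; exact: measurableT_comp.
    + by apply: integD; [exact: integ_cst|exact: integZ].
    + move=> w; rewrite normrX (@le_trans _ _ ((`|psi m| + M * `|X w - m|) ^+ 2))//.
        by rewrite lerXn2r ?nnegrE ?addr_ge0 ?mulr_ge0.
      rewrite -[in leRHS](real_normK (num_real (X w - m))).
      have := sqr_ge0 (`|psi m| - M * `|X w - m|); nra.
pose g := normal_pdf m s.
have [i1 e1] := normal_law_integral mpsi' ipsi'.
have mf2 : measurable_fun setT (fun x => psi x * (x - m)).
  by apply: measurable_funM => //; exact: measurable_funB.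
have [i2 e2] := normal_law_integral mf2 ipsi.
pose h x := psi' x * g x - (s ^+ 2)^-1 * (psi x * (x - m) * g x).
have dg (x : R) : is_derive x 1 g (- ((x - m) / s ^+ 2) * g x) by exact: is_derive_normal_pdf.
have cg : continuous g by move=> x; exact: deriv_continuous (dg x).
have dpg (x : R) : is_derive x 1 (fun y => psi y * g y) (h x).
  by apply: (is_derive_eq (derivM (dpsi x) (dg x))); rewrite /h; field.
have ch : continuous h.
  move=> x; apply: (@cvgB _ R^o); first by apply: cvgM; [exact: cpsi'|exact: cg].
  apply: cvgM; first exact: cvg_cst.
  apply: cvgM; last exact: cg.
  apply: cvgM; first exact: cpsi.
  by apply: (@cvgB _ R^o); [exact: cvg_id|exact: cvg_cst].
have ih : mu.-integrable setT (EFin \o h).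
  have := integrableB measurableT i1 (integrableZl measurableT (s ^+ 2)^-1 i2).
  by apply: eq_integrable.
have Eh : \int[mu]_x h x = \int[P]_w psi' (X w) -
    (s ^+ 2)^-1 * \int[P]_w (psi (X w) * (X w - m)).
  rewrite e1 e2 RintegralB//; last first.
    by have := integrableZl measurableT (s ^+ 2)^-1 i2; apply: eq_integrable.
  by rewrite RintegralZl.
have mh : measurable_fun setT h by exact: continuous_measurable_fun.
(* the boundary terms vanish, hence so does the integral of (psi g)' *)
pose I n : set R := [set` `[m - n.+1%:R, m + n.+1%:R]].
pose hn n := (EFin \o (h \_ (I n))).
have lim1 : (\int[mu]_x hn n x)%E @[n --> \oo] --> (\int[mu]_x (EFin \o h) x)%E.
  have := @dominated_convergence _ (measurableTypeR R) R mu setT measurableT hn (EFin \o h)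
    (fun x => `|(EFin \o h) x|%E).
  case.
  - move=> n; apply/measurable_EFinP.
    have mI : measurable (I n : set (measurableTypeR R)) by exact: measurable_itv.
    apply: (@measurable_restrictT _ _ (measurableTypeR R) _ (I n) h mI).1.
    exact: (measurable_funS measurableT (@subsetT _ _) mh).
  - exact/measurable_EFinP.
  - apply: aeW => x _; apply: cvg_near_cst.
    near=> n; rewrite /hn /= patchE mem_set// /I /= in_itv /=.
    rewrite -ler_distlC distrC.
    rewrite (@le_trans _ _ n%:R)// ?ler_nat//.
    by near: n; exact: nbhs_infty_ger.
  - by have := integrable_abse ih; apply: eq_integrable.
  - apply: aeW => x n _; rewrite /hn /= patchE; case: ifPn => // _.
    by rewrite /= ?normr0 lee_fin.
  - by [].
pose F y := psi y * g y.
have Ehn n : (\int[mu]_x hn n x = (F (m + n.+1%:R)%R)%:E - (F (m - n.+1%:R)%R)%:E)%E.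
  rewrite /hn -(continuous_FTC2 (F := F) (f := h)).
  - rewrite [RHS]integral_mkcond; apply: eq_integral => x _.
    by rewrite restrict_EFin.
  - by rewrite ltrD2l gtrN// ltr0n.
  - by apply: continuous_subspaceT.
  - split.
    + by move=> x _; have [] := dpg x.
    + by apply: cvg_at_right_filter; exact: deriv_continuous (dpg _).
    + by apply: cvg_at_left_filter; exact: deriv_continuous (dpg _).
  - by move=> x _; rewrite derive1E; have [_ ->] := dpg x.
(* At distance N = n + 1 from [m], [psi] is at most of order N and the density of order N^-2, so the
   boundary terms are at most C / N. *)
pose C := (`|psi m| + M) * (normal_peak s * (s ^+ 2 *+ 2)).
have bound n x : `|x - m| = n.+1%:R -> `|psi x * g x| <= C / n.+1%:R.
  move=> xn; rewrite ler_pdivlMr ?ltr0n// normrM.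
  rewrite [`|g x|]ger0_norm ?normal_pdf_ge0//.
  have gd : n.+1%:R ^+ 2 * g x <= normal_peak s * (s ^+ 2 *+ 2).
    by rewrite -xn real_normK ?num_real//; exact: normal_pdf_decay.
  have N1 : (1 : R) <= n.+1%:R by rewrite ler1n.
  have pl : `|psi x| <= (`|psi m| + M) * n.+1%:R.
    rewrite mulrDl (le_trans (psilin x))// xn lerD2r ler_peMr//.
  apply: (@le_trans _ _ ((`|psi m| + M) * n.+1%:R * g x * n.+1%:R)).
    by rewrite ler_wpM2r// ler_wpM2r// normal_pdf_ge0.
  rewrite (_ : _ * g x * _ = (`|psi m| + M) * (n.+1%:R ^+ 2 * g x)); last by ring.
  by rewrite ler_wpM2l ?addr_ge0.
have Cn : C / n.+1%:R @[n --> \oo] --> 0.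
  rewrite -(mulr0 C); apply: cvgM; first exact: cvg_cst.
  exact: (@cvg_harmonic R).
have lim0 (x : nat -> R) : (forall n, `|x n - m| = n.+1%:R) ->
    psi (x n) * g (x n) @[n --> \oo] --> 0.
  move=> xn; apply/cvgr0Pnorm_le => e e0; near=> n.
  apply: (le_trans (bound n _ (xn n))).
  apply: (le_trans (ler_norm _)); near: n.
  by move/cvgr0Pnorm_le : Cn; apply.
have limh : (\int[mu]_x hn n x)%E @[n --> \oo] --> 0%:E.
  under eq_fun do rewrite Ehn -EFinB.
  apply: cvg_EFin; first exact: nearW.
  rewrite -(subr0 0); apply: (@cvgB _ R^o); apply: lim0 => n.
  - by rewrite addrAC subrr add0r normr_nat.
  - by rewrite addrAC subrr add0r normrN normr_nat.
have h0 : \int[mu]_x h x = 0.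
  by rewrite /Rintegral (cvg_unique _ lim1 limh).
move: Eh; rewrite h0 => /eqP; rewrite eq_sym subr_eq0 => /eqP ->.
by rewrite mulrA divff ?mul1r// expf_neq0.
Unshelve. all: by end_near. Qed.

End stein_law.
End stein.

(** * Fourier annihilators *)

Section sign_limit.
Context (R : realType).

(** An odd polynomial with fixed points -1, 0 and 1 which maps [-1, 1] into itself; 0 repels and the
    other two attract, so the iterates tend to the sign. Being a polynomial, it can be applied
    inside an algebra of functions. *)
Let S (y : R) : R := (3 * y - y ^+ 3) / 2.

Let S_bound (y : R) : 0 < y <= 1 -> y <= S y <= 1 /\ 1 - S y <= (1 - y) * (1 - y / 2).
Proof.
move=> /andP[y0 y1]; have z0 : 0 <= 1 - y by lra.
have e1 : S y - y = y * (1 - y) * (1 + y) / 2 by rewrite /S; field.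
have e2 : 1 - S y = (1 - y) ^+ 2 * (2 + y) / 2 by rewrite /S; field.
have e3 : (1 - y) * (1 - y / 2) - (1 - S y) = (1 - y) * y ^+ 2 / 2.
  by rewrite /S; field.
split; last by rewrite -subr_ge0 e3 divr_ge0// mulr_ge0// sqr_ge0.
apply/andP; split; rewrite -subr_ge0 ?e1 ?e2 divr_ge0// !mulr_ge0 ?sqr_ge0//; lra.
Qed.

(** The iterates increase, so each step contracts the distance to 1 at least by the factor
    [1 - y / 2] of the starting point. *)
Let S_iter_pos (y : R) n : 0 < y <= 1 ->
  y <= iter n S y <= 1 /\ 1 - iter n S y <= (1 - y / 2) ^+ n.
Proof.
move=> /andP[y0 y1]; elim: n => [|n [/andP[h1 h2] h3]] /=.
  by rewrite lexx y1 expr0; split => //; lra.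
have [|/andP[k1 k2] k3] := S_bound (y := iter n S y).
  by rewrite h2 (lt_le_trans y0).
split; first by rewrite k2 (le_trans h1).
apply: (le_trans k3); rewrite exprSr ler_pM//; lra.
Qed.

Let S_odd (y : R) n : iter n S (- y) = - iter n S y.
Proof. by elim: n => //= n ->; rewrite /S; field. Qed.

Lemma iter_cubic_bound (y : R) n : `|y| <= 1 -> `|iter n S y| <= 1.
Proof.
move=> yl; elim: n => //= n ih; rewrite /S.
move: ih; rewrite !ler_norml; set z := iter n S y => /andP[h1 h2].
have e1 : (3 * z - z ^+ 3) / 2 + 1 = (1 + z) ^+ 2 * (2 - z) / 2 by field.
have e2 : 1 - (3 * z - z ^+ 3) / 2 = (1 - z) ^+ 2 * (2 + z) / 2 by field.
apply/andP; split; rewrite -subr_ge0 ?opprK ?e1 ?e2 divr_ge0// !mulr_ge0 ?sqr_ge0//; lra.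
Qed.

Lemma iter_cubic_cvg (y : R) : `|y| <= 1 ->
  iter n S y @[n --> \oo] --> Num.sg y.
Proof.
have pos (z : R) : 0 < z <= 1 -> iter n S z @[n --> \oo] --> (1 : R).
  move=> /andP[z0 z1].
  have g : (1 - z / 2) ^+ n @[n --> \oo] --> 0.
    by apply: cvg_expr; rewrite ger0_norm; lra.
  apply/cvgrPdist_le => e e0; near=> n.
  have [/andP[_ h1] h2] := @S_iter_pos z n (introT andP (conj z0 z1)).
  rewrite ger0_norm ?subr_ge0//; apply: (le_trans h2).
  apply: (le_trans (ler_norm _)); near: n.
  by move/cvgr0Pnorm_le : g; apply.
rewrite ler_norml => /andP[h1 h2].
case: (ltrgt0P y) => [y0|y0|->].
- by rewrite gtr0_sg//; apply: pos; rewrite y0.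
- rewrite ltr0_sg// (_ : (fun n => iter n S y) = (fun n => - iter n S (- y))).
    by apply: (@cvgN _ R^o); apply: pos; rewrite oppr_gt0 y0 lerNl h1.
  by apply/funext => n; rewrite S_odd opprK.
- rewrite sgr0 (_ : (fun n => iter n S 0) = cst 0); first exact: cvg_cst.
  by apply/funext => n /=; elim: n => //= n ->; rewrite /S; ring.
Unshelve. all: by end_near. Qed.

End sign_limit.

Section fourier_annihilator.
Context d (T : measurableType d) (R : realType) (P : probability T R).
Context (V : lmodType R) (W : V -> T -> R).
Hypothesis mW : forall h, measurable_fun setT (W h).
Hypothesis linW : forall (a : R) (h1 h2 : V),
  {ae P, forall w, W (a *: h1 + h2) w = a * W h1 w + W h2 w}.
Variable S : V -> Prop.
Hypothesis S0 : S 0.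
Hypothesis linS : forall (a : R) h1 h2, S h1 -> S h2 -> S (a *: h1 + h2).

Local Notation E X := (\int[P]_w X w).

(** [S] is a linear subspace. It is taken to be the orthogonal complement of a vector and the line
    spanned by that vector in the proof of independence, and the whole space in the proof of
    uniqueness of the divergence. *)
Definition fourier_null (D : T -> R) := integ P D /\
  forall h, S h -> E (fun w => D w * cos (W h w)) = 0 /\
                   E (fun w => D w * sin (W h w)) = 0.

(* The sum formulas for cos and sin make cos (W h) and sin (W h) such factors.
   They are stable under products, linear combinations and bounded limits,
   hence contain the indicators of the sets W h > a: the sign of x is the limit
   of the iterates of y |-> (3 y - y^3) / 2 at sin (x / L), as L grows. *)
Definition null_multiplier (m : T -> R) := [/\ measurable_fun setT m,
  exists M, forall w, `|m w| <= M &
  forall D, fourier_null D -> fourier_null (fun w => D w * m w)].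

Lemma gauss_lin0 : {ae P, forall w, W 0 w = 0}.
Proof.
have := linW 1 0 0; apply: filterS => w; rewrite scale1r addr0 mul1r.
by move=> ?; lra.
Qed.

Let mcos (X : T -> R) : measurable_fun setT X ->
  measurable_fun setT (fun w => cos (X w)).
Proof. by move=> mX; apply: measurableT_comp => //; apply: continuous_measurable_fun; exact: continuous_cos. Qed.

Let msin (X : T -> R) : measurable_fun setT X ->
  measurable_fun setT (fun w => sin (X w)).
Proof. by move=> mX; apply: measurableT_comp => //; apply: continuous_measurable_fun; exact: continuous_sin. Qed.

Let integ_cos D (X : T -> R) : integ P D -> measurable_fun setT X ->
  integ P (fun w => D w * cos (X w)).
Proof.
move=> iD mX; apply: (@integMb _ _ _ _ 1) => //; first exact: mcos.
by move=> w; rewrite ler_norml cos_geN1 cos_le1.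
Qed.

Let integ_sin D (X : T -> R) : integ P D -> measurable_fun setT X ->
  integ P (fun w => D w * sin (X w)).
Proof.
move=> iD mX; apply: (@integMb _ _ _ _ 1) => //; first exact: msin.
by move=> w; rewrite ler_norml sin_geN1 sin_le1.
Qed.

Lemma null_multiplier_ae (m m' : T -> R) : null_multiplier m -> measurable_fun setT m' ->
  (exists M, forall w, `|m' w| <= M) -> {ae P, forall w, m w = m' w} ->
  null_multiplier m'.
Proof.
move=> [mm [M mM] mD] mm' [M' mM'] mm'E; split => //; first by exists M'.
move=> D nD; have [iDm Dm] := mD D nD; have [iD _] := nD.
have iDm' : integ P (fun w => D w * m' w) by exact: integMb mM'.
split => // h Sh; have [h1 h2] := Dm h Sh.
split; [rewrite -h1|rewrite -h2]; apply: E_ae.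
- by apply: integ_meas; exact: integ_cos.
- by apply: integ_meas; exact: integ_cos.
- by apply: filterS mm'E => w ->.
- by apply: integ_meas; exact: integ_sin.
- by apply: integ_meas; exact: integ_sin.
- by apply: filterS mm'E => w ->.
Qed.

Lemma null_multiplier_mul (m m' : T -> R) : null_multiplier m -> null_multiplier m' ->
  null_multiplier (fun w => m w * m' w).
Proof.
move=> [mm [M mM] mD] [mm' [M' mM'] mD']; split.
- exact: measurable_funM.
- by exists (M * M') => w; rewrite normrM ler_pM//.
- by move=> D nD; have := mD' _ (mD _ nD); apply: (_ : forall f g, f = g -> fourier_null f -> fourier_null g); [by move=> f g ->|by apply/funext => w; rewrite mulrA].
Qed.

Lemma null_multiplier_lin (a b : R) (m m' : T -> R) : null_multiplier m -> null_multiplier m' ->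
  null_multiplier (fun w => a * m w + b * m' w).
Proof.
move=> [mm [M mM] mD] [mm' [M' mM'] mD']; split.
- by apply: measurable_funD; exact: measurable_funM.
- exists (`|a| * M + `|b| * M') => w; rewrite (le_trans (ler_normD _ _))//.
  by rewrite !normrM lerD// ler_wpM2l.
- move=> D nD; have [iDm Dm] := mD _ nD; have [iDm' Dm'] := mD' _ nD.
  have e : (fun w => D w * (a * m w + b * m' w)) =
    (fun w => a * (D w * m w) + b * (D w * m' w)).
    by apply/funext => w; ring.
  rewrite e; split; first by apply: integD; exact: integZ.
  move=> h Sh; have [h1 h2] := Dm h Sh; have [h3 h4] := Dm' h Sh.
  split.
  + transitivity (a * E (fun w => D w * m w * cos (W h w)) +
                  b * E (fun w => D w * m' w * cos (W h w))).
      rewrite -!E_Z -?E_D; [|exact/integZ/integ_cos|exact/integZ/integ_cos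
        |exact: integ_cos|exact: integ_cos].
      by apply: eq_Rintegral => w _; ring.
    by rewrite h1 h3 !mulr0 addr0.
  + transitivity (a * E (fun w => D w * m w * sin (W h w)) +
                  b * E (fun w => D w * m' w * sin (W h w))).
      rewrite -!E_Z -?E_D; [|exact/integZ/integ_sin|exact/integZ/integ_sin
        |exact: integ_sin|exact: integ_sin].
      by apply: eq_Rintegral => w _; ring.
    by rewrite h2 h4 !mulr0 addr0.
Qed.

Lemma null_multiplier_cst (a : R) : null_multiplier (fun=> a).
Proof.
split; [exact: measurable_cst|by exists (`|a|)|].
move=> D [iD nD]; split.
  by under eq_fun do rewrite mulrC; exact: integZ.
move=> h Sh; have [h1 h2] := nD h Sh; split.
- under eq_Rintegral do rewrite mulrAC mulrC.
  by rewrite E_Z ?h1 ?mulr0//; exact: integ_cos.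
- under eq_Rintegral do rewrite mulrAC mulrC.
  by rewrite E_Z ?h2 ?mulr0//; exact: integ_sin.
Qed.

Lemma null_multiplier_cvg (M : R) (m_ : nat -> T -> R) (m : T -> R) :
  (forall n, null_multiplier (m_ n)) -> (forall n w, `|m_ n w| <= M) ->
  (forall w, m_ n w @[n --> \oo] --> m w) -> null_multiplier m.
Proof.
move=> mm mM m_m.
have mem n : measurable_fun setT (m_ n) by case: (mm n).
have memm : measurable_fun setT m.
  by apply: (measurable_fun_cvg mem) => w _; exact: m_m.
have mMm w : `|m w| <= M.
  have c : `|m_ n w| @[n --> \oo] --> `|m w| by apply: cvg_norm; exact: m_m.
  rewrite -(cvg_lim (@Rhausdorff R) c); apply: limr_le; first by apply/cvg_ex; eexists; exact: c.
  by apply: nearW => n; exact: mM.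
split => //; first by exists M.
move=> D nD; have [iD _] := nD.
have iDm : integ P (fun w => D w * m w) by exact: integMb mMm.
split=> // h Sh.
have key (c : R -> R) : measurable_fun setT (c \o W h) -> (forall x, `|c x| <= 1) ->
    (forall n, E (fun w => D w * m_ n w * c (W h w)) = 0) ->
    E (fun w => D w * m w * c (W h w)) = 0.
  move=> mc c1 en.
  have mD : measurable_fun setT D by exact: integ_meas iD.
  have iM : integ P (fun w => M * `|D w|) by apply: integZ; exact: integ_norm.
  have [|||_] := @E_dct _ _ _ P (fun n w => D w * m_ n w * c (W h w))
    (fun w => D w * m w * c (W h w)) _ _ _ iM.
  - by move=> n; apply: measurable_funM; [exact: measurable_funM|exact: mc].
  - move=> w; apply: cvgM; last exact: cvg_cst.
    by apply: cvgM; [exact: cvg_cst|exact: m_m].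
  - move=> n w; rewrite 2!normrM (le_trans (ler_piMr _ (c1 _)))//.
    by rewrite mulrC ler_wpM2r.
  under eq_fun do rewrite en.
  by move=> h0; rewrite (cvg_unique _ h0 (cvg_cst _)).
have nn n := (let: And3 _ _ mD := mm n in mD D nD).
split.
- apply: key; first exact: mcos.
    by move=> x; rewrite ler_norml cos_geN1 cos_le1.
  by move=> n; have [_ /(_ h Sh)[]] := nn n.
- apply: key; first exact: msin.
    by move=> x; rewrite ler_norml sin_geN1 sin_le1.
  by move=> n; have [_ /(_ h Sh)[]] := nn n.
Qed.

(** [S] contains [h + k] and [k - h]. Expanding cos and sin there gives four linear equations in the
    four mixed products of [h] and [k], which force each of them to have mean 0 against [D]. *)
Lemma null_multiplier_trig h : S h ->
  null_multiplier (fun w => cos (W h w)) /\ null_multiplier (fun w => sin (W h w)).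
Proof.
move=> Sh.
have key D : fourier_null D -> forall k, S k ->
    [/\ E (fun w => D w * cos (W h w) * cos (W k w)) = 0,
     E (fun w => D w * cos (W h w) * sin (W k w)) = 0,
     E (fun w => D w * sin (W h w) * cos (W k w)) = 0 &
     E (fun w => D w * sin (W h w) * sin (W k w)) = 0].
  move=> [iD nD] k Sk; have mD := integ_meas iD.
  have [ep1 ep2] := nD _ (linS 1 Sh Sk).
  have [em1 em2] := nD _ (linS (-1) Sh Sk).
  have lp := linW 1 h k; have lm := linW (-1) h k.
  have AE (c : R -> R) (a : R) g : measurable_fun setT c ->
      (forall w, W (a *: h + k) w = a * W h w + W k w ->
         D w * c (W (a *: h + k) w) = g w) -> measurable_fun setT g ->
      E (fun w => D w * c (W (a *: h + k) w)) = E g.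
    move=> mc eg mg; apply: E_ae => //.
      by apply: measurable_funM => //; exact: measurableT_comp.
    by apply: filterS (linW a h k) => w; exact: eg.
  have mC : measurable_fun setT (@cos R).
    by apply: continuous_measurable_fun; exact: continuous_cos.
  have mS : measurable_fun setT (@sin R).
    by apply: continuous_measurable_fun; exact: continuous_sin.
  have i1 : integ P (fun w => D w * cos (W h w) * cos (W k w)).
    by do 2 apply: integ_cos => //.
  have i2 : integ P (fun w => D w * cos (W h w) * sin (W k w)).
    by apply: integ_sin => //; exact: integ_cos.
  have i3 : integ P (fun w => D w * sin (W h w) * cos (W k w)).
    by apply: integ_cos => //; exact: integ_sin.
  have i4 : integ P (fun w => D w * sin (W h w) * sin (W k w)).
    by do 2 apply: integ_sin => //.
  have e1 := AE _ 1 (fun w => D w * cos (W h w) * cos (W k w) -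
     D w * sin (W h w) * sin (W k w)) mC.
  have e2 := AE _ 1 (fun w => D w * sin (W h w) * cos (W k w) +
     D w * cos (W h w) * sin (W k w)) mS.
  have e3 := AE _ (-1) (fun w => D w * cos (W h w) * cos (W k w) +
     D w * sin (W h w) * sin (W k w)) mC.
  have e4 := AE _ (-1) (fun w => D w * cos (W h w) * sin (W k w) -
     D w * sin (W h w) * cos (W k w)) mS.
  rewrite e1 in ep1; first last.
  - by apply: (@integ_meas _ _ _ P); exact: integB.
  - by move=> w ->; rewrite mul1r cosD; ring.
  rewrite e2 in ep2; first last.
  - by apply: (@integ_meas _ _ _ P); exact: integD.
  - by move=> w ->; rewrite mul1r sinD; ring.
  rewrite e3 in em1; first last.
  - by apply: (@integ_meas _ _ _ P); exact: integD.
  - by move=> w ->; rewrite mulN1r addrC cosB; ring.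
  rewrite e4 in em2; first last.
  - by apply: (@integ_meas _ _ _ P); exact: integB.
  - by move=> w ->; rewrite mulN1r addrC sinB; ring.
  rewrite E_B// in ep1; rewrite E_D// in ep2; rewrite E_D// in em1.
  rewrite E_B// in em2.
  move: ep1 ep2 em1 em2.
  set x1 := Rintegral _ _ _; set x2 := Rintegral _ _ _.
  set x3 := Rintegral _ _ _; set x4 := Rintegral _ _ _.
  by move=> ? ? ? ?; split; lra.
split; split.
- exact: mcos.
- by exists 1 => w; rewrite ler_norml cos_geN1 cos_le1.
- move=> D nD; split; first by have [iD _] := nD; exact: integ_cos.
  by move=> k Sk; have [] := key D nD k Sk.
- exact: msin.
- by exists 1 => w; rewrite ler_norml sin_geN1 sin_le1.
- move=> D nD; split; first by have [iD _] := nD; exact: integ_sin.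
  by move=> k Sk; have [] := key D nD k Sk.
Qed.

(** The indicator is that of a version [X] of [W h]: a generated sigma-algebra depends on the
    versions chosen, and [W] agrees with [B] only almost surely. *)
Lemma null_multiplier_gt h (X : T -> R) (a : R) : S h -> measurable_fun setT X ->
  {ae P, forall w, W h w = X w} ->
  null_multiplier (fun w => (a < X w)%R%:R).
Proof.
move=> Sh mX WX; have W0 := gauss_lin0.
have sn (L : R) : null_multiplier (fun w => sin (L * (X w - a))).
  have [c s] := null_multiplier_trig (linS L Sh S0).
  apply: null_multiplier_ae (null_multiplier_lin (cos (L * a)) (- sin (L * a)) s c) _ _ _.
  - apply: (msin (X := fun w => L * (X w - a))).
    by apply: measurable_funM => //; exact: measurable_funB.
  - by exists 1 => w; rewrite ler_norml sin_geN1 sin_le1.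
  - have := linW L h 0; move: WX W0; apply: filterS3 => w e1 e2 ->.
    by rewrite e1 e2 addr0 mulrBr sinB; ring.
pose f (y : R) : R := (3 * y - y ^+ 3) / 2.
have sin1 x : `|sin x : R| <= 1 by rewrite ler_norml sin_geN1 sin_le1.
have it (L : R) n : null_multiplier (fun w => iter n f (sin (L * (X w - a)))).
  elim: n => [|n ih] /=; first exact: sn.
  have h3 := null_multiplier_mul ih (null_multiplier_mul ih ih).
  have := null_multiplier_lin (3 / 2) (- 2^-1) ih h3.
  by congr null_multiplier; apply/funext => w; rewrite /f; field.
have sg1 (L : R) : null_multiplier (fun w => Num.sg (sin (L * (X w - a)))).
  apply: (@null_multiplier_cvg 1 _ _ (it L)).
  - by move=> n w; exact: iter_cubic_bound.
  - by move=> w; exact: iter_cubic_cvg.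
(* At a fixed point, once n bounds |X w - a|, the argument of the sine lies strictly between -1 and
   1, where sine has the sign of its argument; the sequence is eventually constant. *)
have sg2 : null_multiplier (fun w => Num.sg (X w - a)).
  apply: (@null_multiplier_cvg 1 _ _ (fun n => sg1 n.+1%:R^-1)).
  - by move=> n w; rewrite normr_sg; case: (_ != 0).
  - move=> w; apply: cvg_near_cst; near=> n.
    set x := X w - a.
    have pos (z : R) : 0 < z -> z <= n%:R -> 0 < sin (n.+1%:R^-1 * z).
      move=> z0 zn; apply: sin_gt0_pihalf; rewrite mulr_gt0// ?invr_gt0//=.
      rewrite mulrC ltr_pdivrMr// (le_lt_trans zn)//.
      rewrite (@lt_le_trans _ _ n.+1%:R) ?ltr_nat// ler_peMl//.
      by have := pi_ge2 R; lra.
    have xn : `|x| <= n%:R by near: n; exact: nbhs_infty_ger.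
    case: (ltrgt0P x) xn => [x0|x0|->] xn.
    + by rewrite !gtr0_sg//; exact: pos.
    + rewrite [RHS]ltr0_sg// -[x]opprK mulrN sinN sgrN gtr0_sg//.
      by apply: pos; rewrite ?oppr_gt0.
    + by rewrite mulr0 sin0.
(* The indicator of x > 0 is (sg x + sg x ^ 2) / 2. *)
have := null_multiplier_lin 2^-1 2^-1 sg2 (null_multiplier_mul sg2 sg2).
congr null_multiplier; apply/funext => w.
rewrite -subr_gt0; case: (ltrgt0P (X w - a)) => [x0|x0|->].
- by rewrite gtr0_sg//=; field.
- by rewrite ltr0_sg//=; field.
- by rewrite sgr0 /=; ring.
Unshelve. all: by end_near. Qed.

(** A pi-lambda argument. The finite intersections [box l] of half-spaces are stable under
    intersection and generate the sigma-algebra; their indicators are products of multipliers. *)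
Lemma fourier_null_sigma (J : Type) (X : J -> T -> R) (D : T -> R) :
  (forall j, measurable_fun setT (X j)) ->
  (forall j, exists2 h, S h & {ae P, forall w, W h w = X j w}) ->
  fourier_null D ->
  forall A, <<s [set A | exists j, exists2 Y : set R, measurable Y & A = X j @^-1` Y] >> A ->
  measurable A /\ (\int[P]_(w in A) (D w)%:E = 0)%E.
Proof.
move=> mX WX nD; have [iD _] := nD.
pose box (l : seq (J * R)) : set T := [set w | all (fun p => p.2 < X p.1 w) l].
pose G : set (set T) := [set A | exists l, A = box l].
have mbox l : measurable (box l).
  elim: l => [|p l ih]; first by rewrite /box /= set_true; exact: measurableT.
  rewrite (_ : box (p :: l) = (X p.1) @^-1` `]p.2, +oo[%classic `&` box l).
    by apply: measurableI => //; rewrite -[X in measurable X]setTI; apply: mX.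
  apply/seteqP; split => w; rewrite /box /=.
    by move=> /andP[h1 h2]; rewrite in_itv/= andbT.
  by rewrite in_itv/= andbT => -[-> ->].
have boxmul l : null_multiplier (fun w => \1_(box l) w).
  elim: l => [|p l ih].
    have := null_multiplier_cst 1; congr null_multiplier; apply/funext => w.
    by rewrite indicE mem_set.
  have [h Sh hX] := WX p.1.
  have := null_multiplier_mul (null_multiplier_gt p.2 Sh (mX _) hX) ih.
  congr null_multiplier; apply/funext => w; rewrite !indicE -natrM mulnb.
  congr (nat_of_bool _)%:R; apply/andP/idP; rewrite !inE /box /=.
    by move=> [-> ->].
  by move=> /andP[-> h2]; split => //; rewrite inE.
have boxnull l : (\int[P]_(w in box l) (D w)%:E = 0)%E.
  (* At [h = 0] the cosine is almost surely 1, so nullity of [D] times the indicator is the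
     vanishing of the integral over the box. *)
  have [_ _ /(_ D nD)[iDb /(_ 0 S0)[e _]]] := boxmul l.
  rewrite integral_mkcond.
  transitivity ((E (fun w => D w * \1_(box l) w))%:E).
    rewrite /Rintegral fineK ?integrable_fin_num//.
    apply: eq_integral => w _; rewrite patchE indicE.
    by case: (w \in box l); rewrite ?mulr1 ?mulr0.
  congr EFin; rewrite -[RHS]e; apply: E_ae.
  - exact: integ_meas iDb.
  - by apply: measurable_funM; [exact: integ_meas iDb|exact: mcos].
  - by apply: filterS gauss_lin0 => w ->; rewrite cos0 mulr1.
pose Hs : set (set T) := [set A | measurable A /\ (\int[P]_(w in A) (D w)%:E = 0)%E].
have GI : setI_closed G.
  move=> _ _ [l1 ->] [l2 ->]; exists (l1 ++ l2); apply/seteqP; split => w; rewrite /box /= all_cat.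
    by move=> [-> ->].
  by move=> /andP[].
have T0 : (\int[P]_(w in setT) (D w)%:E = 0)%E.
  by have := boxnull [::]; rewrite /box /= set_true.
have dH : dynkin Hs.
  split.
  - by split.
  - move=> A [mA A0]; split; first exact: measurableC.
    have := T0; rewrite -(setUv A) integral_setU//.
    + by rewrite A0 add0e.
    + exact: measurableC.
    + rewrite setUv; apply/measurable_EFinP; exact: (integ_meas iD).
    + by apply/disj_setPS; rewrite setICr.
  - move=> F tF HF; split; first by apply: bigcupT_measurable => n; have [] := HF n.
    rewrite integral_bigcup//.
    + by apply: eseries0 => n _ _; have [] := HF n.
    + by move=> n; have [] := HF n.
    + apply: (integrableS measurableT) => //.
      by apply: bigcupT_measurable => n; have [] := HF n.
have sGH : <<s G >> `<=` Hs.
  rewrite -(setI_closed_g_dynkin_g_sigma_algebra GI).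
  apply: smallest_sub => //.
  by move=> _ [l ->]; split.
move=> A sA; apply: sGH; move: A sA; apply: smallest_sub.
  exact: smallest_sigma_algebra.
move=> _ [j [Y mY ->]].
have : measurable_fun [set: g_sigma_algebraType G] (X j).
  apply: (measurability _ (RGenOInfty.measurableE R)) => //.
  move=> /= _ [_ [a ->] <-]; rewrite setTI.
  apply: sub_sigma_algebra; exists [:: (j, a)].
  by apply/seteqP; split => w; rewrite /box /= in_itv/= !andbT.
by move=> /(_ measurableT Y mY); rewrite setTI.
Qed.

End fourier_annihilator.

(** * The isonormal process *)

Section dot_tools.
Context (R : realType) (H K T : R) (V : bif_hilbert H K T).
Implicit Types x y z : V.
Local Notation "<| x , y |>" := (dot V x y) (format "<| x ,  y |>").

Lemma dotC x y : <|x, y|> = <|y, x|>.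
Proof. by rewrite hermC /= expr0 mul1r. Qed.

Lemma dotDl x y z : <|x + y, z|> = <|x, z|> + <|y, z|>.
Proof. by rewrite linearDl. Qed.

Lemma dotZl (a : R) x z : <|a *: x, z|> = a * <|x, z|>.
Proof. by rewrite linearZl_LR. Qed.

Lemma dotDr z x y : <|z, x + y|> = <|z, x|> + <|z, y|>.
Proof. by rewrite dotC dotDl !(dotC _ z). Qed.

Lemma dotZr (a : R) z x : <|z, a *: x|> = a * <|z, x|>.
Proof. by rewrite dotC dotZl dotC. Qed.

Lemma dotNl x z : <|- x, z|> = - <|x, z|>.
Proof. by rewrite -scaleN1r dotZl mulN1r. Qed.

Lemma dotNr z x : <|z, - x|> = - <|z, x|>.
Proof. by rewrite dotC dotNl dotC. Qed.

Lemma dotBl x y z : <|x - y, z|> = <|x, z|> - <|y, z|>.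
Proof. by rewrite dotDl dotNl. Qed.

Lemma dotBr z x y : <|z, x - y|> = <|z, x|> - <|z, y|>.
Proof. by rewrite dotDr dotNr. Qed.

Lemma dot0l z : <|0, z|> = 0.
Proof. by rewrite -(scale0r z) dotZl mul0r. Qed.

Lemma dot0r z : <|z, 0|> = 0.
Proof. by rewrite dotC dot0l. Qed.

Lemma dot_suml (I : Type) (s : seq I) (F : I -> V) z :
  <|\sum_(i <- s) F i, z|> = \sum_(i <- s) <|F i, z|>.
Proof.
by elim: s => [|a s ih]; rewrite ?big_nil ?dot0l// !big_cons dotDl ih.
Qed.

Lemma dot_sumr (I : Type) (s : seq I) (F : I -> V) z :
  <|z, \sum_(i <- s) F i|> = \sum_(i <- s) <|z, F i|>.
Proof. by rewrite dotC dot_suml; apply: eq_bigr => i _; rewrite dotC. Qed.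

Lemma dot_cauchy_schwarz x y : `|<|x, y|>| <= `|x| * `|y|.
Proof.
rewrite -(@ler_pXn2r _ 2)// ?nnegrE ?mulr_ge0//.
rewrite exprMn -!dot_norm real_normK ?num_real//.
have [y0|y0] := eqVneq <|y, y|> 0.
  have : `|y| = 0 by apply/eqP; rewrite -sqrf_eq0 -dot_norm y0.
  by move=> /normr0_eq0 ->; rewrite !dot0r mulr0 expr0n.
have yp : 0 < <|y, y|> by rewrite lt_neqAle eq_sym y0 dot_norm sqr_ge0.
have : 0 <= <|<|y, y|> *: x - <|x, y|> *: y, <|y, y|> *: x - <|x, y|> *: y|>.
  by rewrite dot_norm sqr_ge0.
rewrite dotBl !dotBr !dotZl !dotZr (dotC y x) => h.
have : 0 <= <|y, y|> * (<|x, x|> * <|y, y|> - <|x, y|> ^+ 2).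
  by apply: le_trans h _; rewrite le_eqVlt; apply/orP; left; apply/eqP; ring.
by rewrite pmulr_rge0// subr_ge0.
Qed.

End dot_tools.

Lemma ae_eq_probability d (Omega : measurableType d) (R : realType)
    (P : probability Omega R) (X Y : Omega -> R) (A : set R) :
  measurable_fun setT X -> measurable_fun setT Y -> measurable A ->
  {ae P, forall w, X w = Y w} -> P (X @^-1` A) = P (Y @^-1` A).
Proof.
move=> mX mY mA XY.
have mXA : measurable (X @^-1` A) by rewrite -[X in measurable X]setTI; exact: mX.
have mYA : measurable (Y @^-1` A) by rewrite -[X in measurable X]setTI; exact: mY.
have e Z (mZ : measurable Z) : P Z = (\int[P]_w (\1_Z w)%:E)%E.
  by rewrite integral_indic// setIT.
rewrite (e _ mXA) (e _ mYA); apply: ae_eq_integral => //.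
- by apply/measurable_EFinP; exact: measurable_indic.
- by apply/measurable_EFinP; exact: measurable_indic.
- by apply: filterS XY => w h _; rewrite -[LHS]/((\1_A (X w))%:E) h.
Qed.

Section gaussian_space.
Context d (Omega : measurableType d) (R : realType) (P : probability Omega R).
Context (H K T : R) (B : R -> {RV P >-> R}).
Context (V : bif_hilbert H K T) (W : V -> {RV P >-> R}).
Hypothesis hB : is_bifBm H K T B.
Hypothesis hW : is_isonormal B W.
Local Notation E X := (\int[P]_w X w).
Local Notation "<| x , y |>" := (dot V x y) (format "<| x ,  y |>").

Lemma W_meas h : measurable_fun setT (W h).
Proof. exact: measurable_funPT. Qed.

Lemma B_meas t : measurable_fun setT (B t).
Proof. exact: measurable_funPT. Qed.

Lemma W_sqr_integ h : integ P (fun w => W h w ^+ 2).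
Proof.
apply/integrableP; split.
  by apply/measurable_EFinP; apply: measurable_funX; exact: W_meas.
have := isonormal_isometry hW h h; rewrite unlock => e.
rewrite (_ : (\int[P]_w _ = (<|h, h|>)%:E)%E) ?ltry// -e.
by apply: eq_integral => w _ /=; rewrite -expr2 ger0_norm// sqr_ge0.
Qed.

Lemma W_integ h : integ P (W h).
Proof. by apply: integ_sqr; [exact: W_meas|exact: W_sqr_integ]. Qed.

Lemma W_mul_integ h1 h2 : integ P (fun w => W h1 w * W h2 w).
Proof.
by apply: integ_mul; [exact: W_meas|exact: W_meas|exact: W_sqr_integ|exact: W_sqr_integ].
Qed.

Lemma W_isometry h1 h2 : E (fun w => W h1 w * W h2 w) = <|h1, h2|>.
Proof.
have := isonormal_isometry hW h1 h2.
by rewrite expE_fin; [move=> [] | exact: W_mul_integ].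
Qed.

Let linW := isonormal_linear hW.

Lemma W_zero : {ae P, forall w, W 0 w = 0}.
Proof. exact: (gauss_lin0 linW). Qed.

Lemma W_add h1 h2 : {ae P, forall w, W (h1 + h2) w = W h1 w + W h2 w}.
Proof. by have := linW 1 h1 h2; apply: filterS => w; rewrite scale1r mul1r. Qed.

Lemma W_addZ h1 (a : R) h2 :
  {ae P, forall w, W (h1 + a *: h2) w = W h1 w + a * W h2 w}.
Proof. by have := linW a h2 h1; apply: filterS => w; rewrite addrC => ->; rewrite addrC. Qed.

Lemma W_sub h1 h2 : {ae P, forall w, W (h1 - h2) w = W h1 w - W h2 w}.
Proof. by have := W_addZ h1 (-1) h2; apply: filterS => w; rewrite scaleN1r mulN1r. Qed.

(** For these elements [W h] is almost surely a finite combination of values of [B], so the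
    hypothesis on [B] gives its law directly; other elements are reached by density. *)
Definition is_step (h : V) := exists2 c, times_in T c & h = step_elt (ind V) c.

Lemma W_step c : times_in T c ->
  {ae P, forall w, W (step_elt (ind V) c) w = \sum_(p <- c) p.1 * B p.2 w}.
Proof.
elim: c => [|p c ih] tc.
  by apply: filterS W_zero => w; rewrite /step_elt !big_nil.
have tc' : times_in T c by move=> q qc; apply: tc; rewrite inE qc orbT.
have tp : p.2 \in `[0, T] by apply: tc; rewrite inE eqxx.
have := linW p.1 (ind V p.2) (step_elt (ind V) c).
move: (ih tc') (isonormal_ind hW tp); apply: filterS3 => w e1 e2.
by rewrite /step_elt !big_cons => ->; rewrite e1 e2.
Qed.

Lemma W_ind t : t \in `[0, T] -> {ae P, forall w, W (ind V t) w = B t w}.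
Proof. exact: isonormal_ind. Qed.

Lemma B_sqr_integ t : t \in `[0, T] -> integ P (fun w => B t w ^+ 2).
Proof.
move=> tT; apply: integ_ae (W_sqr_integ (ind V t)).
- by apply: measurable_funX; exact: B_meas.
- by apply: filterS (W_ind tT) => w ->.
Qed.

Lemma B_integ t : t \in `[0, T] -> integ P (B t).
Proof. by move=> tT; apply: integ_sqr; [exact: B_meas|exact: B_sqr_integ]. Qed.

Lemma W_step_mean h : is_step h -> E (W h) = 0.
Proof.
move=> [c tc ->].
have mB p : measurable_fun setT (fun w => p.1 * B p.2 w).
  by apply: measurable_funM => //; exact: B_meas.
have msum : measurable_fun setT (fun w => \sum_(p <- c) p.1 * B p.2 w).
  exact: measurable_sum.
rewrite (E_ae (W_meas _) msum (W_step tc)) {msum}.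
elim: c tc => [|p c ih] tc.
  by under eq_Rintegral do rewrite big_nil; rewrite E_cst.
have tc' : times_in T c by move=> q qc; apply: tc; rewrite inE qc orbT.
have tp : p.2 \in `[0, T] by apply: tc; rewrite inE eqxx.
under eq_Rintegral do rewrite big_cons.
have iB := B_integ tp.
have ic : integ P (fun w => \sum_(p <- c) p.1 * B p.2 w).
  apply: integ_ae (W_step tc') (W_integ _); exact: measurable_sum.
rewrite E_D ?ih ?addr0//; last exact: integZ.
rewrite E_Z//; have := bifBm_centered hB tp; rewrite expE_fin// => -[->].
by rewrite mulr0.
Qed.

Lemma W_step_law h : is_step h -> exists m s : R, forall A : set R, measurable A ->
  P (W h @^-1` A) = (if s == 0 then \d_m A else normal_prob m s A).
Proof.
move=> [c tc ->].
have [|m [s ms]] := @bifBm_gaussian _ _ _ _ _ _ _ _ hB (size c)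
  (fun i => (nth (0, 0) c i).1) (fun i => (nth (0, 0) c i).2).
  by move=> i; apply: tc; rewrite mem_nth.
exists m, s => A mA; rewrite -ms//; apply: ae_eq_probability => //.
- by apply: measurable_sum => i; apply: measurable_funM => //; exact: B_meas.
- apply: filterS (W_step tc) => w ->.
  by rewrite (big_nth (0, 0)) big_mkord.
Qed.

(** The law of [W h] comes with unknown parameters [m] and [s], which have to be identified as 0 and
    the norm of [h], the Dirac case included. *)
Lemma W_stein h (psi psi' : R -> R) (M : R) : is_step h ->
  (forall x : R, is_derive x 1 psi (psi' x)) ->
  continuous psi' -> (forall x, `|psi' x| <= M) ->
  E (fun w => psi (W h w) * W h w) = <|h, h|> * E (fun w => psi' (W h w)).
Proof.
move=> sh dpsi cpsi' psiM; have [m [s law]] := W_step_law sh.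
have mean := W_step_mean sh.
have iW := W_integ h; have iW2 := W_sqr_integ h.
(* In the Dirac case the zero mean forces [W h = 0] almost surely, and both sides vanish. *)
have [s0|s0] := eqVneq s 0.
  have W0 : {ae P, forall w, W h w = m}.
    exists (W h @^-1` [set~ m]); split.
    - rewrite -[X in measurable X]setTI; apply: W_meas => //.
      by apply: measurableC; exact: measurable_set1.
    - rewrite law; last by apply: measurableC; exact: measurable_set1.
      rewrite s0 eqxx diracE (_ : m \in [set~ m] = false)//.
      by apply/negbTE; rewrite notin_setE /=; apply.
    - by move=> w /=.
  have m0 : m = 0.
    rewrite -mean -[LHS](E_cst P); apply: E_ae => //.
    by apply: filterS W0 => w ->.
  have WW : {ae P, forall w, W h w = 0} by apply: filterS W0 => w ->.
  have -> : <|h, h|> = 0.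
    rewrite -W_isometry -[RHS](E_cst P); apply: E_ae => //.
      by apply: measurable_funM; exact: W_meas.
    by apply: filterS WW => w ->; rewrite mul0r.
  rewrite mul0r -[RHS](E_cst P); apply: E_ae => //.
    apply: measurable_funM; last exact: W_meas.
    apply: measurableT_comp; last exact: W_meas.
    by apply: continuous_measurable_fun => x; exact: deriv_continuous (dpsi x).
  by apply: filterS WW => w ->; rewrite mulr0.
have law' A : measurable A -> P (W h @^-1` A) = normal_prob m s A.
  by move=> mA; rewrite law// (negbTE s0).
have st := stein_normal s0 law' iW2.
(* Stein's identity itself yields the parameters: [psi = 1] gives the mean and the identity function
   gives the variance. *)
have m0 : m = 0.
  have := st (fun=> 1) (fun=> 0) 0 (fun x => deriv_cst 1 x).
  rewrite E_cst mulr0 => /(_ _ _)e.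
  have {}e : E (fun w => 1 * (W h w - m)) = 0.
    by apply: e => [x|x]; [exact: cvg_cst|rewrite normr0].
  move: e; under eq_Rintegral do rewrite mul1r.
  rewrite E_B//; last exact: integ_cst.
  by rewrite mean E_cst sub0r => /eqP; rewrite oppr_eq0 => /eqP.
have ss : s ^+ 2 = <|h, h|>.
  have := st (fun x => x) (fun=> 1) 1 (fun x => deriv_id x).
  rewrite E_cst mulr1 => <- => [|x|x].
  - by rewrite -W_isometry; apply: eq_Rintegral => w _; rewrite m0 subr0.
  - exact: cvg_cst.
  - by rewrite normr1.
rewrite -ss -(st _ _ _ dpsi cpsi' psiM).
by apply: eq_Rintegral => w _; rewrite m0 subr0.
Qed.

End gaussian_space.

(** * Smooth functionals *)

Section row_measurable.
Context d (T : measurableType d) (R : realType) (n : nat).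

(** An open set of rows is the union of the balls it contains that have a rational centre and radius
    1 / (k + 1). There are countably many of them, and the preimage of such a ball is a finite
    intersection of measurable sets. *)
Lemma measurable_row_open (x : 'I_n -> T -> R) (O : set 'rV[R]_n) :
  (forall i, measurable_fun setT (x i)) -> open O ->
  measurable [set w | O (\row_i x i w)].
Proof.
move=> mx oO.
pose r (q : {ffun 'I_n -> rat}) : 'rV[R]_n := \row_i ratr (q i).
pose F (p : {ffun 'I_n -> rat} * nat) : set T :=
  if `[< ball (r p.1) p.2.+1%:R^-1 `<=` O >]
  then [set w | forall i, `|ratr (p.1 i) - x i w| < p.2.+1%:R^-1] else set0.
rewrite (_ : [set w | O (\row_i x i w)] = \bigcup_p F p).
  apply: countable_bigcupT_measurable => // -[q k]; rewrite /F /=.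
  case: ifP => // _.
  rewrite (_ : [set w | _] =
    \bigcap_(i in [set: 'I_n]) [set w | `|ratr (q i) - x i w| < k.+1%:R^-1]).
    apply: fin_bigcap_measurable => // i _.
    rewrite (_ : [set w | _] = (fun w => `|ratr (q i) - x i w|) @^-1` `]-oo, k.+1%:R^-1[%classic).
      rewrite -[X in measurable X]setTI.
      have : measurable_fun setT (fun w => `|ratr (q i) - x i w|).
        by apply: measurableT_comp => //; exact: measurable_funB.
      by apply => //; exact: measurable_itv.
    by apply/seteqP; split => w /=; rewrite in_itv.
  by apply/seteqP; split => w /= h i; [move=> _; exact: h|exact: h i I].
apply/seteqP; split => [w Ow|w [[q k] _]]; last first.
  rewrite /F /=; case: ifP => // /asboolP bO h; apply: bO.
  split; first by rewrite invr_gt0.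
  by move=> i j; rewrite /ball /= !mxE; exact: h.
have /nbhs_ballP[e /= e0 eO] : nbhs (\row_i x i w) O by exact: open_nbhs_nbhs.
(* A radius below e / 2 keeps the ball around the rational point inside the ball of radius e around
   the given row. *)
have [k ke] : exists k : nat, k.+1%:R^-1 < e / 2.
  have e2 : 0 < e / 2 by rewrite divr_gt0.
  have := @cvg_harmonic R => /cvgrPdist_lt /(_ _ e2) [k _ /(_ k (leqnn k))] /=.
  rewrite sub0r normrN ger0_norm ?invr_ge0// => ke.
  by exists k.
have k0 : (0 : R) < k.+1%:R^-1 by rewrite invr_gt0.
have qi i : exists q : rat, `|ratr q - x i w| < k.+1%:R^-1.
  have [|q] := @rat_in_itvoo R (x i w) (x i w + k.+1%:R^-1); first by rewrite ltrDl.
  rewrite in_itv /= => /andP[h1 h2]; exists q.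
  by rewrite gtr0_norm ?subr_gt0// ltrBlDl.
have /choice[q hq] := qi.
exists ([ffun i => q i], k) => //; rewrite /F /=.
rewrite asboolT; first by move=> i /=; rewrite ffunE.
move=> z [_ rz]; apply: eO; split => // i j; rewrite ord1 mxE.
have := rz ord0 j; rewrite /ball /= !mxE ffunE => h.
rewrite -[X in `|X|](subrKA (ratr (q j))) (le_lt_trans (ler_normD _ _))//.
rewrite [e](splitr e) ltrD//; last exact: lt_trans h ke.
by rewrite distrC (lt_trans (hq j)).
Qed.

Lemma measurable_row_continuous (x : 'I_n -> T -> R) (G : 'rV[R]_n -> R) :
  (forall i, measurable_fun setT (x i)) -> continuous G ->
  measurable_fun setT (fun w => G (\row_i x i w)).
Proof.
move=> mx cG.
apply: (measurability _ (RGenOInfty.measurableE R)) => //.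
move=> /= _ [_ [a ->] <-]; rewrite setTI.
have := @measurable_row_open x (G @^-1` `]a, +oo[%classic) mx; apply.
by apply: open_comp => [z _|]; [exact: cG|exact: interval_open].
Qed.

End row_measurable.

Section smooth_functions.
Context (R : realType) (n : nat).
Implicit Types (G : 'rV[R]_n -> R) (c x : 'rV[R]_n).

Lemma Cb_infty_partial G i : Cb_infty G -> Cb_infty (partial G i).
Proof. by move=> hG s; exact: (hG (i :: s)). Qed.

Lemma Cb_infty_bounded G : Cb_infty G -> exists M, forall x, `|G x| <= M.
Proof. by move=> /(_ [::])[]. Qed.

Lemma Cb_infty_continuous G : Cb_infty G -> continuous G.
Proof. by move=> /(_ [::])[]. Qed.

Lemma Cb_infty_line G i x (s : R) : Cb_infty G ->
  is_derive s 1 (fun t : R => G (x + t *: delta_mx 0 i))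
    (partial G i (x + s *: delta_mx 0 i)).
Proof.
move=> /(_ [::])[_ dG _] /=.
set y := x + s *: delta_mx 0 i; have dGy := dG i y.
have e : (fun h : R => h^-1 *: (((fun t : R => G (x + t *: delta_mx 0 i)) \o shift s)
      (h *: (1 : R)) - G y)) =
    (fun h => h^-1 *: ((G \o shift y) (h *: delta_mx 0 i) - G y)).
  apply/funext => h /=; congr (_ *: (G _ - _)).
  by rewrite (_ : h *: (1 : R) = h) ?scalerDl 1?addrCA //; exact: mulr1.
apply: DeriveDef; first by rewrite /derivable e; exact: dGy.
by rewrite /derive e.
Qed.

Lemma Cb_infty_line_lip G i : Cb_infty G -> exists2 M, 0 <= M &
  forall x (a : R), `|G (x + a *: delta_mx 0 i) - G x| <= M * `|a|.
Proof.
move=> hG; have [M hM] := Cb_infty_bounded (Cb_infty_partial i hG).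
have M0 : 0 <= M by exact: le_trans (hM 0).
exists M => // x a.
have := deriv_lip (fun s => Cb_infty_line i x s hG) (fun s => hM _) 0 a.
by rewrite scale0r addr0 subr0.
Qed.

Lemma Cb_infty_line_taylor G i : Cb_infty G -> exists2 M, 0 <= M &
  forall x (a : R), `|G (x + a *: delta_mx 0 i) - G x - a * partial G i x|
    <= M * a ^+ 2.
Proof.
move=> hG; have hG' := Cb_infty_partial i hG.
have [M hM] := Cb_infty_bounded (Cb_infty_partial i hG').
have M0 : 0 <= M by exact: le_trans (hM 0).
exists M => // x a.
have := deriv_taylor2 (fun s => Cb_infty_line i x s hG)
  (fun s => Cb_infty_line i x s hG') (fun s => hM _) 0 a.
by rewrite scale0r addr0 subr0 mulrC.
Qed.

(** [Cb_infty] speaks of derivatives along the coordinate axes only. A displacement along [c] is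
    therefore made one coordinate at a time, by induction on the list of the coordinates already
    moved. *)
Let part c (l : seq 'I_n) : 'rV[R]_n := \sum_(i <- l) c 0 i *: delta_mx 0 i.

Let part_full c : part c (enum 'I_n) = c.
Proof. by rewrite /part big_enum /= -row_sum_delta. Qed.

Let part_lip G c l : Cb_infty G -> exists2 M, 0 <= M &
  forall x (a : R), `|G (x + a *: part c l) - G x| <= M * `|a|.
Proof.
move=> hG; elim: l => [|i l [M M0 ih]].
  exists 0 => // x a; rewrite /part big_nil scaler0 addr0 subrr normr0 mul0r//.
have [N N0 hN] := Cb_infty_line_lip i hG.
exists (N * `|c 0 i| + M) => [|x a]; first by rewrite addr_ge0// mulr_ge0.
rewrite {1}/part big_cons -/(part c l).
set z := x + a *: part c l.
have -> : x + a *: (c 0 i *: delta_mx 0 i + part c l) = z + (a * c 0 i) *: delta_mx 0 i.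
  by rewrite /z scalerDr scalerA [X in x + X]addrC addrA.
rewrite -(subrKA (G z)) (le_trans (ler_normD _ _))// mulrDl lerD ?ih//.
by rewrite (le_trans (hN _ _))// normrM -mulrA [`|c 0 i| * _]mulrC.
Qed.

Lemma Cb_infty_dir_taylor G c : Cb_infty G -> exists2 M, 0 <= M &
  forall x (a : R), `|G (x + a *: c) - G x -
    a * \sum_(i < n) c 0 i * partial G i x| <= M * a ^+ 2.
Proof.
move=> hG.
suff H l : exists2 M, 0 <= M & forall x (a : R), `|G (x + a *: part c l) - G x -
    a * \sum_(i <- l) c 0 i * partial G i x| <= M * a ^+ 2.
  have [M M0 h] := H (enum 'I_n); exists M => // x a.
  by have := h x a; rewrite part_full big_enum.
elim: l => [|i l [M M0 ih]].
  exists 0 => // x a; rewrite /part !big_nil scaler0 addr0 subrr mulr0 subr0.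
  by rewrite normr0 mul0r.
have [N N0 hN] := Cb_infty_line_taylor i hG.
have [L L0 hL] := part_lip c l (Cb_infty_partial i hG).
exists (N * (c 0 i) ^+ 2 + `|c 0 i| * L + M) => [|x a].
  by rewrite addr_ge0// addr_ge0// mulr_ge0// sqr_ge0.
rewrite /part !big_cons -/(part c l).
set z := x + a *: part c l.
have -> : x + a *: (c 0 i *: delta_mx 0 i + part c l) = z + (a * c 0 i) *: delta_mx 0 i.
  by rewrite /z scalerDr scalerA [X in x + X]addrC addrA.
set D := \sum_(j <- l) _.
(* Taylor's bound at [z] along coordinate [i], the change of the partial derivative between [x] and
   [z], and the induction hypothesis. *)
have -> : G (z + (a * c 0 i) *: delta_mx 0 i) - G x - a * (c 0 i * partial G i x + D) =
  (G (z + (a * c 0 i) *: delta_mx 0 i) - G z - (a * c 0 i) * partial G i z) +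
  (a * c 0 i) * (partial G i z - partial G i x) + (G z - G x - a * D) by ring.
rewrite (le_trans (ler_normD _ _))// mulrDl lerD ?ih//.
rewrite (le_trans (ler_normD _ _))// mulrDl lerD//.
  by rewrite (le_trans (hN _ _))// exprMn mulrCA [a ^+ 2 * _]mulrC mulrA.
rewrite normrM normrM (@le_trans _ _ (`|a| * `|c 0 i| * (L * `|a|)))//.
  by rewrite ler_wpM2l// ?mulr_ge0// hL.
by rewrite -(real_normK (num_real a)) le_eqVlt; apply/orP; left; apply/eqP; ring.
Qed.

Lemma Cb_infty_derive_line G x c (s : R) : Cb_infty G ->
  is_derive s 1 (fun v : R => G (x + v *: c))
    (\sum_(i < n) c 0 i * partial G i (x + s *: c)).
Proof.
move=> hG; have [M M0 hM] := Cb_infty_dir_taylor c hG.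
apply: (@is_derive_quadratic_bound _ _ _ _ M) => v.
have := hM (x + s *: c) (v - s).
rewrite (_ : x + s *: c + (v - s) *: c = x + v *: c); last first.
  by rewrite -addrA -scalerDl [s + _]addrC subrK.
by rewrite [(v - s) * _]mulrC.
Qed.

Lemma Cb_infty_partial_sum_bound G c : Cb_infty G -> exists M, forall x,
  `|\sum_(i < n) c 0 i * partial G i x| <= M.
Proof.
move=> hG.
have /choice[M hM] : forall i, exists M, forall x, `|partial G i x| <= M.
  by move=> i; exact: Cb_infty_bounded (Cb_infty_partial i hG).
exists (\sum_(i < n) `|c 0 i| * M i) => x.
rewrite (le_trans (ler_norm_sum _ _ _))// ler_sum// => i _.
by rewrite normrM ler_wpM2l.
Qed.

End smooth_functions.

(** * Characteristic functions of the Gaussian variables *)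

Lemma gaussian_ode (R : realType) (v : R) (phi : R -> R) :
  (forall l : R, is_derive l 1 phi (- (v * l) * phi l)) ->
  forall l, phi l = phi 0 * expR (- (v * l ^+ 2 / 2)).
Proof.
move=> dphi l.
pose u x := phi x * expR (v * x ^+ 2 / 2).
have du (x : R) : is_derive x 1 u 0.
  have h : is_derive x 1 (fun x : R => v * x ^+ 2 / 2) (v * x).
    rewrite (_ : (fun x => _) = fun x : R => (v / 2) * (x - 0) ^+ 2); last first.
      by apply/funext => z; rewrite subr0; field.
    by apply: (is_derive_eq (derivZ (v / 2) (deriv_sqr 0 x))); field.
  have := derivM (dphi x) (deriv_comp (is_derive_expR _) h).
  by move=> h'; apply: (is_derive_eq h'); ring.
have := deriv_lip (M := 0) du (fun=> _) 0 l.
move=> /(_ _)k; have {k} : `|u l - u 0| <= 0 * `|l - 0|.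
  by apply: k => x; rewrite normr0.
rewrite mul0r normr_le0 subr_eq0 => /eqP; rewrite /u expr0n mulr0 mul0r expR0 mulr1.
by move=> <-; rewrite -mulrA -expRD subrr expR0 mulr1.
Qed.

Lemma E_abs_sqr d (T : measurableType d) (R : realType) (P : probability T R)
    (X : T -> R) : measurable_fun setT X -> integ P (fun w => X w ^+ 2) ->
  (\int[P]_w `|X w|) ^+ 2 <= \int[P]_w (X w ^+ 2).
Proof.
move=> mX iX2; have iX := integ_norm (integ_sqr mX iX2).
set a := \int[P]_w `|X w|.
have : 0 <= \int[P]_w ((`|X w| - a) ^+ 2) by apply: E_ge0 => w; exact: sqr_ge0.
rewrite (_ : \int[P]_w _ = \int[P]_w (X w ^+ 2 + ((- (2 * a)) * `|X w| + a ^+ 2))); last first.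
  by apply: eq_Rintegral => w _; rewrite -[X w ^+ 2](real_normK (num_real _)); ring.
rewrite E_D//; last by apply: integD; [exact: integZ|exact: integ_cst].
rewrite E_D; [|exact: integZ|exact: integ_cst].
rewrite E_Z// E_cst -/a; nra.
Qed.

Lemma E_abs_le_sqrt d (T : measurableType d) (R : realType) (P : probability T R)
    (X : T -> R) (a : R) : measurable_fun setT X -> integ P (fun w => X w ^+ 2) ->
  0 <= a -> \int[P]_w (X w ^+ 2) <= a ^+ 2 -> \int[P]_w `|X w| <= a.
Proof.
move=> mX iX a0 Xa; rewrite -(@ler_pXn2r _ 2)// ?nnegrE ?E_ge0//.
exact: le_trans (E_abs_sqr mX iX) Xa.
Qed.

Section gaussian_independence.
Context d (Omega : measurableType d) (R : realType) (P : probability Omega R).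
Context (H K T : R) (B : R -> {RV P >-> R}).
Context (V : bif_hilbert H K T) (W : V -> {RV P >-> R}).
Hypothesis hB : is_bifBm H K T B.
Hypothesis hW : is_isonormal B W.
Local Notation E X := (\int[P]_w X w).
Local Notation "<| x , y |>" := (dot V x y) (format "<| x ,  y |>").
Let linW := isonormal_linear hW.

(** The derivative is E[f'(l W h) W h], which Stein's identity for x |-> f'(l x) transforms. For
    [cos] and [sin] one has f'' = - f, and the result is the linear equation of [gaussian_ode]. *)
Lemma W_trig_derive (f f' f'' : R -> R) h (l : R) : is_step h ->
  (forall x : R, is_derive x 1 f (f' x)) ->
  (forall x : R, is_derive x 1 f' (f'' x)) -> continuous f'' ->
  (forall x, `|f x| <= 1) -> (forall x, `|f' x| <= 1) ->
  (forall x, `|f'' x| <= 1) ->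
  is_derive l 1 (fun l => E (fun w => f (l * W h w)))
    (<|h, h|> * l * E (fun w => f'' (l * W h w))).
Proof.
move=> sh df df' cf'' f1 f1' f1''.
have cf : continuous f by move=> x; exact: deriv_continuous (df x).
have cf' : continuous f' by move=> x; exact: deriv_continuous (df' x).
have mf := continuous_measurable_fun cf.
have mf' := continuous_measurable_fun cf'.
have mf'' := continuous_measurable_fun cf''.
have mW := W_meas W h.
have mlW k : measurable_fun setT (fun w => k * W h w) by exact: measurable_funM.
have iW := W_integ hW h; have iW2 := W_sqr_integ hW h.
have bc (g : R -> R) k : measurable_fun setT g -> (forall x, `|g x| <= 1) ->
    integ P (fun w => g (k * W h w)).
  move=> mg g1; apply: (@integ_bounded _ _ _ _ _ 1) => //.
  exact: measurableT_comp.
have st : E (fun w => f' (l * W h w) * W h w) = <|h, h|> * (l * E (fun w => f'' (l * W h w))).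
  rewrite -E_Z; last exact: bc.
  apply: (W_stein (psi := fun x => f' (l * x)) (psi' := fun x => l * f'' (l * x)) (M := `|l|) hB hW sh).
  - move=> x; have := deriv_comp (df' (l * x)) (derivZ l (deriv_id x)).
    by move=> h'; apply: (is_derive_eq h'); ring.
  - move=> x; apply: cvgM; first exact: cvg_cst.
    apply: (cvg_comp _ f''); last exact: cf''.
    by apply: cvgM; [exact: cvg_cst|exact: cvg_id].
  - by move=> x; rewrite normrM ler_piMr.
have if'W : integ P (fun w => f' (l * W h w) * W h w).
  have -> : (fun w => f' (l * W h w) * W h w) = (fun w => W h w * f' (l * W h w)).
    by apply/funext => w; rewrite mulrC.
  by apply: (@integMb _ _ _ _ 1) => //; exact: measurableT_comp.
apply: (@is_derive_quadratic_bound _ _ _ _ <|h, h|>) => k.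
rewrite -mulrA -st mulrC -E_Z//.
rewrite -E_B ?bc// -E_B//; last exact: integZ; last by apply: integB; exact: bc.
rewrite -(W_isometry hW) mulrC -E_Z; last exact: (W_mul_integ hW).
apply: E_abs_le.
- by apply: (@integ_meas _ _ _ P); apply: integB; [apply: integB; exact: bc|exact: integZ].
- by apply: integZ; exact: (W_mul_integ hW).
- move=> w; have := deriv_taylor2 df df' f1'' (l * W h w) (k * W h w).
  rewrite -mulrBl mul1r => h1.
  rewrite (_ : (k - l) * (f' _ * _) = f' (l * W h w) * ((k - l) * W h w)); last by ring.
  by apply: (le_trans h1); rewrite exprMn (expr2 (W h w)).
Qed.

Let mcos h : measurable_fun setT (fun w => cos (W h w)).
Proof.
apply: measurableT_comp; last exact: W_meas.
by apply: continuous_measurable_fun; exact: continuous_cos.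
Qed.

Let msin h : measurable_fun setT (fun w => sin (W h w)).
Proof.
apply: measurableT_comp; last exact: W_meas.
by apply: continuous_measurable_fun; exact: continuous_sin.
Qed.

Let cos1 (x : R) : `|cos x| <= 1.
Proof. by rewrite ler_norml cos_geN1 cos_le1. Qed.

Let sin1 (x : R) : `|sin x| <= 1.
Proof. by rewrite ler_norml sin_geN1 sin_le1. Qed.

Let icos h : integ P (fun w => cos (W h w)).
Proof. by apply: (@integ_bounded _ _ _ _ _ 1) => //; exact: mcos. Qed.

Let isin h : integ P (fun w => sin (W h w)).
Proof. by apply: (@integ_bounded _ _ _ _ _ 1) => //; exact: msin. Qed.

Let continuousNcos : continuous (fun x : R => - cos x).
Proof. by move=> x; apply: (@cvgN _ R^o); exact: continuous_cos. Qed.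

Let continuousNsin : continuous (fun x : R => - sin x).
Proof. by move=> x; apply: (@cvgN _ R^o); exact: continuous_sin. Qed.

Let deriveNsin (x : R) : is_derive x 1 (fun x : R => - sin x) (- cos x).
Proof.
rewrite (_ : (fun x => - sin x) = fun x => (-1) * sin x); last first.
  by apply/funext => z; rewrite mulN1r.
by apply: (is_derive_eq (derivZ (-1) (is_derive_sin x))); rewrite mulN1r.
Qed.

Let W_step_char h : is_step h ->
  E (fun w => cos (W h w)) = expR (- (<|h, h|> / 2)) /\ E (fun w => sin (W h w)) = 0.
Proof.
move=> sh.
have dc (l : R) := @W_trig_derive (@cos R) (fun x => - sin x) (fun x => - cos x) h l sh
  (@is_derive_cos R) deriveNsin continuousNcos cos1
  (fun x => eq_ind_r (fun z => z <= 1) (sin1 x) (normrN _))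
  (fun x => eq_ind_r (fun z => z <= 1) (cos1 x) (normrN _)).
have ds (l : R) := @W_trig_derive (@sin R) (@cos R) (fun x => - sin x) h l sh
  (@is_derive_sin R) (@is_derive_cos R) continuousNsin sin1 cos1
  (fun x => eq_ind_r (fun z => z <= 1) (sin1 x) (normrN _)).
have EN (f : R -> R) (l : R) : measurable_fun setT f -> (forall x, `|f x| <= 1) ->
   E (fun w => - f (l * W h w)) = - E (fun w => f (l * W h w)).
  move=> mf f1; rewrite -mulN1r -E_Z.
    by apply: eq_Rintegral => w _; rewrite mulN1r.
  apply: (@integ_bounded _ _ _ _ _ 1) => //.
  by apply: measurableT_comp => //; apply: measurable_funM => //; exact: W_meas.
have mc := continuous_measurable_fun (@continuous_cos R).
have ms := continuous_measurable_fun (@continuous_sin R).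
split.
- pose phi l := E (fun w => cos (l * W h w)).
  have dphi (l : R) : is_derive l 1 phi (- (<|h, h|> * l) * phi l).
    by apply: (is_derive_eq (dc l)); rewrite EN// mulrN mulNr.
  transitivity (phi 1).
    by apply: eq_Rintegral => w _; rewrite mul1r.
  have phi0 : phi 0 = 1.
    by rewrite -[RHS](E_cst P); apply: eq_Rintegral => w _; rewrite mul0r cos0.
  by rewrite (gaussian_ode dphi) phi0 ?mul1r ?mul0r// expr1n mulr1.
- pose phi l := E (fun w => sin (l * W h w)).
  have dphi (l : R) : is_derive l 1 phi (- (<|h, h|> * l) * phi l).
    by apply: (is_derive_eq (ds l)); rewrite EN// mulrN mulNr.
  transitivity (phi 1).
    by apply: eq_Rintegral => w _; rewrite mul1r.
  have phi0 : phi 0 = 0.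
    by rewrite -[RHS](E_cst P); apply: eq_Rintegral => w _; rewrite mul0r sin0.
  by rewrite (gaussian_ode dphi) phi0 ?mul1r ?mul0r// expr1n mulr1.
Qed.

Lemma step_dense (h : V) (e : R) : 0 < e -> exists2 y, is_step y & `|h - y| < e.
Proof.
move=> e0; have : closure [set h | exists2 c, times_in T c & h = step_elt (ind V) c] h.
  by rewrite ind_dense.
move=> /(_ (ball h e)) [|y [[c tc yc]]]; first exact: nbhsx_ballx.
by rewrite -ball_normE /= => hy; exists y => //; exists c.
Qed.

(** The derivative is at most 1 in absolute value, since |z| <= 1 + z^2 / 2 <= exp(z^2 / 2). It
    makes the Gaussian characteristic function 1-Lipschitz in the norm of [h]. *)
Let expR_sqr_lip (x y : R) : `|expR (- (y ^+ 2 / 2)) - expR (- (x ^+ 2 / 2))| <= `|y - x|.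
Proof.
rewrite -[leRHS]mul1r.
apply: (@deriv_lip R (fun x => expR (- (x ^+ 2 / 2))) (fun x => - x * expR (- (x ^+ 2 / 2))) 1).
- move=> z; have h : is_derive z 1 (fun x : R => - (x ^+ 2 / 2)) (- z).
    rewrite (_ : (fun x => _) = fun x : R => (- 2^-1) * (x - 0) ^+ 2); last first.
      by apply/funext => u; rewrite subr0; field.
    by apply: (is_derive_eq (derivZ _ (deriv_sqr 0 z))); field.
  have := deriv_comp (is_derive_expR _) h.
  by move=> h'; apply: (is_derive_eq h'); ring.
- move=> z; rewrite normrM normrN [`|expR _|]ger0_norm ?expR_ge0//.
  rewrite expRN ler_pdivrMr ?expR_gt0// mul1r.
  apply: le_trans (expR_ge1Dx _).
  rewrite -(real_normK (num_real z)).
  have := sqr_ge0 (`|z| - 1); lra.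
Qed.

(** Known for step elements, hence for all by density: the isometry bounds E|W h - W y| by |h - y|,
    so that both sides are Lipschitz in [h]. *)
Lemma W_char h :
  E (fun w => cos (W h w)) = expR (- (<|h, h|> / 2)) /\ E (fun w => sin (W h w)) = 0.
Proof.
have L1 y : E (fun w => `|W h w - W y w|) <= `|h - y|.
  have -> : E (fun w => `|W h w - W y w|) = E (fun w => `|W (h - y) w|).
    apply: E_ae.
    - by apply: measurableT_comp => //; apply: measurable_funB; exact: W_meas.
    - by apply: measurableT_comp => //; exact: W_meas.
    - by apply: filterS (W_sub hW h y) => w ->.
  apply: E_abs_le_sqrt => //; first exact: (W_sqr_integ hW).
  by rewrite -dot_norm -(W_isometry hW) le_eqVlt; apply/orP; left.
have il y : integ P (fun w => `|W h w - W y w|).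
  by apply: integ_norm; apply: integB; exact: (W_integ hW).
have clip y : `|E (fun w => cos (W h w)) - E (fun w => cos (W y w))| <= `|h - y|.
  rewrite -E_B//; apply: le_trans (L1 y); apply: E_abs_le => //.
    by apply: measurable_funB; exact: mcos.
  move=> w; rewrite -[leRHS]mul1r.
  apply: (@deriv_lip R (@cos R) (fun x => - sin x) 1 (@is_derive_cos R)).
  by move=> z; rewrite normrN.
have slip y : `|E (fun w => sin (W h w)) - E (fun w => sin (W y w))| <= `|h - y|.
  rewrite -E_B//; apply: le_trans (L1 y); apply: E_abs_le => //.
    by apply: measurable_funB; exact: msin.
  move=> w; rewrite -[leRHS]mul1r.
  exact: (@deriv_lip R (@sin R) (@cos R) 1 (@is_derive_sin R)).
split.
- apply/eqP; rewrite -subr_eq0 -normr_le0; apply/ler_addgt0Pl => e e0.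
  have e2 : 0 < e / 2 by rewrite divr_gt0.
  have [y sy hy] := step_dense h e2; have [cy _] := W_step_char sy.
  rewrite addr0 -(subrKA (E (fun w => cos (W y w)))).
  rewrite (le_trans (ler_normD _ _))// [e]splitr lerD//.
    by apply: le_trans (clip y) _; exact: ltW.
  rewrite cy !dot_norm (le_trans (expR_sqr_lip _ _))// (le_trans _ (ltW hy))//.
  by rewrite -[`|h - y|]normrN opprB ler_dist_dist.
- apply/eqP; rewrite -normr_le0; apply/ler_addgt0Pl => e e0.
  have [y sy hy] := step_dense h e0; have [_ sy0] := W_step_char sy.
  by have := slip y; rewrite sy0 subr0 addr0 => /le_trans; apply; exact: ltW.
Qed.

End gaussian_independence.

Lemma continuous_mulr (R : realType) (U : topologicalType) (f g : U -> R) :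
  continuous f -> continuous g -> continuous (fun x => f x * g x).
Proof. by move=> cf cg x; apply: cvgM; [exact: cf|exact: cg]. Qed.

Lemma continuous_sumr (R : realType) (U : topologicalType) (I : Type) (s : seq I)
    (F : I -> U -> R) : (forall i, continuous (F i)) ->
  continuous (fun x => \sum_(i <- s) F i x).
Proof.
move=> cF; elim: s => [|i s ih] x.
  by under eq_fun do rewrite big_nil; exact: cvg_cst.
under eq_fun do rewrite big_cons.
by apply: (@cvgD _ R^o); [exact: cF|exact: ih].
Qed.

Lemma integral_in_indic d (T : measurableType d) (R : realType)
    (P : probability T R) (A : set T) (D : T -> R) : measurable A -> integ P D ->
  (\int[P]_(w in A) (D w)%:E = (\int[P]_w (\1_A w * D w)%R)%R%:E)%E.
Proof.
move=> mA iD.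
have iAD : integ P (fun w => \1_A w * D w).
  apply: (integ_le _ (integ_norm iD)).
    by apply: measurable_funM; [exact: measurable_indic|exact: integ_meas iD].
  by move=> w; rewrite normrM indicE; case: (w \in A); rewrite ?normr0 ?normr1 ?mul1r ?mul0r.
rewrite /Rintegral fineK ?integrable_fin_num// [LHS]integral_mkcond.
apply: eq_integral => w _; rewrite patchE indicE.
by case: (w \in A); rewrite ?mul1r ?mul0r.
Qed.

(** * Gaussian integration by parts *)

Section gaussian_ibp.
Context d (Omega : measurableType d) (R : realType) (P : probability Omega R).
Context (H K T : R) (B : R -> {RV P >-> R}).
Context (V : bif_hilbert H K T) (W : V -> {RV P >-> R}).
Hypothesis hB : is_bifBm H K T B.
Hypothesis hW : is_isonormal B W.
Local Notation E X := (\int[P]_w X w).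
Local Notation "<| x , y |>" := (dot V x y) (format "<| x ,  y |>").
Let linW : forall (a : R) (h1 h2 : V),
  {ae P, forall w, W (a *: h1 + h2) w = a * W h1 w + W h2 w} := isonormal_linear hW.

Let g (h : V) := expR (- (<|h, h|> / 2)).

Let mcos h : measurable_fun setT (fun w => cos (W h w)).
Proof.
apply: measurableT_comp; last exact: W_meas.
by apply: continuous_measurable_fun; exact: continuous_cos.
Qed.

Let msin h : measurable_fun setT (fun w => sin (W h w)).
Proof.
apply: measurableT_comp; last exact: W_meas.
by apply: continuous_measurable_fun; exact: continuous_sin.
Qed.

Let cos1 (x : R) : `|cos x| <= 1.
Proof. by rewrite ler_norml cos_geN1 cos_le1. Qed.

Let sin1 (x : R) : `|sin x| <= 1.
Proof. by rewrite ler_norml sin_geN1 sin_le1. Qed.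

Let icos h : integ P (fun w => cos (W h w)).
Proof. by apply: (@integ_bounded _ _ _ _ _ 1) => //; exact: mcos. Qed.

Let isin h : integ P (fun w => sin (W h w)).
Proof. by apply: (@integ_bounded _ _ _ _ _ 1) => //; exact: msin. Qed.

Let icM (X : Omega -> R) h : integ P X -> integ P (fun w => X w * cos (W h w)).
Proof. by move=> iX; apply: (@integMb _ _ _ _ 1) => //; exact: mcos. Qed.

Let isM (X : Omega -> R) h : integ P X -> integ P (fun w => X w * sin (W h w)).
Proof. by move=> iX; apply: (@integMb _ _ _ _ 1) => //; exact: msin. Qed.

(** The characteristic functions at [h + z] and [h - z], expanded by the sum formulas, are four
    linear equations in the four products. *)
Lemma W_char_products z h :
  [/\ E (fun w => cos (W z w) * cos (W h w)) = (g (h + z) + g (h - z)) / 2,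
      E (fun w => cos (W z w) * sin (W h w)) = 0,
      E (fun w => sin (W z w) * cos (W h w)) = 0 &
      E (fun w => sin (W z w) * sin (W h w)) = (g (h - z) - g (h + z)) / 2].
Proof.
have [cp sp] := W_char hB hW (h + z); have [cm sm] := W_char hB hW (h - z).
have i1 := icM h (icos z); have i2 := isM h (icos z).
have i3 := icM h (isin z); have i4 := isM h (isin z).
have ae1 := W_add hW h z; have ae2 := W_sub hW h z.
have e1 : E (fun w => cos (W (h + z) w)) =
    E (fun w => cos (W z w) * cos (W h w) - sin (W z w) * sin (W h w)).
  apply: E_ae; [exact: mcos|by apply: (@integ_meas _ _ _ P); exact: integB|].
  by apply: filterS ae1 => w ->; rewrite cosD; ring.
have e2 : E (fun w => sin (W (h + z) w)) =
    E (fun w => cos (W z w) * sin (W h w) + sin (W z w) * cos (W h w)).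
  apply: E_ae; [exact: msin|by apply: (@integ_meas _ _ _ P); exact: integD|].
  by apply: filterS ae1 => w ->; rewrite sinD; ring.
have e3 : E (fun w => cos (W (h - z) w)) =
    E (fun w => cos (W z w) * cos (W h w) + sin (W z w) * sin (W h w)).
  apply: E_ae; [exact: mcos|by apply: (@integ_meas _ _ _ P); exact: integD|].
  by apply: filterS ae2 => w ->; rewrite cosB; ring.
have e4 : E (fun w => sin (W (h - z) w)) =
    E (fun w => cos (W z w) * sin (W h w) - sin (W z w) * cos (W h w)).
  apply: E_ae; [exact: msin|by apply: (@integ_meas _ _ _ P); exact: integB|].
  by apply: filterS ae2 => w ->; rewrite sinB; ring.
rewrite e1 E_B// -/(g _) in cp; rewrite e2 E_D// in sp.
rewrite e3 E_D// -/(g _) in cm; rewrite e4 E_B// in sm.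
move: cp sp cm sm.
set x1 := Rintegral _ _ _; set x2 := Rintegral _ _ _.
set x3 := Rintegral _ _ _; set x4 := Rintegral _ _ _.
by move=> ? ? ? ?; split; lra.
Qed.

Definition perp_index (y : V) := {h : V | <|h, y|> = 0}.
Definition perp_gen (y : V) : set (set Omega) := [set A | exists j : perp_index y,
  exists2 Y : set R, measurable Y & A = W (sval j) @^-1` Y].

Let perp_lin y (a : R) (h1 h2 : V) : <|h1, y|> = 0 -> <|h2, y|> = 0 ->
  <|a *: h1 + h2, y|> = 0.
Proof. by move=> e1 e2; rewrite dotDl dotZl e1 e2 mulr0 addr0. Qed.

Let gperp y h : <|h, y|> = 0 -> g (h + y) = g h * g y /\ g (h - y) = g h * g y.
Proof.
move=> hy; rewrite /g -expRD; split; congr expR.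
- by rewrite dotDl !dotDr (dotC y h) hy; field.
- by rewrite dotBl !dotBr (dotC y h) hy; field.
Qed.

Let Wfun (h : V) : Omega -> R := W h.

Lemma perp_gen_measurable y A : <<s perp_gen y >> A -> measurable A.
Proof.
apply: smallest_sub; first exact: sigma_algebra_measurable.
move=> _ [j [Y mY ->]]; rewrite -[X in measurable X]setTI.
exact: W_meas.
Qed.

(** Two applications of [fourier_null_sigma]: the first passes from trigonometric functions of the
    variables orthogonal to [W y] to the event [A], the second from trigonometric functions of [W y]
    to the set [Y]. *)
Lemma W_perp_indep y A Y : <<s perp_gen y >> A -> measurable Y ->
  P (A `&` W y @^-1` Y) = (P A * P (W y @^-1` Y))%E.
Proof.
move=> sA mY; have mA := perp_gen_measurable sA.
have i1A : integ P (fun w => \1_A w).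
  apply: (@integ_bounded _ _ _ _ _ 1) => //; first exact: measurable_indic.
  by move=> w; rewrite indicE; case: (_ \in _); rewrite ?normr0 ?normr1.
pose p := E (fun w => \1_A w).
have S1 D : fourier_null P Wfun (fun h => <|h, y|> = 0) D -> E (fun w => \1_A w * D w) = 0.
  move=> nD; have [iD _] := nD.
  have [_] := @fourier_null_sigma _ _ _ P V Wfun (@W_meas _ _ _ _ _ _ _ V W) linW
    (fun h => <|h, y|> = 0) (dot0l _) (@perp_lin y) (perp_index y)
    (fun j => W (sval j)) D (fun j => W_meas W _)
    (fun j => ex_intro2 _ _ (sval j) (svalP j) (aeW _ (fun w => erefl))) nD A sA.
  by rewrite integral_in_indic// => -[].
(* For [h] orthogonal to [y] the characteristic function at [h + l y] or [h - l y] is the product of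
   those at [h] and at [l y]. Hence cos and sin of [W (l y)], minus their means, are null on the
   orthogonal complement of [y] and integrate to 0 over [A]. *)
have key l : E (fun w => \1_A w * cos (W (l *: y) w)) = p * g (l *: y) /\
             E (fun w => \1_A w * sin (W (l *: y) w)) = 0.
  have ly h : <|h, y|> = 0 -> <|h, l *: y|> = 0 by move=> e; rewrite dotZr e mulr0.
  split.
  - have := S1 (fun w => cos (W (l *: y) w) - g (l *: y)).
    rewrite (_ : E (fun w => \1_A w * _) = E (fun w => \1_A w * cos (W (l *: y) w)) -
       p * g (l *: y)); last first.
      rewrite -E_Zr// -E_B; [|exact: icM|].
        by apply: eq_Rintegral => w _; ring.
      by under eq_fun do rewrite mulrC; exact: integZ.
    move=> e; apply/eqP; rewrite -subr_eq0; apply/eqP; apply: e.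
    split; first by apply: integB; [exact: icos|exact: integ_cst].
    move=> h hy; have [c1 c2 _ _] := W_char_products (l *: y) h.
    have [g1 g2] := gperp (ly h hy); have [ch sh] := W_char hB hW h.
    split.
    + transitivity (E (fun w => cos (W (l *: y) w) * cos (W h w)) -
         g (l *: y) * E (fun w => cos (W h w))).
        rewrite -E_Z// -E_B; [|exact: icM|exact: integZ].
        by apply: eq_Rintegral => w _; rewrite /Wfun; ring.
      by rewrite c1 ch g1 g2 -/(g h); field.
    + transitivity (E (fun w => cos (W (l *: y) w) * sin (W h w)) -
         g (l *: y) * E (fun w => sin (W h w))).
        rewrite -E_Z// -E_B; [|exact: isM|exact: integZ].
        by apply: eq_Rintegral => w _; rewrite /Wfun; ring.
      by rewrite c2 sh; ring.
  - apply: S1; split; first exact: isin.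
    move=> h hy; have [_ _ c3 c4] := W_char_products (l *: y) h.
    have [g1 g2] := gperp (ly h hy).
    by split; [exact: c3|rewrite [LHS]c4 g1 g2 subrr mul0r].
have iD2 : integ P (fun w => \1_A w - p) by apply: integB => //; exact: integ_cst.
(* The roles are exchanged: the centred indicator of [A] is null on the line of [y], hence
   integrates to 0 over the events of [W y]. *)
have nD2 : fourier_null P Wfun (fun h => exists l : R, h = l *: y) (fun w => \1_A w - p).
  split=> // _ [l ->]; have [k1 k2] := key l; have [cl sl] := W_char hB hW (l *: y).
  split.
  - transitivity (E (fun w => \1_A w * cos (W (l *: y) w)) -
         p * E (fun w => cos (W (l *: y) w))).
      rewrite -E_Z// -E_B; [|exact: icM|exact: integZ].
      by apply: eq_Rintegral => w _; rewrite /Wfun; ring.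
    by rewrite k1 cl -/(g _) subrr.
  - transitivity (E (fun w => \1_A w * sin (W (l *: y) w)) -
         p * E (fun w => sin (W (l *: y) w))).
      rewrite -E_Z// -E_B; [|exact: isM|exact: integZ].
      by apply: eq_Rintegral => w _; rewrite /Wfun; ring.
    by rewrite k2 sl mulr0 subrr.
have linS (a : R) (h1 h2 : V) : (exists l : R, h1 = l *: y) -> (exists l : R, h2 = l *: y) ->
    exists l : R, a *: h1 + h2 = l *: y.
  by move=> [l1 ->] [l2 ->]; exists (a * l1 + l2); rewrite scalerDl scalerA.
have S20 : exists l : R, 0 = l *: y by exists 0; rewrite scale0r.
have S2y : exists l : R, y = l *: y by exists 1; rewrite scale1r.
have := @fourier_null_sigma _ _ _ P V Wfun (@W_meas _ _ _ _ _ _ _ V W) linW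
    _ S20 linS unit (fun=> W y) _ (fun j => W_meas W _)
    (fun j => ex_intro2 _ _ y S2y (aeW _ (fun w => erefl))) nD2 (W y @^-1` Y).
have sY : <<s [set A | exists _ : unit, exists2 Y : set R, measurable Y & A = W y @^-1` Y] >> (W y @^-1` Y).
  by apply: sub_sigma_algebra; exists tt; exists Y.
move=> /(_ sY) [mWY]; rewrite integral_in_indic// => -[].
set F := W y @^-1` Y in mWY *.
have PE (Z : set Omega) : measurable Z -> P Z = (E (fun w => \1_Z w))%:E.
  move=> mZ; rewrite /Rintegral fineK.
    by rewrite integral_indic// setIT.
  apply: integrable_fin_num => //; apply: (@integ_bounded _ _ _ _ _ 1).
    exact: measurable_indic.
  by move=> w; rewrite indicE; case: (_ \in _); rewrite ?normr0 ?normr1.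
have i1F : integ P (fun w => \1_F w).
  apply: (@integ_bounded _ _ _ _ _ 1) => //; first exact: measurable_indic.
  by move=> w; rewrite indicE; case: (_ \in _); rewrite ?normr0 ?normr1.
have i1AF : integ P (fun w => \1_(A `&` F) w).
  apply: (@integ_bounded _ _ _ _ _ 1) => //.
    by apply: measurable_indic; exact: measurableI.
  by move=> w; rewrite indicE; case: (_ \in _); rewrite ?normr0 ?normr1.
rewrite (PE _ (measurableI _ _ mA mWY)) (PE _ mA) (PE _ mWY) -EFinM => e.
congr EFin; apply/eqP; rewrite -/p -subr_eq0 -E_Z// -E_B//; last exact: integZ.
rewrite -{}e; apply/eqP; apply: eq_Rintegral => w _.
rewrite !indicE in_setI.
by case: (w \in A); case: (w \in F); rewrite /=; ring.
Qed.

(** The sample space with the smaller sigma-algebra, so that the product measurable structure is the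
    one on which independence makes the joint law a product. *)
Definition perpT (y : V) := g_sigma_algebraType (perp_gen y).

(** By independence the image of [P] under w |-> (w, W y w) is the product of [P] on the small
    sigma-algebra and the law of [W y]; Fubini's theorem then integrates over [W y] first. It plays
    the part of conditioning on the orthogonal variables. *)
Lemma W_freeze y (f1 f2 : perpT y * R -> R) :
  measurable_fun setT f1 -> measurable_fun setT f2 ->
  integ P (fun w => f1 (w, W y w)) -> integ P (fun w => f2 (w, W y w)) ->
  (forall w, integ P (fun w' => f1 (w, W y w'))) ->
  (forall w, integ P (fun w' => f2 (w, W y w'))) ->
  (forall w, E (fun w' => f1 (w, W y w')) = E (fun w' => f2 (w, W y w'))) ->
  E (fun w => f1 (w, W y w)) = E (fun w => f2 (w, W y w)).
Proof.
move=> mf1 mf2 i1 i2 j1 j2 e12.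
have mid : measurable_fun setT (idfun : Omega -> perpT y).
  by move=> _ A mA; rewrite setTI; exact: (@perp_gen_measurable y A mA).
pose mixi := isMeasurableFun.Build _ _ Omega (perpT y) idfun mid.
pose idm : {mfun Omega >-> perpT y} := HB.pack (idfun : Omega -> perpT y) mixi.
have mpair : measurable_fun setT (fun w : Omega => ((w : perpT y), W y w)).
  by apply: measurable_fun_pair => //; exact: W_meas.
pose mixp := isMeasurableFun.Build _ _ Omega (perpT y * R)%type _ mpair.
pose pm : {mfun Omega >-> (perpT y * R)%type} := HB.pack (fun w : Omega => ((w : perpT y), W y w)) mixp.
pose P1 := distribution P idm; pose P2 := distribution P (W y).
pose m' := distribution P pm.
have PP Z : measurable Z -> (P1 \x P2)%E Z = m' Z.
  apply: product_measure_unique => A Y mA mY.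
  exact: (@W_perp_indep y A Y mA mY).
have main (f : perpT y * R -> R) : measurable_fun setT f ->
    integ P (fun w => f (w, W y w)) -> (forall w, integ P (fun w' => f (w, W y w'))) ->
    (\int[P]_w (f (w, W y w))%:E =
     \int[P1]_w (E (fun w' => f (w, W y w')))%:E)%E.
  move=> mf i j.
  have mEf : measurable_fun setT (EFin \o f) by exact/measurable_EFinP.
  have eqm (F : perpT y * R -> \bar R) :
      (\int[(P1 \x P2)%E]_z F z = \int[m']_z F z)%E.
    by apply: eq_measure_integral => Z mZ _; exact: PP.
  have mfin : m'.-integrable setT (EFin \o f).
    exact: (@integrable_pushforward _ _ _ _ R pm mpair P setT (EFin \o f) mEf i measurableT).
  have pfin : (P1 \x P2)%E.-integrable setT (EFin \o f).
    apply/integrableP; split => //; rewrite eqm.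
    by have /integrableP[] := mfin.
  transitivity (\int[m']_z (f z)%:E)%E.
    by rewrite /m' (integral_distribution (X := pm) mEf i).
  rewrite -eqm -(integral12_prod_meas1 pfin); apply: eq_integral => w _.
  rewrite /fubini_F.
  have mfw : measurable_fun setT (fun v => (f (w, v))%:E).
    by apply/measurable_EFinP; apply: measurableT_comp => //; exact: measurable_pair1.
  rewrite (integral_distribution (X := W y) mfw (j w)).
  by rewrite /Rintegral fineK//; apply: integrable_fin_num => //; exact: j.
rewrite {1}/Rintegral main// [in RHS]/Rintegral main//.
by congr fine; apply: eq_integral => w _; rewrite e12.
Qed.

Lemma norm_dot_eq0 (y : V) : <|y, y|> = 0 -> y = 0.
Proof.
by rewrite dot_norm => /eqP; rewrite sqrf_eq0 normr_eq0 => /eqP.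
Qed.

(* With the component of the Gaussian space orthogonal to y frozen, all factors
   are functions of W y alone, to which Stein's identity applies. *)
Lemma W_ibp n (G : 'rV[R]_n -> R) (phi : 'I_n -> V) (psi psi' : R -> R) (M : R)
    (h y : V) : Cb_infty G -> is_step y ->
  (forall x : R, is_derive x 1 psi (psi' x)) -> continuous psi' ->
  (forall x, `|psi x| <= M) -> (forall x, `|psi' x| <= M) ->
  E (fun w => smooth W G phi w * psi (W h w) * W y w) =
  \sum_(i < n) <|phi i, y|> *
     E (fun w => partial G i (\row_j W (phi j) w) * psi (W h w)) +
  <|h, y|> * E (fun w => smooth W G phi w * psi' (W h w)).
Proof.
move=> hG sy dpsi cpsi' psiM psiM'.
have cpsi : continuous psi by move=> x; exact: deriv_continuous (dpsi x).
have mpsi := continuous_measurable_fun cpsi.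
have mpsi' := continuous_measurable_fun cpsi'.
have M0 : 0 <= M by exact: le_trans (psiM 0).
have [MG hMG] := Cb_infty_bounded hG.
have MG0 : 0 <= MG by exact: le_trans (hMG 0).
have mS (F : 'rV[R]_n -> R) : continuous F ->
    measurable_fun setT (fun w => F (\row_j W (phi j) w)).
  by move=> cF; apply: measurable_row_continuous => // i; exact: W_meas.
have cG := Cb_infty_continuous hG.
have cpG i := Cb_infty_continuous (Cb_infty_partial i hG).
have mWh : measurable_fun setT (fun w => psi (W h w)).
  by apply: measurableT_comp => //; exact: W_meas.
have mWh' : measurable_fun setT (fun w => psi' (W h w)).
  by apply: measurableT_comp => //; exact: W_meas.
have mGpsi : measurable_fun setT (fun w => smooth W G phi w * psi (W h w)).
  by apply: measurable_funM => //; exact: mS.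
have mGpsiW : measurable_fun setT (fun w => smooth W G phi w * psi (W h w) * W y w).
  by apply: measurable_funM => //; exact: W_meas.
(* For [y = 0] there is no projection along [y], and both sides are 0. *)
have [v0|v0] := eqVneq <|y, y|> 0.
  have y0 := norm_dot_eq0 v0.
  rewrite y0 dot0r mul0r addr0 [RHS]big1 => [|i _]; last by rewrite dot0r mul0r.
  rewrite -[RHS](E_cst P); apply: E_ae => //; first by rewrite -y0.
  by apply: filterS (W_zero hW) => w ->; rewrite mulr0.
set v := <|y, y|> in v0.
(* [c] and [c0] are the coordinates along [y] of the [phi i] and of [h]; [phi'] and [h'] are the
   components orthogonal to [y]. *)
pose c : 'rV[R]_n := \row_i (<|phi i, y|> / v).
pose c0 := <|h, y|> / v.
pose phi' i := phi i - c 0 i *: y.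
pose h' := h - c0 *: y.
have perp (k : V) : <|k - (<|k, y|> / v) *: y, y|> = 0.
  by rewrite dotBl dotZl -/v divfK// subrr.
have perphi i : <|phi' i, y|> = 0 by rewrite /phi' mxE perp.
have perh : <|h', y|> = 0 by rewrite /h' perp.
pose X (w : Omega) : 'rV[R]_n := \row_i W (phi' i) w.
(* For frozen [w] put Phi(s) = G(X w + s c) psi(W h' w + s c0). Then [f1] is s Phi(s), [D w s] is
   Phi'(s) and [f2] is v Phi'(s), with [v] the variance of [W y]: Stein's identity equates their
   means. *)
pose f1 (p : perpT y * R) := G (X p.1 + p.2 *: c) * psi (W h' p.1 + p.2 * c0) * p.2.
pose D (w : Omega) (s : R) := (\sum_i c 0 i * partial G i (X w + s *: c)) *
    psi (W h' w + s * c0) + G (X w + s *: c) * (psi' (W h' w + s * c0) * c0).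
pose f2 (p : perpT y * R) := v * D p.1 p.2.
have mperp (k : V) : <|k, y|> = 0 -> measurable_fun [set: perpT y] (W k : perpT y -> R).
  move=> ky _ Y mY; rewrite setTI; apply: sub_sigma_algebra.
  by exists (exist _ k ky); exists Y.
have mrow (F : 'rV[R]_n -> R) : continuous F ->
    measurable_fun setT (fun p : perpT y * R => F (X p.1 + p.2 *: c)).
  move=> cF.
  have -> : (fun p : perpT y * R => F (X p.1 + p.2 *: c)) =
      (fun p => F (\row_i (W (phi' i) p.1 + p.2 * c 0 i))).
    by apply/funext => p; congr F; apply/rowP => i; rewrite !mxE.
  apply: (measurable_row_continuous (x := fun i (p : perpT y * R) => W (phi' i) p.1 + p.2 * c 0 i)) => // i.
  apply: measurable_funD; last by apply: measurable_funM => //; exact: measurable_snd.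
  by apply: (measurableT_comp (mperp _ (perphi i))); exact: measurable_fst.
have mcol (F : R -> R) : measurable_fun setT F ->
    measurable_fun setT (fun p : perpT y * R => F (W h' p.1 + p.2 * c0)).
  move=> mF; apply: measurableT_comp => //.
  apply: measurable_funD; last by apply: measurable_funM => //; exact: measurable_snd.
  by apply: (measurableT_comp (mperp _ perh)); exact: measurable_fst.
have mf1 : measurable_fun setT f1.
  apply: measurable_funM; last exact: measurable_snd.
  by apply: measurable_funM; [exact: mrow|exact: mcol].
have mf2 : measurable_fun setT f2.
  apply: measurable_funM => //; apply: measurable_funD.
    apply: measurable_funM; last exact: mcol.
    apply: (mrow (fun x => \sum_i c 0 i * partial G i x)).
    by apply: continuous_sumr => i; apply: continuous_mulr => //; exact: cst_continuous.
  apply: measurable_funM; first exact: mrow.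
  by apply: (mcol (fun x => psi' x * c0)); exact: measurable_funM.
have [MD hMD] := Cb_infty_partial_sum_bound c hG.
have MD0 : 0 <= MD by exact: le_trans (hMD 0).
have D_bound w s : `|D w s| <= MD * M + MG * (M * `|c0|).
  rewrite /D (le_trans (ler_normD _ _))// lerD// normrM ler_pM//.
  by rewrite normrM ler_wpM2r.
have f1_bound w s : `|f1 (w, s)| <= MG * M * `|s|.
  by rewrite /f1 /= !normrM ler_wpM2r// ler_pM.
have f2_bound w s : `|f2 (w, s)| <= `|v| * (MD * M + MG * (M * `|c0|)).
  by rewrite /f2 /= normrM ler_wpM2l.
have iWy : integ P (fun w => MG * M * `|W y w|).
  by apply: integZ; apply: integ_norm; exact: (W_integ hW).
have mdiag (f : perpT y * R -> R) : measurable_fun setT f ->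
    measurable_fun setT (fun w : Omega => f ((w : perpT y), W y w)).
  move=> mf; apply: (measurableT_comp mf).
  apply: measurable_fun_pair; last exact: W_meas.
  by move=> _ A mA; rewrite setTI; exact: (@perp_gen_measurable y A mA).
have msec (f : perpT y * R -> R) w : measurable_fun setT f ->
    measurable_fun setT (fun w' : Omega => f ((w : perpT y), W y w')).
  move=> mf; apply: (measurableT_comp mf).
  by apply: measurable_fun_pair; [exact: measurable_cst|exact: W_meas].
have fr := W_freeze mf1 mf2.
have i1 : integ P (fun w => f1 (w, W y w)) by apply: (integ_le (mdiag _ mf1) iWy).
have i2 : integ P (fun w => f2 (w, W y w)).
  by apply: (integ_bounded P (mdiag _ mf2)) => w; exact: f2_bound.
have j1 w : integ P (fun w' => f1 (w, W y w')) by apply: (integ_le (msec _ w mf1) iWy).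
have j2 w : integ P (fun w' => f2 (w, W y w')).
  by apply: (integ_bounded P (msec _ w mf2)) => w'; exact: f2_bound.
have sec w : E (fun w' => f1 (w, W y w')) = E (fun w' => f2 (w, W y w')).
  have dk (s : R) : is_derive s 1 (fun s => G (X w + s *: c) * psi (W h' w + s * c0)) (D w s).
    have h1 := Cb_infty_derive_line (X w) c s hG.
    have h2 := @deriv_comp R psi (fun s => W h' w + s * c0) s _ _ (dpsi (W h' w + s * c0)) (deriv_affine (W h' w) c0 s).
    exact: (derivM h1 h2).
  have lineC : continuous (fun s : R => X w + s *: c).
    move=> s; apply: cvgD; first exact: cvg_cst.
    by apply: cvgZr_tmp; exact: cvg_id.
  have affC : continuous (fun s : R => W h' w + s * c0).
    by move=> s; exact: deriv_continuous (deriv_affine (W h' w) c0 s).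
  have cD : continuous (D w).
    move=> s; apply: cvgD; apply: cvgM.
    - apply: continuous_sumr => i {}s /=; apply: cvgM; first exact: cvg_cst.
      by apply: (cvg_comp (fun s : R => X w + s *: c)); [exact: lineC|exact: cpG].
    - by apply: (cvg_comp (fun s : R => W h' w + s * c0)); [exact: affC|exact: cpsi].
    - by apply: (cvg_comp (fun s : R => X w + s *: c)); [exact: lineC|exact: cG].
    - apply: cvgM; last exact: cvg_cst.
      by apply: (cvg_comp (fun s : R => W h' w + s * c0)); [exact: affC|exact: cpsi'].
  have st := W_stein hB hW sy dk cD (D_bound w).
  rewrite [RHS](_ : _ = v * E (fun w' => D w (W y w'))).
    by rewrite -st; apply: eq_Rintegral.
  rewrite -E_Z//; apply: (@integ_bounded _ _ _ _ _ (MD * M + MG * (M * `|c0|))) => //.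
  apply: (measurableT_comp (continuous_measurable_fun cD)); exact: W_meas.
have {}fr := fr i1 i2 j1 j2 sec.
have aephi : {ae P, forall w, \row_i W (phi i) w = X w + W y w *: c}.
  have : {ae P, forall w, forall i, W (phi i) w = W (phi' i) w + c 0 i * W y w}.
    apply: filter_forall => i; have := W_addZ hW (phi' i) (c 0 i) y.
    by rewrite /phi' subrK.
  apply: filterS => w e; apply/rowP => i; rewrite !mxE e.
  by rewrite mxE mulrC.
have aeh : {ae P, forall w, W h w = W h' w + W y w * c0}.
  have := W_addZ hW h' c0 y; rewrite /h' subrK.
  by apply: filterS => w ->; rewrite mulrC.
have L : E (fun w => smooth W G phi w * psi (W h w) * W y w) = E (fun w => f1 (w, W y w)).
  apply: E_ae => //; first exact: mdiag.
  by move: aephi aeh; apply: filterS2 => w e1 e2; rewrite /smooth /f1 /= e1 e2.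
rewrite L fr.
have ipsi i : integ P (fun w => partial G i (\row_j W (phi j) w) * psi (W h w)).
  have [N hN] := Cb_infty_bounded (Cb_infty_partial i hG).
  apply: (@integ_bounded _ _ _ _ _ (N * M)); first by apply: measurable_funM => //; exact: mS.
  by move=> w; rewrite normrM ler_pM.
have ipsi' : integ P (fun w => smooth W G phi w * psi' (W h w)).
  apply: (@integ_bounded _ _ _ _ _ (MG * M)); first by apply: measurable_funM => //; exact: mS.
  by move=> w; rewrite normrM ler_pM// hMG.
under eq_bigr do rewrite -E_Z//.
rewrite -E_Z// -E_sum; last by move=> i; exact: integZ.
rewrite -E_D; [|by apply: integ_sum => i; exact: integZ|exact: integZ].
apply: E_ae.
- exact: mdiag.
- apply: (@integ_meas _ _ _ P); apply: integD; last exact: integZ.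
  by apply: integ_sum => i; exact: integZ.
(* The factor [v] cancels the denominators in [c] and [c0] and restores the inner products with
   [y]. *)
- move: aephi aeh; apply: filterS2 => w e1 e2.
  rewrite /smooth /f2 /D /= e1 e2 mulrDr; congr (_ + _).
    rewrite mulr_suml mulr_sumr; apply: eq_bigr => i _.
    by rewrite [c 0 i]mxE; field.
  by rewrite /c0; field.
Qed.

End gaussian_ibp.

Lemma four_le (R : realType) (a b c d : R) : a + d <= b + c -> d - c - b + a <= 0.
Proof. lra. Qed.

(** For the covariance [F] of a process this is the covariance of its increments over (a, a'] and
    (b, b']. *)
Definition rect_incr (R : realType) (F : R -> R -> R) (a a' b b' : R) :=
  F a' b' - F a b' - F a' b + F a b.

Lemma rect_incr_lin (R : realType) (k l : R) (F G : R -> R -> R) (a a' b b' : R) :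
  rect_incr (fun t s => k * (F t s + l * G t s)) a a' b b' =
  k * (rect_incr F a a' b b' + l * rect_incr G a a' b b').
Proof. by rewrite /rect_incr; ring. Qed.

(** * Increments of the covariance *)

Section powR_increments.
Context (R : realType).
Implicit Types (x y l p : R).

Lemma powR_convex p x y l : 1 <= p -> 0 <= x -> 0 <= y -> 0 <= l <= 1 ->
  (l * x + (1 - l) * y) `^ p <= l * x `^ p + (1 - l) * y `^ p.
Proof.
move=> p1 x0 y0 /andP[l0 l1].
have := @convex_powR R p p1 (Itv01 l0 l1) x y.
by rewrite !inE /= !in_itv /= !andbT => /(_ x0 y0).
Qed.

(** Convexity of the power [p^-1], applied to the p-th powers of [x] and [y], and then raised to the
    power [p]. *)
Lemma powR_concave p x y l : 0 < p <= 1 -> 0 <= x -> 0 <= y -> 0 <= l <= 1 ->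
  l * x `^ p + (1 - l) * y `^ p <= (l * x + (1 - l) * y) `^ p.
Proof.
move=> /andP[p0 p1] x0 y0 l01; have /andP[l0 l1] := l01.
have p'1 : 1 <= p^-1 by rewrite invf_ge1.
have pK z : 0 <= z -> (z `^ p) `^ p^-1 = z.
  by move=> z0; rewrite -powRrM divff ?gt_eqF// powRr1.
have pK' z : 0 <= z -> (z `^ p^-1) `^ p = z.
  by move=> z0; rewrite -powRrM mulVf ?gt_eqF// powRr1.
have L0 : 0 <= l * x `^ p + (1 - l) * y `^ p.
  by rewrite addr_ge0// mulr_ge0 ?powR_ge0// subr_ge0.
have := powR_convex p'1 (powR_ge0 x p) (powR_ge0 y p) l01.
rewrite !pK// => h; rewrite -[leLHS]pK'//.
apply: ge0_ler_powR => //; rewrite ?nnegrE ?powR_ge0 ?(ltW p0)//.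
exact: le_trans (powR_ge0 _ _) h.
Qed.

(** [x + a] and [x + b] are convex combinations of [x] and [x + a + b] with complementary weights,
    so adding the two convexity inequalities gives the sum of the values at the ends. *)
Lemma four_point (phi : R -> R) x a b : 0 <= a -> 0 <= b ->
  (forall l, 0 <= l <= 1 -> phi (l * x + (1 - l) * (x + a + b)) <=
     l * phi x + (1 - l) * phi (x + a + b)) ->
  phi (x + a) + phi (x + b) <= phi x + phi (x + a + b).
Proof.
move=> a0 b0 cv.
have [ab|ab] := eqVneq (a + b) 0.
  by move/eqP: ab; rewrite paddr_eq0// => /andP[/eqP -> /eqP ->]; rewrite !addr0.
have abp : 0 < a + b by rewrite lt_neqAle eq_sym ab addr_ge0.
have la : 0 <= a / (a + b) <= 1.
  by rewrite divr_ge0 ?addr_ge0// ler_pdivrMr// mul1r lerDl.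
have lb : 0 <= b / (a + b) <= 1.
  by rewrite divr_ge0 ?addr_ge0// ler_pdivrMr// mul1r lerDr.
have ea : a / (a + b) * x + (1 - a / (a + b)) * (x + a + b) = x + b.
  by field.
have eb : b / (a + b) * x + (1 - b / (a + b)) * (x + a + b) = x + a.
  by field.
have := cv _ la; have := cv _ lb; rewrite ea eb => h1 h2.
apply: (le_trans (lerD h1 h2)); rewrite le_eqVlt; apply/orP; left; apply/eqP.
by field.
Qed.

Lemma norm_powR_four_point p x a b : 1 <= p -> 0 <= a -> 0 <= b ->
  `|x + a| `^ p + `|x + b| `^ p <= `|x| `^ p + `|x + a + b| `^ p.
Proof.
move=> p1 a0 b0; apply: (four_point (phi := fun z => `|z| `^ p)) => // l l01.
have /andP[l0 l1] := l01.
apply: le_trans (powR_convex p1 _ _ l01) => //.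
apply: ge0_ler_powR; rewrite ?nnegrE ?(le_trans ler01 p1)//.
  by rewrite addr_ge0// mulr_ge0// subr_ge0.
rewrite (le_trans (ler_normD _ _))// !normrM (ger0_norm l0).
by rewrite (@ger0_norm _ (1 - l)) ?subr_ge0.
Qed.

Lemma powR_four_point p x a b : 0 < p <= 1 -> 0 <= x -> 0 <= a -> 0 <= b ->
  x `^ p + (x + a + b) `^ p <= (x + a) `^ p + (x + b) `^ p.
Proof.
move=> p01 x0 a0 b0; rewrite -lerN2 !opprD.
apply: (four_point (phi := fun z => - z `^ p)) => // l l01.
rewrite !mulrN -opprD lerN2; apply: powR_concave => //.
by rewrite !addr_ge0.
Qed.

(** By convexity the slope from [a] to [b] is at most that of the chord from [a] to [2 T]. Taking
    [2 T] as the far end, and not [T], keeps its distance to [a] at least [T], whence the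
    constant. *)
Lemma powR_lip p T a b : 1 <= p -> 0 < T -> 0 <= a -> a <= b -> b <= T ->
  b `^ p - a `^ p <= (2 * T) `^ p / T * (b - a).
Proof.
move=> p1 T0 a0 ab bT.
have aT := le_trans ab bT.
have d0 : 0 < 2 * T - a by lra.
pose l := (2 * T - b) / (2 * T - a).
have l01 : 0 <= l <= 1.
  rewrite /l divr_ge0 ?(ltW d0)//=; last lra.
  by rewrite ler_pdivrMr// mul1r lerD2l lerN2.
have := powR_convex p1 a0 (ltW (mulr_gt0 (ltr0Sn _ 1) T0)) l01.
have -> : l * a + (1 - l) * (2 * T) = b.
  by rewrite /l; field; rewrite gt_eqF.
move=> h.
have -> : (2 * T) `^ p / T * (b - a) = ((b - a) / T) * (2 * T) `^ p by field; rewrite gt_eqF.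
have l'E : 1 - l = (b - a) / (2 * T - a) by rewrite /l; field; rewrite gt_eqF.
have lT : 1 - l <= (b - a) / T.
  rewrite l'E ler_wpM2l ?subr_ge0// lef_pV2 ?posrE//; lra.
have h1 : (1 - l) * (2 * T) `^ p <= ((b - a) / T) * (2 * T) `^ p.
  by rewrite ler_wpM2r// powR_ge0.
have h2 : l * a `^ p <= a `^ p.
  by rewrite ler_piMl ?powR_ge0//; case/andP: l01.
lra.
Qed.

Lemma norm_powR_lip p T x y : 1 <= p -> 0 < T -> `|x| <= T -> `|y| <= T ->
  `| `|x| `^ p - `|y| `^ p| <= (2 * T) `^ p / T * `|x - y|.
Proof.
move=> p1 T0.
have key (a b : R) : `|a| <= T -> `|b| <= T -> `|a| <= `|b| ->
    `| `|b| `^ p - `|a| `^ p| <= (2 * T) `^ p / T * `|b - a|.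
  move=> aT bT ab; rewrite ger0_norm.
    apply: (le_trans (powR_lip p1 T0 _ ab bT)) => //.
    by rewrite ler_wpM2l ?divr_ge0 ?powR_ge0 ?(ltW T0)// lerB_dist.
  by rewrite subr_ge0 ge0_ler_powR ?nnegrE// (le_trans ler01 p1).
move=> xT yT; have [xy|/ltW yx] := leP `|x| `|y|; last exact: key.
by rewrite distrC [`|x - y|]distrC; exact: key.
Qed.

End powR_increments.

Section covariance_increments.
Context (R : realType) (H K T : R).
Hypotheses (hH : 0 < H < 1) (hK : 0 < K <= 1) (hHK : 1 <= 2 * H * K) (hT : 0 < T).

Let A (t s : R) := (t `^ (2 * H) + s `^ (2 * H)) `^ K.
Let D (t s : R) := `|t - s| `^ (2 * H * K).
Let k : R := 2 `^ (- K).

(* The covariance is k (A - D).  For 2HK >= 1 the rectangular increments of A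
   and of D are both nonpositive, so those of -k (A + D) dominate it. *)
Definition cov_dom (t s : R) := - k * (A t s + 1 * D t s).

Let k0 : 0 < k. Proof. exact: powR_gt0. Qed.

Let H20 : 0 < 2 * H. Proof. by move: hH => /andP[? _]; rewrite mulr_gt0. Qed.

(** The power [K <= 1] is concave, and its argument is a sum of increasing functions of the two
    times. *)
Let A_incr a a' b b' : 0 <= a -> a <= a' -> 0 <= b -> b <= b' ->
  rect_incr A a a' b b' <= 0.
Proof.
move=> a0 aa b0 bb; rewrite /rect_incr /A.
have i1 : 0 <= a' `^ (2 * H) - a `^ (2 * H).
  by rewrite subr_ge0 ge0_ler_powR ?nnegrE ?(ltW H20)//; exact: le_trans aa.
have i2 : 0 <= b' `^ (2 * H) - b `^ (2 * H).
  by rewrite subr_ge0 ge0_ler_powR ?nnegrE ?(ltW H20)//; exact: le_trans bb.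
have x0 : 0 <= a `^ (2 * H) + b `^ (2 * H) by rewrite addr_ge0 ?powR_ge0.
have := powR_four_point hK x0 i1 i2.
set u := a `^ _; set v := b `^ _; set u' := a' `^ _; set v' := b' `^ _.
rewrite (_ : u + v + (u' - u) + (v' - v) = u' + v'); last by ring.
rewrite (_ : u + v + (u' - u) = u' + v); last by ring.
rewrite (_ : u + v + (v' - v) = u + v'); last by ring.
exact: four_le.
Qed.

(** This is where [2 H K >= 1] is decisive: x |-> |x|^(2HK) is convex, so the increment has the same
    sign as that of [A]. *)
Let D_incr a a' b b' : a <= a' -> b <= b' -> rect_incr D a a' b b' <= 0.
Proof.
move=> aa bb; rewrite /rect_incr /D.
have i1 : 0 <= a' - a by rewrite subr_ge0.
have i2 : 0 <= b' - b by rewrite subr_ge0.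
have := norm_powR_four_point (a - b') hHK i1 i2.
rewrite (_ : a - b' + (a' - a) + (b' - b) = a' - b); last by ring.
rewrite (_ : a - b' + (a' - a) = a' - b'); last by ring.
rewrite (_ : a - b' + (b' - b) = a - b); last by ring.
by move=> h; apply: four_le; rewrite addrC [leRHS]addrC.
Qed.

Lemma cov_incr_dom a a' b b' : 0 <= a -> a <= a' -> 0 <= b -> b <= b' ->
  `|rect_incr (bif_cov H K) a a' b b'| <= rect_incr cov_dom a a' b b'.
Proof.
move=> a0 aa b0 bb.
have hA := A_incr a0 aa b0 bb; have hD := D_incr aa bb.
have -> : rect_incr (bif_cov H K) a a' b b' = k * (rect_incr A a a' b b' + (-1) * rect_incr D a a' b b').
  by rewrite -rect_incr_lin /rect_incr !mulN1r.
rewrite /cov_dom rect_incr_lin mulN1r mul1r mulNr -mulrN normrM (gtr0_norm k0).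
rewrite ler_wpM2l ?(ltW k0)// ler_norml.
move: hA hD; move: (rect_incr A _ _ _ _) (rect_incr D _ _ _ _) => x y ? ?.
by apply/andP; split; lra.
Qed.

Let L := (2 * T) `^ (2 * H * K) / T.
(** [L] is a Lipschitz constant of x |-> x^(2HK) on [0, T]. Three such differences occur in
    [cov_dom_total]; the remaining one, that of [A], is nonpositive. *)
Definition cov_const := 3 * k * L.

Lemma cov_const_ge0 : 0 <= cov_const.
Proof.
have L0 : 0 <= L by rewrite divr_ge0 ?powR_ge0// ltW.
by rewrite /cov_const mulr_ge0// mulr_ge0// ltW.
Qed.

Let A0 x : A x 0 = x `^ (2 * H * K).
Proof. by rewrite /A powR0 ?gt_eqF// addr0 -powRrM. Qed.

Let absD a a' s : 0 <= a -> a <= a' -> a' <= T -> 0 <= s <= T ->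
  D a s - D a' s <= L * (a' - a).
Proof.
move=> a0 aa aT /andP[s0 sT]; apply: le_trans (ler_norm _) _.
have aT' : `|a - s| <= T by rewrite ler_norml; apply/andP; split; lra.
have aT'' : `|a' - s| <= T by rewrite ler_norml; apply/andP; split; lra.
apply: le_trans (norm_powR_lip hHK hT aT' aT'') _.
rewrite (_ : a - s - (a' - s) = - (a' - a)); last by ring.
by rewrite normrN ger0_norm ?subr_ge0.
Qed.

(** The row sum for Schur's test: the increments over a partition of [0, b] add up to the increment
    over [0, b]. *)
Lemma cov_dom_total a a' b : 0 <= a -> a <= a' -> a' <= T -> 0 <= b <= T ->
  rect_incr cov_dom a a' 0 b <= cov_const * (a' - a).
Proof.
move=> a0 aa aT bT; have /andP[b0 _] := bT.
have -> : rect_incr cov_dom a a' 0 b =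
    k * ((A a b - A a' b) + (a' `^ (2 * H * K) - a `^ (2 * H * K)) +
         ((D a b - D a' b) + (D a' 0 - D a 0))).
  rewrite /rect_incr /cov_dom !A0.
  move: (A a b) (A a' b) (a `^ _) (a' `^ _) (D a b) (D a' b) (D a 0) (D a' 0).
  by move: k => *; ring.
have a'0 := le_trans a0 aa.
have h1 : A a b <= A a' b.
  apply: ge0_ler_powR; rewrite ?nnegrE ?addr_ge0 ?powR_ge0//.
    by case/andP: hK => /ltW.
  by rewrite lerD2r ge0_ler_powR ?nnegrE ?(ltW H20).
have h2 : a' `^ (2 * H * K) - a `^ (2 * H * K) <= L * (a' - a) by exact: powR_lip.
have h3 := absD a0 aa aT bT.
have h4 : D a' 0 - D a 0 <= L * (a' - a).
  by rewrite /D !subr0 !ger0_norm.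
rewrite /cov_const (_ : 3 * k * L * (a' - a) = k * (3 * (L * (a' - a)))); last first.
  by move: k L => *; ring.
rewrite ler_wpM2l ?(ltW k0)//; move: h1 h2 h3 h4.
move: (A a b) (A a' b) (a `^ _) (a' `^ _) (D a b) (D a' b) (D a 0) (D a' 0).
by move: (L * _) => *; lra.
Qed.

Lemma cov_domC t s : cov_dom t s = cov_dom s t.
Proof. by rewrite /cov_dom /A /D distrC (addrC (t `^ _)). Qed.

Lemma bif_cov_diag t : 0 <= t -> bif_cov H K t t = t `^ (2 * H * K).
Proof.
move=> t0; rewrite /bif_cov subrr normr0 powR0 ?subr0; last first.
  by rewrite gt_eqF// (lt_le_trans ltr01 hHK).
set x := t `^ (2 * H).
have -> : x + x = 2 * x by ring.
rewrite powRM ?powR_ge0// mulrA -powRD; last by rewrite pnatr_eq0 implybT.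
by rewrite addNr powRr0 mul1r -powRrM.
Qed.

Lemma bif_cov0l s : 0 <= s -> bif_cov H K 0 s = 0.
Proof.
move=> s0; rewrite /bif_cov powR0 ?gt_eqF// add0r -powRrM sub0r normrN ger0_norm//.
by rewrite subrr mulr0.
Qed.

Lemma bif_covC t s : bif_cov H K t s = bif_cov H K s t.
Proof. by rewrite /bif_cov distrC (addrC (t `^ _)). Qed.

End covariance_increments.

(** * Quadratic forms on partitions and Schur's test *)

Section quadratic_forms.
Context (R : realType).
Implicit Types (F : R -> R -> R) (c : seq (R * R)).

(** For [F = bif_cov H K] this is the squared norm of the step element coded by [c], and for
    [F = Num.min] the squared L^2 norm of the step function. *)
Definition quad F c : R := \sum_(p <- c) \sum_(q <- c) p.1 * q.1 * F p.2 q.2.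

Section partition.
Variables (tau : nat -> R) (n : nat) (idx : R * R -> nat) (c : seq (R * R)).
Hypothesis idxP : forall p, p \in c -> p.2 = tau (idx p).
Hypothesis idx_le : forall p, p \in c -> (idx p <= n)%N.

(** The value on the [k]-th cell of the partition of the step function coded by [c]: the cell lies
    in [0, p.2] exactly when [k < idx p]. *)
Let b k : R := \sum_(p <- c) p.1 * (k < idx p)%N%:R.

Lemma telescope_lt (u : nat -> R) m j : (j <= m)%N ->
  \sum_(l < m) (l < j)%N%:R * (u l.+1 - u l) = u j - u 0%N.
Proof.
elim: m j => [|m ih] j.
  by rewrite leqn0 => /eqP ->; rewrite big_ord0 subrr.
rewrite leq_eqVlt => /predU1P[->|jm]; rewrite big_ord_recr /=.
  rewrite (_ : \sum_(l < m) _ = \sum_(l < m) (l < m)%N%:R * (u l.+1 - u l)).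
    by rewrite ih// ltnSn mul1r; ring.
  by apply: eq_bigr => l _; rewrite ltn_ord (ltn_trans (ltn_ord l)).
by rewrite ih// ltnNge -ltnS jm mul0r addr0.
Qed.

Lemma partition_sum (u : R -> R) : u (tau 0%N) = 0 ->
  \sum_(p <- c) p.1 * u p.2 = \sum_(k < n) b k * (u (tau k.+1) - u (tau k)).
Proof.
move=> u0.
under [RHS]eq_bigr do rewrite /b mulr_suml.
rewrite exchange_big /=; apply: eq_big_seq => p pc.
under eq_bigr do rewrite -mulrA.
rewrite -mulr_sumr (telescope_lt (fun k => u (tau k)) (idx_le pc)) u0 subr0.
by rewrite -idxP.
Qed.

Lemma quad_partition F : (forall s, F (tau 0%N) s = 0) -> (forall t, F t (tau 0%N) = 0) ->
  quad F c = \sum_(k < n) \sum_(l < n)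
    b k * b l * rect_incr F (tau k) (tau k.+1) (tau l) (tau l.+1).
Proof.
move=> F0l F0r; rewrite /quad.
transitivity (\sum_(p <- c) p.1 * \sum_(l < n) b l * (F p.2 (tau l.+1) - F p.2 (tau l))).
  apply: eq_bigr => p _; rewrite -(@partition_sum (F p.2))// mulr_sumr.
  by apply: eq_bigr => q _; rewrite mulrA.
rewrite (@partition_sum (fun t => \sum_(l < n) b l * (F t (tau l.+1) - F t (tau l)))).
  apply: eq_bigr => k _; rewrite -sumrB mulr_sumr; apply: eq_bigr => l _.
  by rewrite /rect_incr; ring.
by apply: big1 => l _; rewrite !F0l subrr mulr0.
Qed.

End partition.

(** Bound each product by |b k| |b l| <= (b k ^ 2 + b l ^ 2) / 2; by symmetry of [N] the two halves
    have the same sum, and only row sums remain. *)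
Lemma schur_test n (b : nat -> R) (f N : nat -> nat -> R) (S : nat -> R) :
  (forall k l, (k < n)%N -> (l < n)%N -> `|f k l| <= N k l) ->
  (forall k l, N k l = N l k) ->
  (forall k, (k < n)%N -> \sum_(l < n) N k l <= S k) ->
  \sum_(k < n) \sum_(l < n) b k * b l * f k l <= \sum_(k < n) b k ^+ 2 * S k.
Proof.
move=> fN Nsym NS.
apply: (@le_trans _ _ (\sum_(k < n) \sum_(l < n) (b k ^+ 2 / 2 * N k l + b l ^+ 2 / 2 * N k l))).
  apply: ler_sum => k _; apply: ler_sum => l _.
  apply: (le_trans (ler_norm _)); rewrite normrM -mulrDl.
  apply: ler_pM => //; last exact: fN.
  rewrite normrM -[b k ^+ 2](real_normK (num_real _)) -[b l ^+ 2](real_normK (num_real _)).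
  have := sqr_ge0 (`|b k| - `|b l|); lra.
have -> : \sum_(k < n) \sum_(l < n) (b k ^+ 2 / 2 * N k l + b l ^+ 2 / 2 * N k l) =
    \sum_(k < n) b k ^+ 2 * \sum_(l < n) N k l.
  under eq_bigr do rewrite big_split /=.
  rewrite big_split /= [X in _ + X]exchange_big /= -big_split /=.
  apply: eq_bigr => k _; rewrite mulr_sumr -big_split /=.
  by apply: eq_bigr => l _; rewrite (Nsym l k); field.
by apply: ler_sum => k _; rewrite ler_wpM2l ?sqr_ge0// NS.
Qed.

Lemma times_partition (T : R) c : 0 <= T -> times_in T c ->
  exists (tau : nat -> R) (idx : R * R -> nat), [/\ tau 0%N = 0,
    forall k, tau k <= tau k.+1, forall k, 0 <= tau k <= T,
    forall p, p \in c -> p.2 = tau (idx p) &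
    forall p, p \in c -> (idx p <= size c)%N].
Proof.
move=> T0 tc; pose r := sort <=%R (map snd c).
have rT x : x \in r -> 0 <= x <= T.
  by rewrite mem_sort => /mapP[p pc ->]; have := tc p pc; rewrite in_itv.
have srt : sorted <=%R (0 :: r).
  rewrite /= path_min_sorted; first by rewrite sort_sorted//; exact: le_total.
  by apply/allP => x /rT/andP[].
(* The default value [T] continues the sequence past its end while keeping it monotone in [0, T].
   The successor in the index accounts for the point 0 put in front. *)
exists (fun k => nth T (0 :: r) k), (fun p => (index p.2 r).+1).
have nT k : 0 <= nth T (0 :: r) k <= T.
  have [kr|kr] := ltnP k (size (0 :: r)); last by rewrite nth_default// T0 lexx.
  have := mem_nth T kr; rewrite inE => /predU1P[->|/rT//]; first by rewrite lexx T0.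
split => //.
- move=> k; have [kr|kr] := ltnP k.+1 (size (0 :: r)).
    by move/(sortedP T) : srt; exact.
  by rewrite [leRHS]nth_default//; case/andP: (nT k).
- by move=> p pc; rewrite /= nth_index// mem_sort; apply/mapP; exists p.
- move=> p pc; rewrite -(size_map snd) -(size_sort <=%R (map snd c)) index_mem.
  by rewrite mem_sort; apply/mapP; exists p.
Qed.

End quadratic_forms.

Section hilbert_norm_bound.
Context (R : realType) (H K T : R) (V : bif_hilbert H K T).
Hypotheses (hH : 0 < H < 1) (hK : 0 < K <= 1) (hHK : 1 <= 2 * H * K) (hT : 0 < T).

Lemma step_norm c : times_in T c ->
  `|step_elt (ind V) c| ^+ 2 = quad (bif_cov H K) c.
Proof.
move=> tc; rewrite -dot_norm /step_elt dot_suml /quad; apply: eq_big_seq => p pc.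
rewrite dotZl dot_sumr mulr_sumr; apply: eq_big_seq => q qc.
by rewrite dotZr mulrA dot_ind//; exact: tc.
Qed.

Lemma quad_bif_cov_le c : times_in T c ->
  quad (bif_cov H K) c <= cov_const H K T * quad Num.min c.
Proof.
move=> tc; have [tau [idx [t0 tmono tT idxP idx_le]]] := times_partition (ltW hT) tc.
have Kext (F G : R -> R -> R) : (forall t s, t \in `[0, T] -> s \in `[0, T] -> F t s = G t s) ->
    quad F c = quad G c.
  move=> FG; rewrite /quad; apply: eq_big_seq => p pc; apply: eq_big_seq => q qc.
  by rewrite FG//; exact: tc.
(* [quad_partition] wants a kernel vanishing on the axes for all values of the other argument,
   whereas [bif_cov] and [Num.min] are controlled there for nonnegative ones; [F0] changes them only
   outside the times in use. *)
pose F0 (F : R -> R -> R) t s := if (t <= 0) || (s <= 0) then 0 else F t s.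
have F0E (F : R -> R -> R) : (forall t, 0 <= t -> F 0 t = 0) -> (forall t, 0 <= t -> F t 0 = 0) ->
    forall t s, 0 <= t -> 0 <= s -> F0 F t s = F t s.
  move=> Fl Fr t s; rewrite /F0 le_eqVlt => /predU1P[<-|t0']; first by rewrite lexx => /Fl.
  rewrite le_eqVlt => /predU1P[<-|s0]; first by rewrite lexx orbT Fr// ltW.
  by rewrite leNgt t0' leNgt s0.
have covE := F0E _ (@bif_cov0l R H K hH) (fun t t0 => etrans (bif_covC H K t 0) (@bif_cov0l R H K hH t t0)).
have minE := F0E Num.min (fun t t0 => min_idPl t0) (fun t t0 => min_idPr t0).
have tau0 k : 0 <= tau k by case/andP: (tT k).
rewrite (Kext (bif_cov H K) (F0 (bif_cov H K))); last first.
  move=> t s; rewrite !in_itv /= => /andP[t0' _] /andP[s0 _]; by rewrite covE.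
rewrite (Kext Num.min (F0 Num.min)); last first.
  move=> t s; rewrite !in_itv /= => /andP[t0' _] /andP[s0 _]; by rewrite minE.
have z0l F s : F0 F (tau 0%N) s = 0 by rewrite /F0 t0 lexx.
have z0r F s : F0 F s (tau 0%N) = 0 by rewrite /F0 t0 lexx orbT.
pose b (k : nat) : R := \sum_(p <- c) p.1 * (k < idx p)%N%:R.
have qF F : quad (F0 F) c = \sum_(k < size c) \sum_(l < size c)
    b k * b l * rect_incr (F0 F) (tau k) (tau k.+1) (tau l) (tau l.+1).
  exact: (quad_partition idxP idx_le).
rewrite !qF.
(* The kernel [Num.min] is the covariance of Brownian motion, whose increments over distinct cells
   are uncorrelated: the form is diagonal. *)
have -> : \sum_(k < size c) \sum_(l < size c)
    b k * b l * rect_incr (F0 Num.min) (tau k) (tau k.+1) (tau l) (tau l.+1) =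
    \sum_(k < size c) b k ^+ 2 * (tau k.+1 - tau k).
  apply: eq_bigr => k _; rewrite (bigD1 k)//= big1 ?addr0 => [|l lk].
    rewrite /rect_incr !minE// !minxx (min_idPl (tmono k)) (min_idPr (tmono k)).
    by ring.
  have mono i j : (i <= j)%N -> tau i <= tau j.
    by move=> ij; apply: (homo_leq (f := tau) (r := <=%R)) => //; exact: le_trans.
  rewrite /rect_incr !minE//.
  have [kl|kl] : (k < l)%N \/ (l < k)%N.
    by apply/orP; rewrite -neq_ltn eq_sym.
  - have h1 := mono _ _ kl; have h2 := mono _ _ (leqW kl).
    have h3 := mono _ _ (ltnW kl); have h4 := mono _ _ (leqW (ltnW kl)).
    rewrite (min_idPl h1) (min_idPl h2) (min_idPl h3) (min_idPl h4); ring.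
  - have h1 := mono _ _ kl; have h2 := mono _ _ (leqW kl).
    have h3 := mono _ _ (ltnW kl); have h4 := mono _ _ (leqW (ltnW kl)).
    rewrite (min_idPr h1) (min_idPr h2) (min_idPr h3) (min_idPr h4); ring.
rewrite mulr_sumr.
under [leRHS]eq_bigr do rewrite mulrCA.
(* The rows of the dominating kernel telescope along the partition, and [cov_dom_total] bounds their
   sums by a multiple of the cell length. *)
apply: (@schur_test _ _ b
  (fun k l => rect_incr (F0 (bif_cov H K)) (tau k) (tau k.+1) (tau l) (tau l.+1))
  (fun k l => rect_incr (cov_dom H K) (tau k) (tau k.+1) (tau l) (tau l.+1))
  (fun k => cov_const H K T * (tau k.+1 - tau k))).
- move=> k l _ _; rewrite {1}/rect_incr !covE//.
  exact: cov_incr_dom.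
- by move=> k l; rewrite /rect_incr !(cov_domC _ _ (tau k)) !(cov_domC _ _ (tau k.+1)); ring.
- move=> k _; pose G j := cov_dom H K (tau k.+1) (tau j) - cov_dom H K (tau k) (tau j).
  have -> : \sum_(l < size c) rect_incr (cov_dom H K) (tau k) (tau k.+1) (tau l) (tau l.+1) =
      rect_incr (cov_dom H K) (tau k) (tau k.+1) 0 (tau (size c)).
    transitivity (\sum_(l < size c) (G l.+1 - G l)).
      by apply: eq_bigr => l _; rewrite /G /rect_incr; ring.
    rewrite -(big_mkord xpredT (fun l => G l.+1 - G l)) telescope_sumr//.
    by rewrite /G /rect_incr t0; ring.
  by apply: cov_dom_total => //; case/andP: (tT k.+1).
Qed.

Local Notation mu := (@lebesgue_measure R).

Lemma integral_step_fun_sqr c : times_in T c ->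
  (\int[mu]_(x in `[0%R, T]) (step_fun c x ^+ 2)%:E = (quad Num.min c)%:E)%E.
Proof.
move=> tc.
have mi : measurable (`[0, T] : set (measurableTypeR R)) by exact: measurable_itv.
pose f (p q : R * R) (x : R) : R := p.1 * q.1 * \1_(`[0, Num.min p.2 q.2]) x.
have mind (t : R) : measurable_fun (`[0, T] : set (measurableTypeR R)) (\1_(`[0, t]) : R -> R).
  by apply: measurable_indic; exact: measurable_itv.
have fi p q : mu.-integrable `[0, T] (EFin \o f p q).
  apply: measurable_bounded_integrable => //.
  - by rewrite /= lebesgue_measure_itv /= lte_fin hT ltry.
  - by apply: measurable_funM => //; exact: mind.
  - exists `|p.1 * q.1|; split => // M pM x _ /=; rewrite (le_trans _ (ltW pM))//.
    by rewrite /f normrM ler_piMr// indicE; case: (_ \in _); rewrite ?normr0 ?normr1.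
have fe x : (step_fun c x ^+ 2)%:E = (\sum_(p <- c) \sum_(q <- c) (f p q x)%:E)%E.
  under eq_bigr do rewrite sumEFin.
  rewrite sumEFin; congr EFin; rewrite expr2 /step_fun mulr_suml.
  apply: eq_bigr => p _; rewrite mulr_sumr; apply: eq_bigr => q _.
  rewrite mulrACA /f; congr (_ * _); rewrite !indicE -natrM mulnb; congr (nat_of_bool _)%:R.
  apply/andP/idP; rewrite !inE /= !in_itv /= le_min.
    by move=> [/andP[-> ->] /andP[_ ->]].
  by move=> /and3P[-> -> ->]; rewrite ?inE.
under eq_integral do rewrite fe.
rewrite integral_sum//=; last first.
  move=> p; apply: integrable_sum => [|q _]; [exact: mi|exact: fi].
pose m (p q : R * R) := p.1 * q.1 * Num.min p.2 q.2.
have ind_int p q : p \in c -> q \in c ->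
    (\int[mu]_(x in `[0%R, T]) (f p q x)%:E = (m p q)%:E)%E.
  move=> pc qc.
  have m0 : 0 <= Num.min p.2 q.2 <= T.
    have := tc p pc; have := tc q qc; rewrite !in_itv /= => /andP[q0 qT] /andP[p0 pT].
    by rewrite le_min p0 q0 ge_min pT.
  have /andP[m1 m2] := m0.
  rewrite /f; under eq_integral do rewrite EFinM.
  rewrite integralZl//; last first.
    apply: measurable_bounded_integrable => //.
    - by rewrite /= lebesgue_measure_itv /= lte_fin hT ltry.
    - exists 1; split => // M pM x _ /=; rewrite (le_trans _ (ltW pM))//.
      by rewrite indicE; case: (_ \in _); rewrite ?normr0 ?normr1.
  rewrite integral_indic//= setIidl; last first.
    by move=> x /=; rewrite !in_itv /= => /andP[-> /le_trans]; apply.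
  rewrite lebesgue_measure_itv /= lte_fin /m.
  rewrite [RHS]EFinM; congr (_ * _)%E; rewrite oppr0 adde0.
  by move: m1; rewrite le_eqVlt => /predU1P[<-|->]; rewrite ?ltxx.
have inner p : p \in c ->
    (\int[mu]_(x in `[0%R, T]) (\sum_(q <- c) (f p q x)%:E) = (\sum_(q <- c) m p q)%R%:E)%E.
  move=> pc; rewrite integral_sum//; last by move=> q; exact: fi.
  rewrite -sumEFin; etransitivity; first by apply: eq_big_seq => q qc; exact: ind_int pc qc.
  by [].
etransitivity; first by apply: eq_big_seq => p pc; exact: inner pc.
by rewrite sumEFin.
Qed.

Lemma step_norm_le c : times_in T c ->
  (((`|step_elt (ind V) c|) ^+ 2)%:E <= (cov_const H K T)%:E *
    \int[mu]_(x in `[0%R, T]) (step_fun c x ^+ 2)%:E)%E.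
Proof.
move=> tc; rewrite integral_step_fun_sqr// -EFinM lee_fin step_norm//.
exact: quad_bif_cov_le.
Qed.

End hilbert_norm_bound.

(** * Riemann sums *)

Section hilbert_embedding.
Context (R : realType) (H K T : R) (V : bif_hilbert H K T).
Hypotheses (hH : 0 < H < 1) (hK : 0 < K <= 1) (hHK : 1 <= 2 * H * K) (hT : 0 < T).
Local Notation mu := (@lebesgue_measure R).

Definition neg_times (c : seq (R * R)) := [seq (- p.1, p.2) | p <- c].

Lemma step_elt_cat c c' :
  step_elt (ind V) (c ++ c') = step_elt (ind V) c + step_elt (ind V) c'.
Proof. by rewrite /step_elt big_cat. Qed.

Lemma step_elt_neg c : step_elt (ind V) (neg_times c) = - step_elt (ind V) c.
Proof.
rewrite /step_elt big_map -sumrN; apply: eq_bigr => p _ /=.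
by rewrite scaleNr.
Qed.

Lemma step_fun_cat (c c' : seq (R * R)) x :
  step_fun (c ++ c') x = step_fun c x + step_fun c' x.
Proof. by rewrite /step_fun big_cat. Qed.

Lemma step_fun_neg (c : seq (R * R)) x : step_fun (neg_times c) x = - step_fun c x.
Proof.
by rewrite /step_fun big_map -sumrN; apply: eq_bigr => p _ /=; rewrite mulNr.
Qed.

Lemma times_in_cat (c c' : seq (R * R)) :
  times_in T c -> times_in T c' -> times_in T (c ++ c').
Proof. by move=> tc tc' p; rewrite mem_cat => /orP[/tc|/tc']. Qed.

Lemma times_in_neg (c : seq (R * R)) : times_in T c -> times_in T (neg_times c).
Proof. by move=> tc p /mapP[q qc ->] /=; exact: tc. Qed.

Lemma measurable_step_fun (c : seq (R * R)) (D : set R) : measurable D ->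
  measurable_fun (D : set (measurableTypeR R)) (step_fun c).
Proof.
by move=> mD; apply: measurable_sum => p; exact: measurable_funM.
Qed.

Let mI : measurable (`[0, T] : set (measurableTypeR R)).
Proof. exact: measurable_itv. Qed.

Definition l2dist (phi : R -> R) c : \bar R :=
  (\int[mu]_(x in `[0%R, T]) ((phi x - step_fun c x) ^+ 2)%:E)%E.

Lemma step_dist_le phi c c' : measurable_fun `[0, T] phi ->
  times_in T c -> times_in T c' ->
  (((`|step_elt (ind V) c - step_elt (ind V) c'|) ^+ 2)%:E <=
   (2 * cov_const H K T)%:E * (l2dist phi c + l2dist phi c'))%E.
Proof.
move=> mphi tc tc'.
have := step_norm_le V hH hK hHK hT (times_in_cat tc (times_in_neg tc')).
rewrite step_elt_cat step_elt_neg => /le_trans; apply.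
rewrite [2 * _]mulrC.
have := @cov_const_ge0 _ H K T hT; move: (cov_const H K T) => C C0.
rewrite [(C * 2)%:E]EFinM -muleA; apply: lee_wpmul2l; first by rewrite lee_fin.
have md c0 : measurable_fun (`[0, T] : set (measurableTypeR R))
    (fun x => ((phi x - step_fun c0 x) ^+ 2)%:E).
  apply/measurable_EFinP; apply: measurable_funX; apply: measurable_funB => //.
  exact: measurable_step_fun.
have pos c0 (x : R) : (0 <= ((phi x - step_fun c0 x) ^+ 2)%:E)%E.
  by rewrite lee_fin sqr_ge0.
rewrite /l2dist -ge0_integralD//= -ge0_integralZl//=; last 2 first.
- by apply: emeasurable_funD; exact: md.
- by move=> x _; rewrite adde_ge0.
apply: ge0_le_integral => //=.
- by move=> x _; rewrite lee_fin sqr_ge0.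
- apply/measurable_EFinP; apply: measurable_funX; exact: measurable_step_fun.
- by apply: measurable_funeM; apply: emeasurable_funD; exact: md.
- move=> x _; rewrite -EFinD -EFinM lee_fin step_fun_cat step_fun_neg.
  have := sqr_ge0 ((phi x - step_fun c x) + (phi x - step_fun c' x)).
  nra.
Qed.

(** Two approximating sequences of the same function are close to each other in L^2, hence in norm.
    This makes the choice in [toH] unambiguous. *)
Lemma represents_unique phi (h1 h2 : V) :
  represents phi h1 -> represents phi h2 -> h1 = h2.
Proof.
move=> [mphi [c [tc cc ch]]] [_ [c' [tc' cc' ch']]].
have cd : step_elt (ind V) (c n) - step_elt (ind V) (c' n) @[n --> \oo] --> h1 - h2.
  exact: cvgB.
have cd2 : (`|step_elt (ind V) (c n) - step_elt (ind V) (c' n)| ^+ 2)%:E @[n --> \oo]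
    --> (`|h1 - h2| ^+ 2)%:E.
  apply: cvg_EFin; first exact: nearW.
  under eq_fun do rewrite /= expr2; rewrite expr2.
  by apply: cvgM; apply: cvg_norm.
have cz : ((2 * cov_const H K T)%:E * (l2dist phi (c n) + l2dist phi (c' n)))%E
    @[n --> \oo] --> 0%E.
  rewrite -[X in _ --> X](mule0 (2 * cov_const H K T)%:E).
  apply: cvgeZl => //; rewrite -[X in _ --> X](adde0 0%E).
  exact: cvgeD.
have le0 : ((`|h1 - h2| ^+ 2)%:E <= 0%E)%E.
  rewrite -(cvg_lim (@ereal_hausdorff R) cd2) -(cvg_lim (@ereal_hausdorff R) cz).
  apply: lee_lim; [exact: cvgP cd2|exact: cvgP cz|].
  by apply: nearW => n; exact: step_dist_le.
apply/eqP; rewrite -subr_eq0 -normr_eq0 -sqrf_eq0 eq_le sqr_ge0 andbT.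
by rewrite -lee_fin.
Qed.

Lemma toH_eq phi (h : V) : represents phi h -> toH V phi = h.
Proof.
move=> rh; apply: represents_unique (rh).
exact: (@xgetPex _ 0 [set h | represents phi h] (ex_intro _ h rh)).
Qed.

(** The norm bound turns L^2 convergence of the step functions into a Cauchy sequence; completeness
    of the Hilbert space provides the limit, which then represents [phi]. *)
Lemma toH_cvg phi (c : nat -> seq (R * R)) : measurable_fun `[0, T] phi ->
  (forall n, times_in T (c n)) -> (l2dist phi (c n) @[n --> \oo] --> 0%E) ->
  step_elt (ind V) (c n) @[n --> \oo] --> toH V phi.
Proof.
move=> mphi tc cc.
suff : cvg (step_elt (ind V) (c n) @[n --> \oo]).
  by move=> /cvg_ex[h ch]; rewrite (@toH_eq phi h)//; split => //; exists c.
apply: cauchy_cvg; apply/cauchy_ballP => e e0.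
have C0 := @cov_const_ge0 _ H K T hT.
(* Two terms at distance d from [phi] are at squared distance at most 4 C d from each other; the
   added 1 makes the divisor positive. *)
pose D := 4 * cov_const H K T + 1.
have D0 : 0 < D by rewrite /D ltr_wpDl// mulr_ge0.
pose d := e ^+ 2 / D.
have d0 : 0 < d by rewrite divr_gt0// exprn_gt0.
have [N _ hN] : \forall n \near \oo, (l2dist phi (c n) < d%:E)%E.
  have : nbhs 0%E [set y : \bar R | (y < d%:E)%E].
    by apply: open_nbhs_nbhs; split; [exact: open_ereal_lt_ereal|rewrite /= lte_fin].
  exact: cc.
pose A : set V := [set v | exists2 n, (N <= n)%N & v = step_elt (ind V) (c n)].
exists (A, A).
  by split; exists N => // n Nn; exists n.
move=> [_ _] [/= [n Nn ->] [m Nm ->]]; rewrite -ball_normE /=.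
rewrite -(@ltr_pXn2r _ 2)// ?nnegrE ?(ltW e0)// -lte_fin.
apply: (le_lt_trans (step_dist_le mphi (tc n) (tc m))).
have ln := ltW (hN n Nn); have lm := ltW (hN m Nm).
apply: (@le_lt_trans _ _ ((2 * cov_const H K T)%:E * (d%:E + d%:E))%E).
  by apply: lee_wpmul2l; [rewrite lee_fin mulr_ge0|exact: leeD].
rewrite -EFinD -EFinM lte_fin.
have -> : 2 * cov_const H K T * (d + d) = 4 * cov_const H K T * (e ^+ 2 / D) by rewrite /d; ring.
rewrite mulrA ltr_pdivrMr// mulrC ltr_pM2l ?exprn_gt0//.
by rewrite /D ltrDl.
Qed.

End hilbert_embedding.

Section grid_approximation.
Context (R : realType) (H K T : R) (V : bif_hilbert H K T).
Hypotheses (hH : 0 < H < 1) (hK : 0 < K <= 1) (hHK : 1 <= 2 * H * K) (hT : 0 < T).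
Local Notation mu := (@lebesgue_measure R).
Variables (t : R) (p : R -> R) (M : R).
Hypothesis tT : t \in `[0, T].
Hypothesis pM : forall x, `|p x| <= M.
Hypothesis pcont : forall x e, x \in `[0, T] -> 0 < e -> exists2 d, 0 < d &
  forall y, y \in `[0, T] -> `|y - x| < d -> `|p y - p x| <= e.

Definition grid n k : R := t * k%:R / n.+1%:R.

(** The step function with value [p (grid n k)] on each cell open on the left, coded as a difference
    of initial indicators because lists of pairs express nothing else. *)
Definition grid_steps n : seq (R * R) :=
  [seq (p (grid n k), grid n k.+1) | k <- iota 0 n.+1] ++
  [seq (- p (grid n k), grid n k) | k <- iota 0 n.+1].

Let t0 : 0 <= t. Proof. by move: tT; rewrite in_itv /= => /andP[]. Qed.
Let tT' : t <= T. Proof. by move: tT; rewrite in_itv /= => /andP[]. Qed.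

Lemma grid0 n : grid n 0 = 0. Proof. by rewrite /grid mulr0 mul0r. Qed.

Lemma gridN n : grid n n.+1 = t. Proof. by rewrite /grid mulfK. Qed.

Lemma grid_mono n k l : (k <= l)%N -> grid n k <= grid n l.
Proof. by move=> kl; rewrite /grid ler_wpM2r// ler_wpM2l// ler_nat. Qed.

Lemma grid_itv n k : (k <= n.+1)%N -> 0 <= grid n k <= t.
Proof.
move=> kn; have h := grid_mono n kn; rewrite gridN in h.
by rewrite h andbT /grid divr_ge0// mulr_ge0.
Qed.

Lemma grid_in n k : (k <= n.+1)%N -> grid n k \in `[0, T].
Proof.
move=> kn; have /andP[h1 h2] := grid_itv kn.
by rewrite in_itv /= h1 (le_trans h2).
Qed.

Lemma gridS n k : grid n k.+1 - grid n k = t / n.+1%:R.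
Proof. by rewrite /grid -mulrBl -mulrBr -natrB// subSnn mulr1. Qed.

Lemma grid_steps_times n : times_in T (grid_steps n).
Proof.
move=> q; rewrite mem_cat => /orP[] /mapP[k]; rewrite mem_iota add0n => /andP[_ kn] -> /=.
  exact: grid_in.
by apply: grid_in; exact: ltnW.
Qed.

Lemma grid_steps_elt n : step_elt (ind V) (grid_steps n) =
  \sum_(k < n.+1) p (grid n k) *: (ind V (grid n k.+1) - ind V (grid n k)).
Proof.
rewrite /step_elt /grid_steps big_cat !big_map.
rewrite (_ : iota 0 n.+1 = index_iota 0 n.+1); last by rewrite /index_iota subn0.
rewrite /= -big_split /= big_mkord.
by apply: eq_bigr => k _ /=; rewrite scalerBr scaleNr.
Qed.

Lemma grid_steps_fun n x : step_fun (grid_steps n) x =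
  \sum_(k < n.+1) p (grid n k) * (\1_(`[0, grid n k.+1]) x - \1_(`[0, grid n k]) x).
Proof.
rewrite /step_fun /grid_steps big_cat !big_map.
rewrite (_ : iota 0 n.+1 = index_iota 0 n.+1); last by rewrite /index_iota subn0.
rewrite /= -big_split /= big_mkord.
by apply: eq_bigr => k _ /=; rewrite mulrBr mulNr.
Qed.

Lemma grid_steps_out n x : ~~ (0 < x <= t) -> step_fun (grid_steps n) x = 0.
Proof.
move=> xt; rewrite grid_steps_fun big1// => k _.
suff -> : \1_`[0, grid n k.+1] x = \1_`[0, grid n k] x :> R by rewrite subrr mulr0.
rewrite !indicE; congr (nat_of_bool _)%:R.
have /andP[g1 g2] := grid_itv (ltn_ord k : (k.+1 <= n.+1)%N).
have /andP[g3 g4] := grid_itv (ltnW (ltn_ord k) : (k <= n.+1)%N).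
apply/idP/idP; rewrite !inE /= !in_itv /= => /andP[x0 xg]; rewrite x0 /=.
- move: xt; rewrite negb_and -leNgt -ltNge => /orP[|] h.
    by have -> : x = 0 by apply/eqP; rewrite eq_le h.
  by have := le_lt_trans g2 h; rewrite ltNge xg.
- by apply: (le_trans xg); exact: grid_mono.
Qed.

Lemma grid_steps_eval n x : 0 < x <= t -> exists k, [/\ (k < n.+1)%N,
  grid n k < x <= grid n k.+1 & step_fun (grid_steps n) x = p (grid n k)].
Proof.
move=> /andP[x0 xt].
have ex : exists j, (x <= grid n j) by exists n.+1; rewrite gridN.
have [j xj jmin] := ex_minnP ex.
case: j => [|k] in xj jmin *; first by move: xj; rewrite grid0 leNgt x0.
have kn : (k < n.+1)%N by apply: (jmin n.+1); rewrite gridN.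
have gx : grid n k < x.
  by rewrite ltNge; apply/negP => /jmin; rewrite ltnn.
exists k; split => //; first by rewrite gx.
have ie (a : R) : \1_(`[0, a]) x = (x <= a)%R%:R :> R.
  rewrite indicE; congr (nat_of_bool _)%:R; apply/idP/idP; rewrite !inE /= in_itv /= (ltW x0)//.
rewrite grid_steps_fun (bigD1 (Ordinal kn))//= big1 => [|l lk].
  by rewrite !ie xj leNgt gx subr0 mulr1 addr0.
rewrite !ie; have [lk'|kl|e] := ltngtP l k.
- rewrite !leNgt (le_lt_trans (grid_mono n lk') gx).
  by rewrite (le_lt_trans (grid_mono n (ltnW lk')) gx) subrr mulr0.
- rewrite (le_trans xj (grid_mono n kl)) (le_trans xj (grid_mono n (leqW kl))).
  by rewrite subrr mulr0.
- by move: lk; rewrite -(inj_eq val_inj) /= e eqxx.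
Qed.

Lemma grid_steps_bound n x : `|step_fun (grid_steps n) x| <= M.
Proof.
have M0 := le_trans (normr_ge0 _) (pM 0).
have [xt|xt] := boolP (0 < x <= t); last by rewrite grid_steps_out// normr0.
by have [k [_ _ ->]] := grid_steps_eval n xt.
Qed.

Let phi x := p x * \1_(`]0, t]) x.

Lemma grid_steps_cvg x : step_fun (grid_steps n) x @[n --> \oo] --> phi x.
Proof.
have [xt|xt] := boolP (0 < x <= t); last first.
  rewrite (_ : phi x = 0); last first.
    rewrite /phi indicE (_ : (x \in _) = false) ?mulr0//.
    by apply/negbTE; apply: contra xt; rewrite inE /= in_itv.
  by under eq_fun do rewrite grid_steps_out//; exact: cvg_cst.
have -> : phi x = p x.
  by rewrite /phi indicE mem_set ?mulr1// /= in_itv.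
have /andP[x0 xt'] := xt.
have xT : x \in `[0, T] by rewrite in_itv /= (ltW x0) (le_trans xt').
apply/cvgrPdist_le => e e0; have [d d0 hd] := pcont xT e0.
have c0 : t / n.+1%:R @[n --> \oo] --> 0.
  rewrite -(mulr0 t); apply: cvgM; first exact: cvg_cst.
  exact: (@cvg_harmonic R).
near=> n.
have [k [kn /andP[gk kg] ->]] := grid_steps_eval n xt.
rewrite distrC; apply: hd; first by apply: grid_in; exact: ltnW.
rewrite distrC gtr0_norm ?subr_gt0//.
apply: (@le_lt_trans _ _ (t / n.+1%:R)).
  by rewrite -(gridS n k) lerD2r.
apply: (le_lt_trans (ler_norm _)); near: n.
by move/cvgr0Pnorm_lt : c0; apply.
Unshelve. all: by end_near. Qed.

Let mI : measurable (`[0, T] : set (measurableTypeR R)).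
Proof. exact: measurable_itv. Qed.

Lemma grid_limit_measurable : measurable_fun `[0, T] phi.
Proof.
apply: (measurable_fun_cvg (h := fun n => step_fun (grid_steps n))).
  by move=> n; exact: measurable_step_fun.
by move=> x _; exact: grid_steps_cvg.
Qed.

Lemma grid_l2dist : l2dist T phi (grid_steps n) @[n --> \oo] --> 0%E.
Proof.
have M0 := le_trans (normr_ge0 _) (pM 0).
have phiM x : `|phi x| <= M.
  rewrite /phi normrM indicE; case: (_ \in _); rewrite ?normr1 ?normr0 ?mulr1 ?mulr0//.
pose f n x : \bar R := ((phi x - step_fun (grid_steps n) x) ^+ 2)%:E.
have [|||||_ _] := @dominated_convergence _ (measurableTypeR R) R mu (`[0, T] : set R) mI
  f (fun=> 0%E) (fun=> ((2 * M) ^+ 2)%:E).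
- move=> n; apply/measurable_EFinP; apply: measurable_funX; apply: measurable_funB.
    exact: grid_limit_measurable.
  exact: measurable_step_fun.
- exact: measurable_cst.
- apply: aeW => x _; apply: cvg_EFin; first exact: nearW.
  rewrite (_ : 0 = (phi x - phi x) ^+ 2); last by rewrite subrr expr0n.
  under eq_fun do rewrite /f /= expr2; rewrite expr2.
  have h : phi x - step_fun (grid_steps n) x @[n --> \oo] --> phi x - phi x.
    by apply: (@cvgB _ R^o); [exact: cvg_cst|exact: grid_steps_cvg].
  by apply: cvgM.
- apply/integrableP; split; first exact: measurable_cst.
  rewrite integral_cst//= lebesgue_measure_itv /= lte_fin hT -EFinB -EFinM ltry//.
- apply: aeW => x n _; rewrite /f /= lee_fin ger0_norm ?sqr_ge0//.
  rewrite -(real_normK (num_real (_ - _))) lerXn2r ?nnegrE ?mulr_ge0//.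
  rewrite (le_trans (ler_normB _ _))// mulr_natl mulr2n lerD//.
  exact: grid_steps_bound.
by rewrite integral0.
Qed.

Lemma grid_toH :
  \sum_(k < n.+1) p (grid n k) *: (ind V (grid n k.+1) - ind V (grid n k)) @[n --> \oo]
  --> toH V phi.
Proof.
under eq_fun do rewrite -grid_steps_elt.
apply: toH_cvg => //; first exact: grid_limit_measurable.
  exact: grid_steps_times.
exact: grid_l2dist.
Qed.

End grid_approximation.

(** * Convergence of the time integral *)

Section Rintegral_tools.
Context d (X : measurableType d) (R : realType) (mu : {measure set X -> \bar R}).
Variables (D : set X) (mD : measurable D).

Lemma Rintegral_dct (f_ : nat -> X -> R) (f g : X -> R) :
  (forall n, measurable_fun D (f_ n)) ->
  (forall x, D x -> f_ n x @[n --> \oo] --> f x) ->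
  mu.-integrable D (EFin \o g) ->
  (forall n x, D x -> `|f_ n x| <= g x) ->
  mu.-integrable D (EFin \o f) /\
  \int[mu]_(x in D) f_ n x @[n --> \oo] --> \int[mu]_(x in D) f x.
Proof.
move=> mf_ ff ig fg.
have mf : measurable_fun D f by exact: (measurable_fun_cvg mf_ ff).
have mEf_ n : measurable_fun D (EFin \o f_ n) by exact/measurable_EFinP.
have mEf : measurable_fun D (EFin \o f) by exact/measurable_EFinP.
have cf : {ae mu, forall x, D x -> (EFin \o f_ n) x @[n --> \oo] --> (EFin \o f) x}.
  by apply: aeW => x Dx; apply: cvg_EFin; [exact: nearW|exact: ff].
have bf : {ae mu, forall x n, D x -> (`|(EFin \o f_ n) x| <= (EFin \o g) x)%E}.
  by apply: aeW => x n Dx; rewrite lee_fin; exact: fg.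
have [iF _ cE] := dominated_convergence mD mEf_ mEf cf ig bf.
by split => //; apply: fine_cvg; rewrite fineK//; exact: integrable_fin_num.
Qed.

Lemma Rintegral_sum (I : Type) (s : seq I) (F : I -> X -> R) :
  (forall i, mu.-integrable D (EFin \o F i)) ->
  mu.-integrable D (EFin \o (fun x => \sum_(i <- s) F i x)) /\
  \int[mu]_(x in D) (\sum_(i <- s) F i x) = \sum_(i <- s) \int[mu]_(x in D) F i x.
Proof.
move=> iF; elim: s => [|i s [ih1 ih2]].
  split.
    rewrite (_ : EFin \o _ = cst 0%E); first exact: integrable0.
    by apply/funext => x /=; rewrite big_nil.
  rewrite big_nil (_ : (fun x => _) = cst 0); last by apply/funext => x; rewrite big_nil.
  by rewrite Rintegral_cst// mul0r.
split.
  rewrite (_ : EFin \o _ = ((EFin \o F i) \+ (EFin \o (fun x => (\sum_(i <- s) F i x)%R)))%E).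
    exact: integrableD.
  by apply/funext => x /=; rewrite big_cons EFinD.
rewrite (_ : (fun x => _) = (fun x => F i x + \sum_(i <- s) F i x)).
  by rewrite RintegralD// big_cons ih2.
by apply/funext => x; rewrite big_cons.
Qed.

End Rintegral_tools.

Section time_integral.
Context (R : realType) (q : R).
Hypothesis q1 : 1 <= q.
Local Notation mu := (@lebesgue_measure R).

Let q0 : 0 < q. Proof. exact: lt_le_trans q1. Qed.

Lemma powR_within_continuous (r a : R) : 0 <= r -> 0 < a ->
  {within `[0, a], continuous (fun x : R => x `^ r)}.
Proof.
move=> r0 a0; have cont x : 0 < x -> {for x, continuous (fun x : R => x `^ r)}.
  by move=> x0; exact: deriv_continuous (is_derive1_powR r x0).
apply/continuous_within_itvP => //; split.
- by move=> x; rewrite in_itv /= => /andP[x0 _]; exact: cont.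
- have [->|r0'] := eqVneq r 0.
    by under eq_fun do rewrite powRr0; rewrite powRr0; exact: cvg_cst.
  by rewrite powR0//; apply: powR_cvg0; rewrite lt_neqAle eq_sym r0'.
- by apply: cvg_at_left_filter; exact: cont.
Qed.

Lemma integral_powR (a : R) : 0 <= a ->
  mu.-integrable `[0, a] (fun x => (x `^ (q - 1))%:E) /\
  \int[mu]_(x in `[0, a]) (x `^ (q - 1)) = a `^ q / q.
Proof.
rewrite le_eqVlt => /predU1P[<-|a0].
  rewrite set_itv1; split; last by rewrite Rintegral_set1 powR0 ?mul0r// gt_eqF.
  apply/integrableP; split; first exact/measurable_EFinP/measurable_fun_set1.
  by rewrite integral_set1 ltry.
have q10 : 0 <= q - 1 by rewrite subr_ge0.
have cf := powR_within_continuous q10 a0.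
split.
  by apply: continuous_compact_integrable => //; exact: segment_compact.
have cF := powR_within_continuous (ltW q0) a0.
have /continuous_within_itvP := cF => /(_ a0)[c1 c2 c3].
have qK (x : R) : x `^ q / q = q^-1 * x `^ q by rewrite mulrC.
rewrite /Rintegral (continuous_FTC2 (F := fun x => x `^ q / q) a0 cf).
- by rewrite powR0 ?gt_eqF// mul0r -EFinB subr0.
- split.
  + move=> x; rewrite in_itv /= => /andP[x0 _].
    have := derivZ q^-1 (is_derive1_powR q x0); under eq_fun do rewrite -qK.
    by case.
  + by apply: cvgM; [exact: c2|exact: cvg_cst].
  + by apply: cvgM; [exact: c3|exact: cvg_cst].
- move=> x; rewrite in_itv /= => /andP[x0 _].
  have := derivZ q^-1 (is_derive1_powR q x0); under eq_fun do rewrite -qK.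
  by move=> [_ ]; rewrite derive1E => ->; rewrite mulrA mulVf ?mul1r// gt_eqF.
Qed.

Variables (T t : R) (p : R -> R) (M : R).
Hypothesis tT : t \in `[0, T].
Hypothesis pM : forall x, `|p x| <= M.
Hypothesis pcont : forall x e, x \in `[0, T] -> 0 < e -> exists2 d, 0 < d &
  forall y, y \in `[0, T] -> `|y - x| < d -> `|p y - p x| <= e.

(** Each weight (s'^q - s^q) / 2 is q / 2 times the integral of s^(q-1) over the cell. The sum is
    thus the integral of a step function against s^(q-1), and dominated convergence applies. *)
Lemma time_integral_cvg :
  \sum_(k < n.+1) p (grid t n k) * ((grid t n k.+1 `^ q - grid t n k `^ q) / 2)
    @[n --> \oo] --> q / 2 * \int[mu]_(s in `[0, t]) (p s * s `^ (q - 1)).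
Proof.
have /andP[t0 tT'] : 0 <= t <= T by move: tT; rewrite in_itv.
have mI : measurable (`[0, t] : set (measurableTypeR R)) by exact: measurable_itv.
have ipow (a : R) : 0 <= a <= t ->
    mu.-integrable `[0, t] (EFin \o (fun x => \1_(`[0, a]) x * x `^ (q - 1))) /\
    \int[mu]_(x in `[0, t]) (\1_(`[0, a]) x * x `^ (q - 1)) = a `^ q / q.
  move=> /andP[a0 at'].
  have E : (fun x : R => \1_(`[0, a]) x * x `^ (q - 1)) = (fun x : R => x `^ (q - 1)) \_ [set` `[0, a]].
    apply/funext => x; rewrite patchE indicE.
    by case: ifPn; rewrite ?mul1r ?mul0r.
  have S : [set` `[0, t]] `&` [set` `[0, a]] = [set` `[0, a]] :> set R.
    rewrite setIC; apply/setIidl => x /=; rewrite !in_itv /= => /andP[-> xa].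
    exact: le_trans xa at'.
  rewrite E -Rintegral_mkcondr S; have [i1 i2] := integral_powR a0.
  split => //; apply: (integrable_mkcond _ mI).2 => /=.
  have -> : (EFin \o ((fun x : R => x `^ (q - 1)) \_ [set` `[0, a]])) \_ [set` `[0, t]] =
      (fun x : R => (x `^ (q - 1))%:E) \_ [set` `[0, a]].
    apply/funext => x; rewrite -[in RHS]S !patchE /= patchE in_setI.
    by case: (x \in [set` `[0, t]]); case: (x \in [set` `[0, a]]).
  have ma : measurable ([set` `[0, a]] : set (measurableTypeR R)) by exact: measurable_itv.
  exact: (integrable_mkcond _ ma).1.
pose f n x := step_fun (grid_steps t p n) x * x `^ (q - 1).
have fE n : mu.-integrable `[0, t] (EFin \o f n) /\ \int[mu]_(x in `[0, t]) f n x =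
   \sum_(k < n.+1) p (grid t n k) * ((grid t n k.+1 `^ q - grid t n k `^ q) / q).
  pose F (k : 'I_n.+1) x := p (grid t n k) *
    (\1_(`[0, grid t n k.+1]) x * x `^ (q - 1) - \1_(`[0, grid t n k]) x * x `^ (q - 1)).
  have -> : f n = (fun x => \sum_(k < n.+1) F k x).
    apply/funext => x; rewrite /f grid_steps_fun mulr_suml; apply: eq_bigr => k _.
    by rewrite /F -mulrBl mulrA.
  have iF k : mu.-integrable `[0, t] (EFin \o F k) /\ \int[mu]_(x in `[0, t]) F k x =
      p (grid t n k) * ((grid t n k.+1 `^ q - grid t n k `^ q) / q).
    have [i1 v1] := ipow _ (grid_itv tT (ltn_ord k : (k.+1 <= n.+1)%N)).
    have [i2 v2] := ipow _ (grid_itv tT (ltnW (ltn_ord k) : (k <= n.+1)%N)).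
    have iB := integrableB mI i1 i2; split.
      exact: (integrableZl mI (p (grid t n k)) iB).
    by rewrite RintegralZl// RintegralB// v1 v2 mulrBl.
  have [h ->] := Rintegral_sum mI (index_enum _) (fun k => (iF k).1).
  by split => //; apply: eq_bigr => k _; exact: (iF k).2.
have mpow : measurable_fun `[0, t] (fun x : measurableTypeR R => x `^ (q - 1)).
  apply: (measurable_funS measurableT) => //; exact: measurable_powR.
have [ipq _] := integral_powR t0.
have [] := @Rintegral_dct _ (measurableTypeR R) R mu `[0, t] mI f
   (fun x => p x * \1_(`]0, t]) x * x `^ (q - 1)) (fun x => M * x `^ (q - 1)).
- by move=> n; have /integrableP[/measurable_EFinP] := (fE n).1.
- move=> x _; apply: (@cvgM R _ eventually); last exact: cvg_cst.
  exact: (grid_steps_cvg tT pcont).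
- exact: (integrableZl mI M ipq).
- move=> n x _; rewrite normrM (ger0_norm (powR_ge0 _ _)).
  by rewrite ler_wpM2r ?powR_ge0//; exact: (grid_steps_bound tT).
pose h (x : R) := p x * \1_(`]0, t]) x * x `^ (q - 1).
rewrite -/h => ih cf.
have ho : \int[mu]_(x in `[0, t]) h x = \int[mu]_(s in `[0, t]) (p s * s `^ (q - 1)).
  have io : mu.-integrable `]0, t] (EFin \o h).
    by apply: integrableS ih => // x /=; rewrite !in_itv /= => /andP[/ltW-> ->].
  have eo (x : R) : x \in [set` `]0, t]] -> h x = p x * x `^ (q - 1).
    by move=> xo; rewrite /h indicE xo mulr1.
  rewrite -(Rintegral_itv_obnd_cbnd io) -Rintegral_itv_obnd_cbnd.
    exact: eq_Rintegral.
  by apply: eq_integrable io => // x xo /=; rewrite eo.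
rewrite -ho (_ : (fun n => _) = (fun n => q / 2 * \int[mu]_(x in `[0, t]) f n x)).
  by apply: (@cvgM R _ eventually) => //; exact: cvg_cst.
apply/funext => n /=; rewrite (fE n).2 mulr_sumr.
apply: eq_bigr => k _.
have q0' : q != 0 by rewrite gt_eqF.
by move: (p _) (_ - _) => a b; field.
Qed.

End time_integral.

(** * Expansion of an increment in expectation *)

(** The inequality of arithmetic and geometric means, with k = M^2 / e. A quadratic modulus has an
    explicit expectation along [W y], namely e + k |y|^2. *)
Lemma lipschitz_quadratic_modulus (R : realType) (f : R -> R) (M : R) : 0 <= M ->
  (forall x y, `|f y - f x| <= M * `|y - x|) ->
  forall e, 0 < e -> exists2 k, 0 <= k &
    forall x y, `|f y - f x| <= e + k * (y - x) ^+ 2.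
Proof.
move=> M0 lf e e0; exists (M ^+ 2 / e); first by rewrite divr_ge0 ?sqr_ge0// ltW.
move=> x y; apply: (le_trans (lf x y)).
rewrite -(real_normK (num_real (y - x))); set a := `|y - x|.
rewrite -(ler_pM2r e0) mulrDl mulrAC (mulrAC (M ^+ 2)) divfK ?gt_eqF//.
rewrite -subr_ge0 (_ : _ - _ = (e - M * a / 2) ^+ 2 + 3 / 4 * (M * a) ^+ 2); last by field.
by rewrite addr_ge0 ?sqr_ge0// mulr_ge0 ?sqr_ge0.
Qed.

Section smooth_increment.
Context d (Omega : measurableType d) (R : realType) (P : probability Omega R).
Context (H K T : R) (B : R -> {RV P >-> R}).
Context (V : bif_hilbert H K T) (W : V -> {RV P >-> R}).
Hypothesis hB : is_bifBm H K T B.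
Hypothesis hW : is_isonormal B W.
Local Notation E X := (\int[P]_w X w).
Local Notation "<| x , y |>" := (dot V x y) (format "<| x ,  y |>").
Variables (g g' g'' : R -> R) (M : R).
Hypothesis dg : forall x : R, is_derive x 1 g (g' x).
Hypothesis dg' : forall x : R, is_derive x 1 g' (g'' x).
Hypothesis cg'' : continuous g''.
Hypotheses (gM : forall x, `|g x| <= M) (gM' : forall x, `|g' x| <= M).
Hypothesis gM'' : forall x, `|g'' x| <= M.
Variables (n : nat) (G : 'rV[R]_n -> R) (phi : 'I_n -> V) (MG : R).
Hypothesis hG : Cb_infty G.
Hypothesis GM : forall x, `|G x| <= MG.
Hypothesis pGM : forall i x, `|partial G i x| <= MG.

Let M0 : 0 <= M. Proof. exact: le_trans (gM 0). Qed.
Let MG0 : 0 <= MG. Proof. exact: le_trans (GM 0). Qed.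
Let cg : continuous g. Proof. by move=> x; exact: deriv_continuous (dg x). Qed.
Let cg' : continuous g'. Proof. by move=> x; exact: deriv_continuous (dg' x). Qed.
Let mg := continuous_measurable_fun cg.
Let mg' := continuous_measurable_fun cg'.
Let mg'' := continuous_measurable_fun cg''.

Let mS (F : 'rV[R]_n -> R) : continuous F ->
  measurable_fun setT (fun w => F (\row_j W (phi j) w)).
Proof. by move=> cF; apply: measurable_row_continuous => // i; exact: W_meas. Qed.

Let mG : measurable_fun setT (smooth W G phi).
Proof. exact/mS/Cb_infty_continuous. Qed.

Let mpG i : measurable_fun setT (fun w => partial G i (\row_j W (phi j) w)).
Proof. exact/mS/Cb_infty_continuous/Cb_infty_partial. Qed.

Let modulus_E (e k s : R) (F : Omega -> R) (f : R -> R) (h y : V) :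
  measurable_fun setT F -> (forall w, `|F w| <= MG) ->
  measurable_fun setT f -> (forall x, `|f x| <= M) ->
  (forall x x', `|f x' - f x| <= e + k * (x' - x) ^+ 2) -> 0 <= k -> `|s| <= 1 ->
  `|E (fun w => F w * f (W h w + W y w * s)) - E (fun w => F w * f (W h w))|
    <= MG * (e + k * `|y| ^+ 2).
Proof.
move=> mF FM mf fM fk k0 s1.
have mfs : measurable_fun setT (fun w => f (W h w + W y w * s)).
  apply: measurableT_comp => //; apply: measurable_funD; first exact: W_meas.
  by apply: measurable_funM => //; exact: W_meas.
have mfh : measurable_fun setT (fun w => f (W h w)).
  by apply: measurableT_comp => //; exact: W_meas.
have iF := integ_bounded P mF FM.
rewrite -E_B; [|exact: (integMb iF mfs (fun w => fM _))|exact: (integMb iF mfh (fun w => fM _))].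
have iW := W_sqr_integ hW y.
apply: (@le_trans _ _ (E (fun w => MG * (e + k * W y w ^+ 2)))).
  apply: E_abs_le.
  - by apply: measurable_funB; exact: measurable_funM.
  - by apply: integZ; apply: integD; [exact: integ_cst|exact: integZ].
  - move=> w; rewrite -mulrBr normrM ler_pM//.
    apply: (le_trans (fk _ _)); rewrite lerD2l ler_wpM2l//.
    rewrite [X in X ^+ 2]addrC addrA addNr add0r exprMn ler_piMr ?sqr_ge0//.
    by rewrite -(real_normK (num_real s)) expr_le1.
rewrite E_Z; last by apply: integD; [exact: integ_cst|exact: integZ].
rewrite E_D; [|exact: integ_cst|exact: integZ].
rewrite E_cst E_Z// ler_wpM2l//.
have := W_isometry hW y y; rewrite dot_norm => <-.
by under eq_Rintegral do rewrite expr2.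
Qed.

(* [mean_value] is applied to E[F g(W h + s W y)] minus its expected second
   order expansion in s: integration by parts expresses its derivative by
   differences of expectations at s and at 0. *)
Lemma smooth_increment (e k k' : R) (h y : V) : is_step h -> is_step y ->
  0 <= k -> 0 <= k' -> 
  (forall x x', `|g' x' - g' x| <= e + k * (x' - x) ^+ 2) ->
  (forall x x', `|g'' x' - g'' x| <= e + k' * (x' - x) ^+ 2) ->
  exists a : 'I_n -> R, exists b : R,
  [/\ forall i, `|a i| <= MG * (e + k * `|y| ^+ 2),
      `|b| <= MG * (e + k' * `|y| ^+ 2) * (`|<|h, y|>| + `|y| ^+ 2) &
  E (fun w => smooth W G phi w * (g (W h w + W y w) - g (W h w))) =
  \sum_(i < n) <|phi i, y|> *
    (E (fun w => partial G i (\row_j W (phi j) w) * g' (W h w)) + a i) +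
  (<|h, y|> + <|y, y|> / 2) * E (fun w => smooth W G phi w * g'' (W h w)) + b].
Proof.
move=> sh sy k0 k0' gk' gk''.
pose X s w := W h w + W y w * s.
have mX s : measurable_fun setT (X s).
  apply: measurable_funD; first exact: W_meas.
  by apply: measurable_funM => //; exact: W_meas.
pose a s i := E (fun w => partial G i (\row_j W (phi j) w) * g' (X s w)).
pose b s := E (fun w => smooth W G phi w * g'' (X s w)).
pose m s := E (fun w => smooth W G phi w * g (X s w)).
have iG := integ_bounded P mG (fun w => GM _).
have mgX s : measurable_fun setT (fun w => g (X s w)) by exact: measurableT_comp.
have mgX' s : measurable_fun setT (fun w => g' (X s w)) by exact: measurableT_comp.
have im s : integ P (fun w => smooth W G phi w * g (X s w)).
  exact: (integMb iG (mgX s) (fun w => gM _)).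
have iW := W_integ hW y; have iW2 := W_sqr_integ hW y.
have im' s : integ P (fun w => smooth W G phi w * g' (X s w) * W y w).
  have -> : (fun w => smooth W G phi w * g' (X s w) * W y w) =
      (fun w => W y w * (smooth W G phi w * g' (X s w))).
    by apply/funext => w; rewrite mulrC.
  apply: (@integMb _ _ _ _ (MG * M)) => //; first exact: measurable_funM.
  by move=> w; rewrite normrM ler_pM//; exact: GM.
pose m' s := E (fun w => smooth W G phi w * g' (X s w) * W y w).
have dm (s : R) : is_derive s 1 m (m' s).
  apply: (@is_derive_quadratic_bound _ _ _ _ (MG * M * E (fun w => W y w ^+ 2))) => s'.
  have -> : m s' - m s - m' s * (s' - s) =
     E (fun w => smooth W G phi w * (g (X s' w) - g (X s w) - g' (X s w) * (X s' w - X s w))).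
    rewrite /m /m' -E_Zr// -!E_B//; [|exact: integB|].
      by apply: eq_Rintegral => w _; rewrite /X; ring.
    have -> : (fun w => smooth W G phi w * g' (X s w) * W y w * (s' - s)) =
      (fun w => (s' - s) * (smooth W G phi w * g' (X s w) * W y w)).
      by apply/funext => w; rewrite mulrC.
    exact: integZ.
  rewrite mulrAC -E_Z//; apply: E_abs_le => [||w]; [|exact: integZ|].
    apply: measurable_funM => //; apply: measurable_funB; first exact: measurable_funB.
    by apply: measurable_funM => //; exact: measurable_funB.
  rewrite /= -!mulrA normrM ler_pM//; first exact: GM.
  apply: (le_trans (deriv_taylor2 dg dg' gM'' _ _)); rewrite ler_wpM2l//.
  by rewrite [leLHS](_ : _ = (s' - s) * ((s' - s) * W y w ^+ 2))// /X; ring.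
have EX s (F : Omega -> R) (f : R -> R) : measurable_fun setT F -> measurable_fun setT f ->
    E (fun w => F w * f (W (h + s *: y) w)) = E (fun w => F w * f (X s w)).
  move=> mF mf; apply: E_ae.
  - by apply: measurable_funM => //; apply: measurableT_comp => //; exact: W_meas.
  - by apply: measurable_funM => //; exact: measurableT_comp.
  - by apply: filterS (W_addZ hW h s y) => w ->; rewrite /X (mulrC s).
(* Integration by parts at [h + s *: y] exchanges the factor [W y] for inner products. The linear
   term [s * <|y, y|>] is the origin of [<|y, y|> / 2] after integration in [s]. *)
have m'E s : m' s = \sum_(i < n) <|phi i, y|> * a s i + (<|h, y|> + s * <|y, y|>) * b s.
  have := W_ibp hB hW phi (h + s *: y) hG sy dg' cg'' gM' gM''.
  rewrite dotDl dotZl EX//.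
  under eq_bigr => i _ do rewrite EX//.
  move=> <-; rewrite /m'; under eq_Rintegral do rewrite mulrAC.
  rewrite -EX//; last exact: measurable_funM.
  by under eq_Rintegral do rewrite mulrAC.
pose m0 s := m s - s * (\sum_(i < n) <|phi i, y|> * a 0 i) -
  b 0 * (s * <|h, y|> + s * s * (<|y, y|> / 2)).
have dm0 (s : R) : is_derive s 1 m0 (\sum_(i < n) <|phi i, y|> * (a s i - a 0 i) +
    (<|h, y|> + s * <|y, y|>) * (b s - b 0)).
  have d1 := derivM (deriv_id s) (deriv_cst (\sum_(i < n) <|phi i, y|> * a 0 i) s).
  have d2 := derivM (deriv_id s) (deriv_cst <|h, y|> s).
  have d3 := derivM (derivM (deriv_id s) (deriv_id s)) (deriv_cst (<|y, y|> / 2) s).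
  have := derivB (derivB (dm s) d1) (derivZ (b 0) (derivD d2 d3)).
  move=> /is_derive_eq; apply; rewrite m'E.
  under [in RHS]eq_bigr do rewrite mulrBr.
  rewrite sumrB; move: (\sum_(i < n) _) (\sum_(i < n) _) => u v; by field.
have X0 w : X 0 w = W h w by rewrite /X mulr0 addr0.
have X1 w : X 1 w = W h w + W y w by rewrite /X mulr1.
have a0E i : a 0 i = E (fun w => partial G i (\row_j W (phi j) w) * g' (W h w)).
  by apply: eq_Rintegral => w _; rewrite X0.
have b0E : b 0 = E (fun w => smooth W G phi w * g'' (W h w)).
  by apply: eq_Rintegral => w _; rewrite X0.
have [c] := mean_value 0 1 dm0; rewrite !subr0 normr1 mulr1 => mc c1.
have bc : `|b c - b 0| <= MG * (e + k' * `|y| ^+ 2).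
  by rewrite b0E; apply: modulus_E => // w; exact: GM.
exists (fun i => a c i - a 0 i), ((<|h, y|> + c * <|y, y|>) * (b c - b 0)); split.
- by move=> i; rewrite a0E; apply: modulus_E => // w; exact: pGM.
- rewrite normrM mulrC ler_pM//; apply: (le_trans (ler_normD _ _)).
  by rewrite lerD2l normrM dot_norm (ger0_norm (sqr_ge0 _)) ler_piMl ?sqr_ge0.
- have -> : E (fun w => smooth W G phi w * (g (W h w + W y w) - g (W h w))) = m 1 - m 0.
    by rewrite /m -E_B//; apply: eq_Rintegral => w _; rewrite X0 X1 mulrBr.
  rewrite -b0E; under eq_bigr do rewrite -a0E addrC subrK.
  set U := \sum_(i < n) _ * a c i; pose u := \sum_(i < n) <|phi i, y|> * a 0 i.
  have Uu : \sum_(i < n) <|phi i, y|> * (a c i - a 0 i) = U - u.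
    by rewrite -sumrB; apply: eq_bigr => i _; rewrite mulrBr.
  move: mc; rewrite Uu /m0 -/u => mc.
  have -> : m 1 - m 0 = U - u + (<|h, y|> + c * <|y, y|>) * (b c - b 0) + u +
      b 0 * (<|h, y|> + <|y, y|> / 2) by rewrite -mc; field.
  by ring.
Qed.
End smooth_increment.

Section grid_norms.
Context (R : realType) (H K T : R) (V : bif_hilbert H K T).
Hypotheses (hH : 0 < H < 1) (hK : 0 < K <= 1) (hHK : 1 <= 2 * H * K) (hT : 0 < T).
Local Notation mu := (@lebesgue_measure R).
Local Notation "<| x , y |>" := (dot V x y) (format "<| x ,  y |>").
Local Notation C := (cov_const H K T).
Let C0 : 0 <= C. Proof. exact: cov_const_ge0. Qed.

(** The covariance vanishes at time 0, so this inner product is the increment over a rectangle with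
    one side [0, b], dominated by a row sum of [cov_dom]. *)
Lemma dot_ind_increment s s' b : 0 <= s -> s <= s' -> s' <= T -> b \in `[0, T] ->
  `|<|ind V b, ind V s' - ind V s|>| <= C * (s' - s).
Proof.
move=> s0 ss s'T; rewrite in_itv /= => /andP[b0 bT].
have i1 : s \in `[0, T] by rewrite in_itv /= s0 (le_trans ss).
have i2 : s' \in `[0, T] by rewrite in_itv /= s'T (le_trans s0).
rewrite dotBr !dot_ind ?in_itv /= ?b0 ?bT//.
have s'0 := le_trans s0 ss.
have h := cov_incr_dom hH hK hHK s0 ss (lexx 0) b0.
have bT' : 0 <= b <= T by rewrite b0.
apply: (@le_trans _ _ `|rect_incr (bif_cov H K) s s' 0 b|); last first.
  exact: le_trans h (cov_dom_total hH hK hHK hT s0 ss s'T bT').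
rewrite /rect_incr (bif_covC _ _ s' 0) (bif_covC _ _ s 0) !bif_cov0l//.
by rewrite subr0 addr0 (bif_covC _ _ b) (bif_covC _ _ b).
Qed.

Lemma norm_ind_increment s s' : 0 <= s -> s <= s' -> s' <= T ->
  `|ind V s' - ind V s| ^+ 2 <= 2 * C * (s' - s).
Proof.
move=> s0 ss s'T; rewrite -dot_norm dotBl.
have i1 : s \in `[0, T] by rewrite in_itv /= s0 (le_trans ss).
have i2 : s' \in `[0, T] by rewrite in_itv /= s'T (le_trans s0).
have h1 := dot_ind_increment s0 ss s'T i1.
have h2 := dot_ind_increment s0 ss s'T i2.
apply: (le_trans (ler_norm _)); apply: (le_trans (ler_normB _ _)).
by apply: (le_trans (lerD h2 h1)); rewrite -mulrDl mulr_natl mulr2n.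
Qed.

(** Polarization: the left side is half the difference of the squared norms of [ind V s'] and
    [ind V s], and the variance at time s is s^(2HK). *)
Lemma dot_ind_increment_half s s' : 0 <= s -> s <= s' -> s' <= T ->
  <|ind V s, ind V s' - ind V s|> + <|ind V s' - ind V s, ind V s' - ind V s|> / 2
  = (s' `^ (2 * H * K) - s `^ (2 * H * K)) / 2.
Proof.
move=> s0 ss s'T; have s'0 := le_trans s0 ss.
have i1 : s \in `[0, T] by rewrite in_itv /= s0 (le_trans ss).
have i2 : s' \in `[0, T] by rewrite in_itv /= s'T (le_trans s0).
rewrite !dotBl !dotBr (dotC _ (ind V s')) !dot_ind// !bif_cov_diag//.
by move: (bif_cov _ _ _ _) (_ `^ _) (_ `^ _) => a b c; field.
Qed.

Variable t : R.
Hypothesis tT : t \in `[0, T].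
Local Notation Delta n k := (ind V (grid t n k.+1) - ind V (grid t n k)).

Lemma grid_sum_norm (p : R -> R) (M : R) n : (forall x, `|p x| <= M) ->
  `|\sum_(k < n.+1) p (grid t n k) *: Delta n k| ^+ 2 <= C * (M ^+ 2 * T).
Proof.
move=> pM; rewrite -grid_steps_elt -lee_fin.
have M0 := le_trans (normr_ge0 _) (pM 0).
have tc : times_in T (grid_steps t p n) by exact: grid_steps_times.
have h := step_norm_le V hH hK hHK hT tc.
apply: (le_trans h).
rewrite [leRHS]EFinM; apply: lee_wpmul2l; first by rewrite lee_fin.
have mI : measurable (`[0, T] : set (measurableTypeR R)) by exact: measurable_itv.
have -> : ((M ^+ 2 * T)%:E = \int[mu]_(x in `[0%R, T]) (M ^+ 2)%:E)%E.
  by rewrite integral_cst//= lebesgue_measure_itv /= lte_fin hT oppr0 -EFinD addr0.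
apply: ge0_le_integral => //.
- by move=> x _; rewrite lee_fin; exact: sqr_ge0.
- by apply/measurable_EFinP; apply: measurable_funX; exact: measurable_step_fun.
- move=> x _; rewrite lee_fin -(real_normK (num_real (step_fun _ _))).
  by rewrite lerXn2r ?nnegrE//; exact: (grid_steps_bound tT pM).
Qed.

Lemma grid_weights_norm (e : nat -> R) (eta : R) n : (forall k, `|e k| <= eta) ->
  `|\sum_(k < n.+1) e k *: Delta n k| ^+ 2 <= C * (eta ^+ 2 * T).
Proof.
move=> eM; have [t0|t0] := eqVneq t 0.
  rewrite big1 => [|k _]; last by rewrite /grid t0 !mul0r subrr scaler0.
  by rewrite normr0 expr0n /= mulr_ge0// mulr_ge0 ?sqr_ge0// ltW.
(* Arbitrary weights are realized as the values at the grid points of a function of time: at the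
   [k]-th point the truncation returns [k]. The case [t = 0], where all grid points coincide, has
   been set apart. *)
have := @grid_sum_norm (fun x => e (Num.truncn (x * n.+1%:R / t))) eta n.
rewrite (_ : \sum_(k < n.+1) _ = \sum_(k < n.+1) e k *: Delta n k); first by apply.
apply: eq_bigr => k _; congr (_ *: _); congr e.
rewrite /grid mulfVK// mulrC mulrA mulVf// mul1r.
by rewrite natrK.
Qed.

End grid_norms.

Lemma cvg_norm_seq (R : realType) (u : nat -> R) (l : R) :
  u n @[n --> \oo] --> l -> `|u n| @[n --> \oo] --> `|l|.
Proof. exact: cvg_norm. Qed.

Lemma dot_cvg (R : realType) (H K T : R) (V : bif_hilbert H K T) (y : V)
    (u : nat -> V) (l : V) :
  u n @[n --> \oo] --> l -> dot V y (u n) @[n --> \oo] --> dot V y l.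
Proof.
move=> ul; apply/cvgrPdist_le => /= e e0.
have y1 : 0 < `|y| + 1 by rewrite ltr_wpDl.
have := ul; move=> /cvgrPdist_le/(_ _ (divr_gt0 e0 y1)); apply: filterS => n h.
rewrite -dotBr (le_trans (dot_cauchy_schwarz _ _))//.
rewrite -(divfK (lt0r_neq0 y1) e) mulrC ler_pM// lerDl//.
Qed.

(** * Duality *)

Section main_identity.
Context d (Omega : measurableType d) (R : realType) (P : probability Omega R).
Context (H K T : R) (B : R -> {RV P >-> R}).
Context (V : bif_hilbert H K T) (W : V -> {RV P >-> R}).
Hypotheses (hH : 0 < H < 1) (hK : 0 < K <= 1) (hHK : 1 <= 2 * H * K) (hT : 0 < T).
Hypothesis hB : is_bifBm H K T B.
Hypothesis hW : is_isonormal B W.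
Local Notation E X := (\int[P]_w X w).
Local Notation "<| x , y |>" := (dot V x y) (format "<| x ,  y |>").
Local Notation C := (cov_const H K T).
Local Notation q := (2 * H * K).
Variables (g g' g'' : R -> R) (M : R).
Hypothesis dg : forall x : R, is_derive x 1 g (g' x).
Hypothesis dg' : forall x : R, is_derive x 1 g' (g'' x).
Hypothesis cg'' : continuous g''.
Hypotheses (gM : forall x, `|g x| <= M) (gM' : forall x, `|g' x| <= M).
Hypothesis gM'' : forall x, `|g'' x| <= M.
Hypothesis ug'' : forall e, 0 < e -> exists2 k, 0 <= k &
  forall x y, `|g'' y - g'' x| <= e + k * (y - x) ^+ 2.
Variable t : R.
Hypothesis tT : t \in `[0, T].
Local Notation Delta m k := (ind V (grid t m k.+1) - ind V (grid t m k)).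

Let M0 : 0 <= M. Proof. exact: le_trans (gM 0). Qed.
Let C0 : 0 <= C. Proof. exact: cov_const_ge0. Qed.
Let cg : continuous g. Proof. by move=> x; exact: deriv_continuous (dg x). Qed.
Let cg' : continuous g'. Proof. by move=> x; exact: deriv_continuous (dg' x). Qed.
Let mgB s : measurable_fun setT (fun w => g (B s w)).
Proof. by apply: measurableT_comp => //; exact: continuous_measurable_fun. Qed.
Let mgB' s : measurable_fun setT (fun w => g' (B s w)).
Proof. by apply: measurableT_comp => //; exact: continuous_measurable_fun. Qed.
Let mgB'' s : measurable_fun setT (fun w => g'' (B s w)).
Proof. by apply: measurableT_comp => //; exact: continuous_measurable_fun. Qed.

(** * Passage to the limit along the grid *)

Lemma path_modulus (f : R -> R) w (x e : R) : continuous f -> x \in `[0, T] -> 0 < e ->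
  exists2 d, 0 < d & forall y, y \in `[0, T] -> `|y - x| < d ->
    `|f (B y w) - f (B x w)| <= e.
Proof.
move=> cf xT e0.
have /subspace_continuousP/(_ x xT) cB := @bifBm_continuous _ _ _ _ _ _ _ _ hB w.
have := cvg_comp _ _ cB (cf (B x w)).
move=> /cvgrPdist_le/(_ e e0)/nbhs_ballP[r /= r0 hr].
exists r => // y yT yx; rewrite distrC; apply: hr => //.
by rewrite /ball /= distrC.
Qed.

Lemma integrand_cvg w :
  \sum_(j < m.+1) g' (B (grid t m j) w) *: Delta m j @[m --> \oo]
  --> integrand B V g' t w.
Proof.
rewrite /integrand.
have pM x : `|g' (B x w)| <= M by exact: gM'.
exact: (grid_toH hH hK hHK hT tT pM (fun x e => path_modulus w cg')).
Qed.

Lemma integrand_norm w : `|integrand B V g' t w| ^+ 2 <= C * (M ^+ 2 * T).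
Proof.
have h := @integrand_cvg w.
have h2 : `|\sum_(j < m.+1) g' (B (grid t m j) w) *: Delta m j| ^+ 2 @[m --> \oo]
    --> `|integrand B V g' t w| ^+ 2.
  rewrite expr2; under eq_fun do rewrite expr2.
  by apply: (@cvgM R _ eventually); apply: cvg_norm.
rewrite -(cvg_lim (@Rhausdorff R) h2); apply: limr_le.
  by apply/cvg_ex; eexists; exact: h2.
apply: nearW => m.
exact: (grid_sum_norm V hH hK hHK hT tT m (p := fun s => g' (B s w))).
Qed.

Definition ito_correction w :=
  H * K * \int[lebesgue_measure]_(s in `[0, t]) (g'' (B s w) * s `^ (q - 1)).

Lemma ito_correction_cvg w :
  \sum_(j < m.+1) g'' (B (grid t m j) w) * ((grid t m j.+1 `^ q - grid t m j `^ q) / 2)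
    @[m --> \oo] --> ito_correction w.
Proof.
have -> : ito_correction w = q / 2 * \int[lebesgue_measure]_(s in `[0, t]) (g'' (B s w) * s `^ (q - 1)).
  by rewrite /ito_correction; move: (\int[_]_(_ in _) _) => I; field.
have pM x : `|g'' (B x w)| <= M by exact: gM''.
exact: (time_integral_cvg hHK tT pM (fun x e => path_modulus w cg'')).
Qed.

Lemma ito_sum_bound m w :
  `|\sum_(j < m.+1) g'' (B (grid t m j) w) * ((grid t m j.+1 `^ q - grid t m j `^ q) / 2)|
  <= M * (t `^ q / 2).
Proof.
apply: (le_trans (ler_norm_sum _ _ _)).
apply: (@le_trans _ _ (\sum_(j < m.+1) M * ((grid t m j.+1 `^ q - grid t m j `^ q) / 2))).
  apply: ler_sum => j _; rewrite normrM.
  have h : 0 <= (grid t m j.+1 `^ q - grid t m j `^ q) / 2.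
    have /andP[h1 _] := grid_itv tT (ltnW (ltn_ord j) : (j <= m.+1)%N).
    have h2 := grid_mono tT m (leqnSn j).
    rewrite divr_ge0// subr_ge0 ge0_ler_powR ?nnegrE ?(le_trans ler01 hHK)//.
    exact: le_trans h2.
  by rewrite (ger0_norm h) ler_wpM2r.
rewrite -mulr_sumr -mulr_suml ler_wpM2l// ler_wpM2r ?invr_ge0//.
rewrite -(big_mkord xpredT (fun j => grid t m j.+1 `^ q - grid t m j `^ q)).
rewrite telescope_sumr// gridN grid0 lerBlDr lerDl; exact: powR_ge0.
Qed.

Lemma ito_correction_bound w : `|ito_correction w| <= M * (t `^ q / 2).
Proof.
have h := @ito_correction_cvg w.
have h2 := cvg_norm_seq h.
rewrite -(cvg_lim (@Rhausdorff R) h2); apply: limr_le.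
  by apply/cvg_ex; eexists; exact: h2.
by apply: nearW => m; exact: ito_sum_bound.
Qed.

Lemma measurable_ito_correction : measurable_fun setT ito_correction.
Proof.
apply: (measurable_fun_cvg (h := fun m w => \sum_(j < m.+1) g'' (B (grid t m j) w) *
   ((grid t m j.+1 `^ q - grid t m j `^ q) / 2))) => [m|w _].
  by apply: measurable_sum => j; exact: measurable_funM.
exact: ito_correction_cvg.
Qed.

Definition ito_remainder w := g (B t w) - g 0 - ito_correction w.

Lemma ito_remainder_bound w : `|ito_remainder w| <= 2 * M + M * (t `^ q / 2).
Proof.
rewrite /ito_remainder (le_trans (ler_normB _ _))// lerD ?ito_correction_bound//.
by rewrite (le_trans (ler_normB _ _))// mulr_natl mulr2n lerD.
Qed.

Lemma measurable_ito_remainder : measurable_fun setT ito_remainder.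
Proof.
apply: measurable_funB; last exact: measurable_ito_correction.
exact: measurable_funB.
Qed.

Section smooth_functional.
Variables (n : nat) (G : 'rV[R]_n -> R) (phi : 'I_n -> V).
Hypothesis hG : Cb_infty G.
Local Notation F := (smooth W G phi).
Local Notation dF i := (fun w => partial G i (\row_j W (phi j) w)).

Let mS (f : 'rV[R]_n -> R) : continuous f ->
  measurable_fun setT (fun w => f (\row_j W (phi j) w)).
Proof. by move=> cf; apply: measurable_row_continuous => // i; exact: W_meas. Qed.

Let mG : measurable_fun setT F.
Proof. exact/mS/Cb_infty_continuous. Qed.

Let mpG i : measurable_fun setT (dF i).
Proof. exact/mS/Cb_infty_continuous/Cb_infty_partial. Qed.

Section discretization.
Variable MG : R.
Hypothesis GM : forall x, `|G x| <= MG.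
Hypothesis pGM : forall i x, `|partial G i x| <= MG.
Let MG0 : 0 <= MG. Proof. exact: le_trans (GM 0). Qed.

Let iF : integ P F. Proof. by apply: (integ_bounded P mG) => w; exact: GM. Qed.
Let idF i : integ P (dF i). Proof. by apply: (integ_bounded P (mpG i)) => w; exact: pGM. Qed.

(** The factor [3 * C] adds the bound C (s' - s) for the inner product of [ind V s] with the
    increment and the bound 2 C (s' - s) for the squared norm of the increment. The errors form one
    pair so that they can be chosen together over the grid. *)
Lemma B_increment (e k s s' : R) : 0 <= s -> s <= s' -> s' <= T -> 0 <= e -> 0 <= k ->
  (forall x x', `|g' x' - g' x| <= e + k * (x' - x) ^+ 2) ->
  (forall x x', `|g'' x' - g'' x| <= e + k * (x' - x) ^+ 2) ->
  exists ab : ('I_n -> R) * R,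
  [/\ forall i, `|ab.1 i| <= MG * (e + k * (2 * C * (s' - s))),
      `|ab.2| <= MG * (e + k * (2 * C * (s' - s))) * (3 * C * (s' - s)) &
  E (fun w => F w * (g (B s' w) - g (B s w))) =
  \sum_(i < n) <|phi i, ind V s' - ind V s|> * (E (fun w => dF i w * g' (B s w)) + ab.1 i) +
  (s' `^ q - s `^ q) / 2 * E (fun w => F w * g'' (B s w)) + ab.2].
Proof.
move=> s0 ss s'T e0 k0 hk' hk''.
have i1 : s \in `[0, T] by rewrite in_itv /= s0 (le_trans ss).
have i2 : s' \in `[0, T] by rewrite in_itv /= s'T (le_trans s0).
have sd : 0 <= s' - s by rewrite subr_ge0.
have s1 (b : R) : b \in `[0, T] -> is_step (ind V b).
  move=> bT; exists [:: (1, b)]; first by move=> p; rewrite inE => /eqP ->.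
  by rewrite /step_elt big_seq1 scale1r.
have s2 : is_step (ind V s' - ind V s).
  exists [:: (1, s'); (-1, s)]; first by move=> p; rewrite !inE => /orP[]/eqP ->.
  by rewrite /step_elt big_cons big_seq1 /= scale1r scaleN1r.
have [a [b [ha hb]]] := smooth_increment hB hW dg dg' cg'' gM gM' gM'' phi hG GM pGM
  (s1 _ i1) s2 k0 k0 hk' hk''.
have EB (X : Omega -> R) (f : R -> R) : measurable_fun setT X -> continuous f ->
    E (fun w => X w * f (W (ind V s) w)) = E (fun w => X w * f (B s w)).
  move=> mX cf; have mf := continuous_measurable_fun cf.
  apply: E_ae.
  - by apply: measurable_funM => //; apply: measurableT_comp => //; exact: W_meas.
  - by apply: measurable_funM => //; exact: measurableT_comp.
  - by apply: filterS (W_ind hW i1) => w ->.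
rewrite (EB F)// dot_ind_increment_half//.
under eq_bigr => i _ do rewrite EB//.
rewrite (_ : E (fun w => F w * (g (W (ind V s) w + W (ind V s' - ind V s) w) - g (W (ind V s) w))) = E (fun w => F w * (g (B s' w) - g (B s w)))); last first.
  have mg := continuous_measurable_fun cg.
  apply: E_ae.
  - apply: measurable_funM => //; apply: measurable_funB; apply: measurableT_comp => //.
    by apply: measurable_funD; exact: W_meas.
  - by apply: measurable_funM => //; exact: measurable_funB.
  - have h := W_sub hW (ind V s') (ind V s).
    apply: filterS3 h (W_ind hW i1) (W_ind hW i2) => w -> -> ->.
    by rewrite addrCA subrr addr0.
move=> h; exists (a, b); split => //=.
- move=> i; apply: (le_trans (ha i)); rewrite ler_wpM2l// lerD2l ler_wpM2l//.
  exact: norm_ind_increment.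
- apply: (le_trans hb); have h1 := norm_ind_increment V hH hK hHK hT s0 ss s'T.
  have h2 := dot_ind_increment V hH hK hHK hT s0 ss s'T i1.
  apply: ler_pM => //.
  + by apply: mulr_ge0 => //; apply: addr_ge0 => //; apply: mulr_ge0 => //; exact: sqr_ge0.
  + by rewrite ler_wpM2l// lerD2l ler_wpM2l.
  + apply: (le_trans (lerD h2 h1)); rewrite -mulrDl ler_wpM2r//.
    by move: (C) => c; lra.
Qed.

(* The errors weighted by <phi i, Delta m j> have to be summed over j inside the
   scalar product, where [grid_weights_norm] applies. *)
Lemma discretized_identity (e k : R) m : 0 <= e -> 0 <= k ->
  (forall x x', `|g' x' - g' x| <= e + k * (x' - x) ^+ 2) ->
  (forall x x', `|g'' x' - g'' x| <= e + k * (x' - x) ^+ 2) ->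
  `|E (fun w => F w * (g (B t w) - g 0)) -
    E (fun w => <|malliavinD W G phi w,
                  \sum_(j < m.+1) g' (B (grid t m j) w) *: Delta m j|>) -
    E (fun w => F w * \sum_(j < m.+1) g'' (B (grid t m j) w) *
                  ((grid t m j.+1 `^ q - grid t m j `^ q) / 2))|
  <= MG * (e + k * (2 * C * (t / m.+1%:R))) *
     (\sum_(i < n) `|phi i| * Num.sqrt (C * T) + 3 * C * t).
Proof.
move=> e0 k0 hk' hk''.
have /andP[t0 tT'] : 0 <= t <= T by move: tT; rewrite in_itv.
set eta := MG * _.
have eta0 : 0 <= eta.
  have th : 0 <= t / m.+1%:R by exact: divr_ge0.
  by rewrite mulr_ge0// addr_ge0// mulr_ge0// mulr_ge0// mulr_ge0.
have /choice[ab hab] : forall j : 'I_m.+1, exists ab : ('I_n -> R) * R,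
    [/\ forall i, `|ab.1 i| <= eta, `|ab.2| <= eta * (3 * C * (t / m.+1%:R)) &
    E (fun w => F w * (g (B (grid t m j.+1) w) - g (B (grid t m j) w))) =
    \sum_(i < n) <|phi i, Delta m j|> *
      (E (fun w => dF i w * g' (B (grid t m j) w)) + ab.1 i) +
    (grid t m j.+1 `^ q - grid t m j `^ q) / 2 *
      E (fun w => F w * g'' (B (grid t m j) w)) + ab.2].
  move=> j; have /andP[h1 _] := grid_itv tT (ltnW (ltn_ord j) : (j <= m.+1)%N).
  have /andP[_ h2] := grid_itv tT (ltn_ord j : (j.+1 <= m.+1)%N).
  have := B_increment h1 (grid_mono tT m (leqnSn j)) (le_trans h2 tT') e0 k0 hk' hk''.
  by rewrite gridS.
have igB (X : Omega -> R) (f : R -> R) s (N : R) : integ P X -> continuous f ->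
    (forall x, `|f x| <= N) -> integ P (fun w => X w * f (B s w)).
  move=> iX cf fN; apply: (@integMb _ _ _ _ N) => //.
  by apply: measurableT_comp => //; exact: continuous_measurable_fun.
have -> : E (fun w => F w * (g (B t w) - g 0)) =
    \sum_(j < m.+1) E (fun w => F w * (g (B (grid t m j.+1) w) - g (B (grid t m j) w))).
  rewrite -E_sum => [|j].
    apply: eq_Rintegral => w _; rewrite -mulr_sumr; congr (_ * _).
    rewrite -(big_mkord xpredT (fun j => g (B (grid t m j.+1) w) - g (B (grid t m j) w))).
    by rewrite telescope_sumr// gridN grid0 (bifBm_start hB).
  have -> : (fun w => F w * (g (B (grid t m j.+1) w) - g (B (grid t m j) w))) =
    (fun w => F w * g (B (grid t m j.+1) w) - F w * g (B (grid t m j) w)).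
    by apply/funext => w; rewrite mulrBr.
  by apply: integB; exact: igB gM.
have -> : E (fun w => <|malliavinD W G phi w,
      \sum_(j < m.+1) g' (B (grid t m j) w) *: Delta m j|>) =
    \sum_(j < m.+1) \sum_(i < n) <|phi i, Delta m j|> *
      E (fun w => dF i w * g' (B (grid t m j) w)).
  have iji i j : integ P (fun w => <|phi i, Delta m j|> * (dF i w * g' (B (grid t m j) w))).
    by apply: integZ; exact: igB gM'.
  transitivity (\sum_(j < m.+1) E (fun w => \sum_(i < n)
      <|phi i, Delta m j|> * (dF i w * g' (B (grid t m j) w)))); last first.
    apply: eq_bigr => j _; rewrite E_sum => [|i]; last exact: iji.
    by apply: eq_bigr => i _; rewrite E_Z//; exact: igB gM'.
  rewrite -E_sum => [|j]; last by apply: integ_sum => i; exact: iji.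
  apply: eq_Rintegral => w _; rewrite dot_sumr; apply: eq_bigr => j _.
  rewrite dotZr dot_suml mulr_sumr; apply: eq_bigr => i _.
  by rewrite dotZl; ring.
have -> : E (fun w => F w * \sum_(j < m.+1) g'' (B (grid t m j) w) *
      ((grid t m j.+1 `^ q - grid t m j `^ q) / 2)) =
    \sum_(j < m.+1) (grid t m j.+1 `^ q - grid t m j `^ q) / 2 *
      E (fun w => F w * g'' (B (grid t m j) w)).
  transitivity (\sum_(j < m.+1) E (fun w =>
      (grid t m j.+1 `^ q - grid t m j `^ q) / 2 * (F w * g'' (B (grid t m j) w)))); last first.
    by apply: eq_bigr => j _; rewrite E_Z//; exact: igB gM''.
  rewrite -E_sum => [|j]; last by apply: integZ; exact: igB gM''.
  apply: eq_Rintegral => w _; rewrite mulr_sumr; apply: eq_bigr => j _.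
  by move: (_ / 2) => c; ring.
(* The main terms cancel; only errors remain, those of first order gathered into one vector for each
   [phi i]. *)
rewrite (_ : _ - _ - _ = \sum_(i < n) <|phi i, \sum_(j < m.+1) (ab j).1 i *: Delta m j|>
    + \sum_(j < m.+1) (ab j).2); last first.
  have -> : \sum_(i < n) <|phi i, \sum_(j < m.+1) (ab j).1 i *: Delta m j|> =
      \sum_(j < m.+1) \sum_(i < n) <|phi i, (ab j).1 i *: Delta m j|>.
    by rewrite exchange_big; apply: eq_bigr => i _; rewrite dot_sumr.
  rewrite -!sumrB -big_split /=; apply: eq_bigr => j _.
  have [_ _ ->] := hab j.
  rewrite [in LHS](eq_bigr (fun i => <|phi i, Delta m j|> * E (fun w => dF i w * g' (B (grid t m j) w)) + <|phi i, (ab j).1 i *: Delta m j|>)); last first.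
    by move=> i _; rewrite mulrDr dotZr; congr (_ + _); rewrite mulrC.
  rewrite big_split /=.
  by move: (\sum_(i < n) _) (\sum_(i < n) _) (_ / 2 * _) => x y z; ring.
apply: (le_trans (ler_normD _ _)); rewrite mulrDr lerD//.
  rewrite mulr_sumr; apply: (le_trans (ler_norm_sum _ _ _)); apply: ler_sum => i _.
  apply: (le_trans (dot_cauchy_schwarz _ _)); rewrite mulrCA ler_wpM2l//.
  (* The weights are extended by 0 past the grid, since [grid_weights_norm] takes a bounded sequence
     indexed by all natural numbers. *)
  pose e' j := if insub j is Some j' then (ab j').1 i else 0.
  have e'M j : `|e' j| <= eta.
    by rewrite /e'; case: insubP => [j' _ _|_]; [have [] := hab j'|rewrite normr0].
  have := grid_weights_norm V hH hK hHK hT tT m e'M.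
  under eq_bigr => j _ do rewrite /e' valK.
  have CT : 0 <= eta ^+ 2 * (C * T) by rewrite mulr_ge0 ?sqr_ge0// mulr_ge0// ltW.
  rewrite mulrCA -(ler_sqrt _ CT).
  by rewrite sqrtr_sqr normr_id sqrtrM ?sqr_ge0// sqrtr_sqr (ger0_norm eta0).
apply: (le_trans (ler_norm_sum _ _ _)).
apply: (@le_trans _ _ (\sum_(j < m.+1) eta * (3 * C * (t / m.+1%:R)))).
  by apply: ler_sum => j _; have [] := hab j.
by rewrite sumr_const card_ord -[leLHS]mulr_natr -!mulrA mulVf ?mulr1// pnatr_eq0.
Qed.

End discretization.
(** Two limits in this order: for fixed [e] the grid is refined, which removes the part of the error
    with the factor [k], however large [k] is; then [e] tends to 0. *)
Lemma duality_identity :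
  integ P (fun w => <|malliavinD W G phi w, integrand B V g' t w|>) /\
  E (fun w => F w * ito_remainder w) =
  E (fun w => <|malliavinD W G phi w, integrand B V g' t w|>).
Proof.
have [t0 tT'] : 0 <= t /\ t <= T by move: tT; rewrite in_itv => /andP.
have [MG [GM pGM]] : exists MG, (forall x, `|G x| <= MG) /\
    (forall i x, `|partial G i x| <= MG).
  have [N hN] := Cb_infty_bounded hG.
  have /choice[N' hN'] : forall i, exists N', forall x, `|partial G i x| <= N'.
    by move=> i; exact: (Cb_infty_bounded (Cb_infty_partial i hG)).
  have N0 : 0 <= N by exact: le_trans (hN 0).
  have N'0 i : 0 <= N' i by exact: le_trans (hN' i 0).
  exists (N + \sum_i N' i); split=> [x|i x].
    by rewrite (le_trans (hN x))// lerDl sumr_ge0.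
  rewrite (le_trans (hN' i x))// (bigD1 i)//= addrCA lerDl addr_ge0// sumr_ge0//.
have MG0 : 0 <= MG by exact: le_trans (GM 0).
have iF : integ P F by apply: (integ_bounded P mG) => w; exact: GM.
pose X m w := <|malliavinD W G phi w, \sum_(j < m.+1) g' (B (grid t m j) w) *: Delta m j|>.
pose Y m w := F w * \sum_(j < m.+1) g'' (B (grid t m j) w) *
   ((grid t m j.+1 `^ q - grid t m j `^ q) / 2).
pose S := \sum_(i < n) `|phi i|.
have DS w : `|malliavinD W G phi w| <= MG * S.
  rewrite /malliavinD (le_trans (ler_norm_sum _ _ _))// mulr_sumr ler_sum// => i _.
  by rewrite normrZ ler_wpM2r.
have S0 : 0 <= S by exact: sumr_ge0.
have [iX cX] : integ P (fun w => <|malliavinD W G phi w, integrand B V g' t w|>) /\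
    E (X m) @[m --> \oo] --> E (fun w => <|malliavinD W G phi w, integrand B V g' t w|>).
  apply: (E_dct (Y := fun=> MG * S * Num.sqrt (C * (M ^+ 2 * T)))).
  - move=> m; rewrite /X.
    have -> : (fun w => <|malliavinD W G phi w, \sum_(j < m.+1) g' (B (grid t m j) w) *: Delta m j|>)
       = (fun w => \sum_(i < n) \sum_(j < m.+1) dF i w * (g' (B (grid t m j) w) * <|phi i, Delta m j|>)).
      apply/funext => w; rewrite dot_suml; apply: eq_bigr => i _.
      by rewrite dotZl dot_sumr mulr_sumr; apply: eq_bigr => j _; rewrite dotZr.
    apply: measurable_sum => i; apply: measurable_sum => j.
    by apply: measurable_funM => //; exact: measurable_funM.
  - by move=> w; apply: dot_cvg; exact: integrand_cvg.
  - exact: integ_cst.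
  - move=> m w; rewrite (le_trans (dot_cauchy_schwarz _ _))// ler_pM//.
    have := grid_sum_norm V hH hK hHK hT tT m (p := fun s => g' (B s w)) (M := M).
    move=> /(_ (fun=> gM' _)).
    have CT : 0 <= C * (M ^+ 2 * T) by rewrite mulr_ge0// mulr_ge0 ?sqr_ge0// ltW.
    by rewrite -(ler_sqrt _ CT) sqrtr_sqr normr_id.
have [iY cY] : integ P (fun w => F w * ito_correction w) /\
    E (Y m) @[m --> \oo] --> E (fun w => F w * ito_correction w).
  apply: (E_dct (Y := fun=> MG * (M * (t `^ q / 2)))).
  - move=> m; apply: measurable_funM => //.
    by apply: measurable_sum => j; exact: measurable_funM.
  - move=> w; apply: (@cvgM R _ eventually); first exact: cvg_cst.
    exact: ito_correction_cvg.
  - exact: integ_cst.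
  - by move=> m w; rewrite normrM ler_pM//; [exact: GM|exact: ito_sum_bound].
split => //.
pose L0 := E (fun w => F w * (g (B t w) - g 0)).
pose L := L0 - E (fun w => <|malliavinD W G phi w, integrand B V g' t w|>)
   - E (fun w => F w * ito_correction w).
have igBF : integ P (fun w => F w * (g (B t w) - g 0)).
  apply: (@integMb _ _ _ _ (2 * M)) => // [|w]; first exact: measurable_funB.
  by rewrite (le_trans (ler_normB _ _))// mulr_natl mulr2n lerD.
suff L00 : L = 0.
  move: L00; rewrite /L => /eqP; rewrite subr_eq0 => /eqP e.
  have -> : E (fun w => F w * ito_remainder w) = L0 - E (fun w => F w * ito_correction w).
    by rewrite /L0 -E_B//; apply: eq_Rintegral => w _; rewrite /ito_remainder mulrBr.
  by rewrite -e opprB addrC subrK.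
pose A := S * Num.sqrt (C * T) + 3 * C * t.
have A0 : 0 <= A by rewrite /A addr_ge0// mulr_ge0// mulr_ge0.
have cL : L0 - E (X m) - E (Y m) @[m --> \oo] --> L.
  by apply: (@cvgB _ R^o) => //; apply: (@cvgB _ R^o) => //; exact: cvg_cst.
have key e : 0 < e -> `|L| <= MG * e * A.
  move=> e0.
  have M'' := deriv_lip dg' gM''.
  have [k1 k10 hk1] := lipschitz_quadratic_modulus M0 M'' e0.
  have [k2 k20 hk2] := ug'' e0.
  have hk1' x x' : `|g' x' - g' x| <= e + (k1 + k2) * (x' - x) ^+ 2.
    by rewrite (le_trans (hk1 x x'))// lerD2l ler_wpM2r ?sqr_ge0// lerDl.
  have hk2' x x' : `|g'' x' - g'' x| <= e + (k1 + k2) * (x' - x) ^+ 2.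
    by rewrite (le_trans (hk2 x x'))// lerD2l ler_wpM2r ?sqr_ge0// lerDr.
  have bd m := discretized_identity GM pGM m (ltW e0) (addr_ge0 k10 k20) hk1' hk2'.
  have c1 : MG * (e + (k1 + k2) * (2 * C * (t / m.+1%:R))) * A @[m --> \oo] --> MG * e * A.
    apply: (@cvgM R _ eventually); last exact: cvg_cst.
    apply: (@cvgM R _ eventually); first exact: cvg_cst.
    rewrite -[X in _ --> X]addr0; apply: (@cvgD _ R^o); first exact: cvg_cst.
    rewrite -[X in _ --> X](mulr0 (k1 + k2)); apply: (@cvgM R _ eventually); first exact: cvg_cst.
    rewrite -[X in _ --> X](mulr0 (2 * C)); apply: (@cvgM R _ eventually); first exact: cvg_cst.
    rewrite -[X in _ --> X](mulr0 t); apply: (@cvgM R _ eventually); first exact: cvg_cst.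
    exact: cvg_harmonic.
  have c2 := cvg_norm_seq cL.
  rewrite -(cvg_lim (@Rhausdorff R) c1) -(cvg_lim (@Rhausdorff R) c2).
  apply: ler_lim.
  - by apply/cvg_ex; eexists; exact: c2.
  - by apply/cvg_ex; eexists; exact: c1.
  - by apply: nearW => m; rewrite /A /S mulr_suml; exact: bd.
(* A positive |L| is contradicted by the bound at e = |L| / (MG A + 1). *)
apply/eqP; rewrite -normr_eq0 eq_le normr_ge0 andbT leNgt; apply/negP => L0'.
have MA : 0 <= MG * A by rewrite mulr_ge0.
have MA1 : 0 < MG * A + 1 by rewrite ltr_wpDl.
have := key _ (divr_gt0 L0' MA1).
by apply/negP; rewrite -ltNge mulrAC mulrA ltr_pdivrMr// (mulrDr _ (MG * A) 1) mulr1 (mulrC (MG * A)) ltrDl L0'.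
Qed.

End smooth_functional.
End main_identity.

(** * Divergence of the integrand *)

Lemma Lnorm2E d (T : measurableType d) (R : realType) (P : probability T R)
    (X : T -> R) : integ P (fun w => X w ^+ 2) ->
  ('N[P]_2%:E[EFin \o X] = (Num.sqrt (\int[P]_w (X w ^+ 2)))%:E)%E.
Proof.
move=> iX; rewrite unlock /Lnorm /=.
suff -> : (\int[P]_w (`|(X w)%:E| `^ 2) = (\int[P]_w (X w ^+ 2)%R)%R%:E)%E.
  by rewrite poweR_EFin powR12_sqrt// E_ge0// => w; exact: sqr_ge0.
rewrite /Rintegral fineK; last exact: integrable_fin_num.
apply: eq_integral => w _; rewrite abse_EFin poweR_EFin /= powR_mulrn//.
by rewrite real_normK// num_real.
Qed.

(** Uniform continuity gives [e] at distances below some [del]. At larger distances the trivial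
    bound 2 M is absorbed by k (y - x)^2 with k = 2 M / del^2. This is the modulus available for a
    second derivative that is merely continuous. *)
Lemma compact_uniform_modulus (R : realType) (f : R -> R) (a b M e : R) :
  continuous f -> (forall x, `|f x| <= M) -> (forall x, x \notin `[a, b] -> f x = 0) ->
  0 < e -> exists2 k, 0 <= k & forall x y, `|f y - f x| <= e + k * (y - x) ^+ 2.
Proof.
move=> cf fM f0 e0; have M0 : 0 <= M by exact: le_trans (fM 0).
have /compact_near_coveringP/(_ _ 0^'+ (fun del x => forall y, `|y - x| < del -> `|f y - f x| <= e)) :=
  @segment_compact R a b.
have h x : [set` `[a, b]] x -> \forall x' \near x & i \near 0^'+,
    forall y : R, `|y - x'| < i -> `|f y - f x'| <= e.
  move=> _; have e2 : 0 < e / 2 by exact: divr_gt0.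
  have /cvgrPdist_le/(_ _ e2)/nbhs_ballP[r /= r0 hr] := cf x.
  have r2 : 0 < r / 2 by exact: divr_gt0.
  exists (ball x (r / 2), [set i | i < r / 2]) => /=.
    by split; [exact: nbhsx_ballx|exact: nbhs_right_lt].
  move=> [x' i] /= [xx' ir] y yx'.
  have h1 : `|f x - f y| <= e / 2.
    apply: hr; rewrite /ball /= (_ : x - y = (x - x') - (y - x')); last by ring.
    rewrite (le_lt_trans (ler_normB _ _))// [ltRHS]splitr ltrD//.
    exact: lt_trans yx' ir.
  have h2 : `|f x - f x'| <= e / 2.
    by apply: hr; rewrite /ball /= (lt_trans xx')// ltr_pdivrMr// ltr_pMr// ltr1n.
  rewrite (_ : f y - f x' = (f x - f x') - (f x - f y)); last by ring.
  by rewrite (le_trans (ler_normB _ _))// [leRHS]splitr lerD.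
move=> /(_ _ h) hK.
have [del [hdel del0]] := filter_ex (filterI hK (nbhs_right_gt 0)).
have d2 : 0 < del ^+ 2 by exact: exprn_gt0.
have k0 : 0 <= 2 * M / del ^+ 2 by rewrite divr_ge0 ?mulr_ge0// ltW.
exists (2 * M / del ^+ 2) => // x y.
have [yx|xy] := ltP `|y - x| del.
  suff : `|f y - f x| <= e by move=> /le_trans; apply; rewrite lerDl mulr_ge0 ?sqr_ge0.
  have [xI|xI] := boolP (x \in `[a, b]); first exact: hdel.
  have [yI|yI] := boolP (y \in `[a, b]); last by rewrite !f0// subrr normr0 ltW.
  by rewrite distrC; apply: hdel => //; rewrite distrC.
apply: (@le_trans _ _ (2 * M)).
  by rewrite (le_trans (ler_normB _ _))// mulr_natl mulr2n lerD.
rewrite (ler_wpDl (ltW e0))// (mulrAC (2 * M)) ler_pdivlMr// ler_wpM2l ?mulr_ge0//.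
by rewrite -(real_normK (num_real (y - x))) lerXn2r// nnegrE// ltW.
Qed.

(** [O j] consists of the points that stay in [U] under displacements up to more than 1 / (j + 1).
    This margin makes it equivalent for the limit to lie in [U] and for the sequence to be
    eventually in some [O j]. It transfers measurability in the sense of preimages of open sets to
    limits. *)
Lemma lim_open_preimage (R : realType) (V : normedModType R) (T : Type)
    (u : nat -> T -> V) (l : T -> V) (U : set V) :
  (forall w, u n w @[n --> \oo] --> l w) -> open U ->
  exists O : nat -> set V, (forall j, open (O j)) /\
    l @^-1` U = \bigcup_j \bigcup_N \bigcap_(m in [set m | (N <= m)%N]) u m @^-1` O j.
Proof.
move=> ul oU.
pose O (j : nat) := [set x : V | exists2 r, j.+1%:R^-1 < r & ball x r `<=` U].
have oO j : open (O j).
  rewrite openE => x [r jr xr].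
  have d0 : 0 < (r - j.+1%:R^-1) / 2 by rewrite divr_gt0 ?subr_gt0.
  apply/nbhs_ballP; exists ((r - j.+1%:R^-1) / 2) => // y; rewrite -ball_normE /= => xy.
  exists (r - (r - j.+1%:R^-1) / 2).
    by rewrite -subr_gt0 (_ : _ - _ = (r - j.+1%:R^-1) / 2)//; field.
  move=> z; rewrite -ball_normE /= => yz; apply: xr; rewrite -ball_normE /=.
  rewrite (_ : x - z = (x - y) + (y - z)); last by rewrite addrA subrK.
  by rewrite (le_lt_trans (ler_normD _ _))// -[ltRHS](subrK ((r - j.+1%:R^-1) / 2)) addrC ltrD.
exists O; split => //; apply/seteqP; split => [w Uw|w [j _ [N _ h]]].
  have /nbhs_ballP[r /= r0 xr] := open_nbhs_nbhs (conj oU Uw).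
  have [j jr] : exists j : nat, j.+1%:R^-1 < r.
    by have [j _ /(_ j (leqnn j))] := near_infty_natSinv_lt (PosNum r0); exists j.
  have Ow : O j (l w) by exists r.
  have [N _ hN] := ul w _ (open_nbhs_nbhs (conj (oO j) Ow)).
  by exists j => //; exists N => // m Nm; exact: hN.
have j0 : 0 < j.+1%:R^-1 :> R by rewrite invr_gt0.
have /cvgrPdist_lt/(_ _ j0)[N' _ hN'] := ul w.
have := h (maxn N N') (leq_maxl _ _) => -[r jr]; apply; rewrite -ball_normE /=.
by rewrite distrC (lt_trans _ jr)// hN' //= leq_maxr.
Qed.

Lemma continuous_vec_sum (R : realType) (V : normedModType R) (U : topologicalType)
    (I : Type) (s : seq I) (F : I -> U -> V) : (forall i, continuous (F i)) ->
  continuous (fun x => \sum_(i <- s) F i x).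
Proof.
move=> cF; elim: s => [|i s ih] x.
  by under eq_fun do rewrite big_nil; exact: cvg_cst.
by under eq_fun do rewrite big_cons; apply: cvgD; [exact: cF|exact: ih].
Qed.

Section divergence_of_integrand.
Context d (Omega : measurableType d) (R : realType) (P : probability Omega R).
Context (H K T : R) (B : R -> {RV P >-> R}).
Context (V : bif_hilbert H K T) (W : V -> {RV P >-> R}).
Hypotheses (hH : 0 < H < 1) (hK : 0 < K <= 1) (hHK : 1 <= 2 * H * K) (hT : 0 < T).
Hypothesis hB : is_bifBm H K T B.
Hypothesis hW : is_isonormal B W.
Local Notation E X := (\int[P]_w X w).
Local Notation "<| x , y |>" := (dot V x y) (format "<| x ,  y |>").
Local Notation C := (cov_const H K T).
Local Notation q := (2 * H * K).
Variables (g g' g'' : R -> R) (M : R).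
Hypothesis dg : forall x : R, is_derive x 1 g (g' x).
Hypothesis dg' : forall x : R, is_derive x 1 g' (g'' x).
Hypothesis cg'' : continuous g''.
Hypotheses (gM : forall x, `|g x| <= M) (gM' : forall x, `|g' x| <= M).
Hypothesis gM'' : forall x, `|g'' x| <= M.
Hypothesis ug'' : forall e, 0 < e -> exists2 k, 0 <= k &
  forall x y, `|g'' y - g'' x| <= e + k * (y - x) ^+ 2.
Variable t : R.
Hypothesis tT : t \in `[0, T].
Local Notation Delta m k := (ind V (grid t m k.+1) - ind V (grid t m k)).
Local Notation OmegaB := (g_sigma_algebraType [set A : set Omega | exists2 t, t \in `[0, T] &
  exists2 Y : set R, measurable Y & A = B t @^-1` Y]).

Let M0 : 0 <= M. Proof. exact: le_trans (gM 0). Qed.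
Let C0 : 0 <= C. Proof. exact: cov_const_ge0. Qed.
Let cg : continuous g. Proof. by move=> x; exact: deriv_continuous (dg x). Qed.
Let cg' : continuous g'. Proof. by move=> x; exact: deriv_continuous (dg' x). Qed.

Let mB s : s \in `[0, T] -> measurable_fun [set: OmegaB] (B s : OmegaB -> R).
Proof.
move=> sT _ Y mY; rewrite setTI; apply: sub_sigma_algebra.
by exists s => //; exists Y.
Qed.

Lemma sigmaB_measurable (A : set Omega) : sigmaB T B A -> measurable A.
Proof.
apply: smallest_sub; first exact: sigma_algebra_measurable.
by move=> _ [s _ [Y mY ->]]; rewrite -[X in measurable X]setTI; exact: B_meas.
Qed.

Let mgB (f : R -> R) s : continuous f -> s \in `[0, T] ->
  measurable_fun [set: OmegaB] (fun w : OmegaB => f (B s w)).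
Proof.
move=> cf sT; apply: measurableT_comp; last exact: mB.
exact: continuous_measurable_fun.
Qed.

Let mcorrection : measurable_fun [set: OmegaB] (ito_correction H K B g'' t : OmegaB -> R).
Proof.
apply: (measurable_fun_cvg (h := fun m (w : OmegaB) => \sum_(j < m.+1) g'' (B (grid t m j) w) *
   ((grid t m j.+1 `^ q - grid t m j `^ q) / 2))) => [m|w _].
  apply: measurable_sum => j; apply: measurable_funM => //; apply: mgB => //.
  by apply: grid_in tT _ _ _; exact: ltnW.
exact: (ito_correction_cvg hHK hB cg'' gM'' tT).
Qed.

Lemma ito_remainder_L2 : L2_real T B (ito_remainder H K B g g'' t).
Proof.
have mZ := measurable_ito_remainder hHK hB dg cg'' gM'' tT.
have ZM := ito_remainder_bound hHK hB cg'' gM gM'' tT.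
split.
  have h : measurable_fun [set: OmegaB] (ito_remainder H K B g g'' t : OmegaB -> R).
    apply: measurable_funB; last exact: mcorrection.
    by apply: measurable_funB => //; exact: mgB.
  by move=> Y mY; have := h measurableT Y mY; rewrite setTI.
have iZ : integ P (fun w => ito_remainder H K B g g'' t w ^+ 2).
  apply: (integ_bounded P (M := (2 * M + M * (t `^ q / 2)) ^+ 2)) => [|w].
    exact: measurable_funX.
  rewrite normrX lerXn2r// nnegrE// (le_trans _ (ZM w))//.
by rewrite Lnorm2E// ltry.
Qed.

Lemma integrand_L2 : L2_hilbert B (integrand B V g' t).
Proof.
have cu w : \sum_(j < m.+1) g' (B (grid t m j) w) *: Delta m j @[m --> \oo] --> integrand B V g' t w.
  exact: (integrand_cvg hH hK hHK hT hB dg' gM' tT).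
split.
  move=> U oU; have [Q [oQ ->]] := lim_open_preimage cu oU.
  suff : measurable (\bigcup_j \bigcup_N \bigcap_(m in [set m | (N <= m)%N])
     (fun w => \sum_(j0 < m.+1) g' (B (grid t m j0) w) *: Delta m j0) @^-1` Q j : set OmegaB) by [].
  apply: bigcup_measurable => j _; apply: bigcup_measurable => N _.
  apply: bigcap_measurableType => m _.
  (* The Riemann sum is a continuous function of finitely many real variables, so the preimage of an
     open set of vectors is that of an open set of rows. *)
  pose L (x : 'rV[R]_m.+1) : V := \sum_(k < m.+1) x 0 k *: Delta m k.
  have cL : continuous L.
    apply: continuous_vec_sum => k x; apply: cvgZr_tmp; [exact: nbhs_filter|exact: coord_continuous].
  have := measurable_row_open (T := OmegaB)
    (x := fun (k : 'I_m.+1) w => g' (B (grid t m k) w)) (O := L @^-1` Q j).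
  have -> : (fun w => \sum_(k < m.+1) g' (B (grid t m k) w) *: Delta m k) =
      (fun w => L (\row_k g' (B (grid t m k) w))).
    by apply/funext => w; apply: eq_bigr => k _; rewrite mxE.
  apply=> [k|]; first by apply: mgB => //; apply: grid_in tT _ _ _; exact: ltnW.
  by apply: open_comp => // x _; exact: cL.
have iu : integ P (fun w => `|integrand B V g' t w| ^+ 2).
  apply: (integ_bounded P (M := C * (M ^+ 2 * T))) => [|w]; last first.
    rewrite (ger0_norm (sqr_ge0 _)).
    exact: (integrand_norm V hH hK hHK hT hB dg' gM' tT).
  apply: (measurable_fun_cvg (h := fun m w =>
    `|\sum_(j < m.+1) g' (B (grid t m j) w) *: Delta m j| ^+ 2)) => [m|w _].
    have -> : (fun w => `|\sum_(j < m.+1) g' (B (grid t m j) w) *: Delta m j| ^+ 2) =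
       (fun w => \sum_(i < m.+1) \sum_(j < m.+1) g' (B (grid t m i) w) *
           (g' (B (grid t m j) w) * <|Delta m i, Delta m j|>)).
      apply/funext => w; rewrite -dot_norm dot_suml; apply: eq_bigr => i _.
      by rewrite dotZl dot_sumr mulr_sumr; apply: eq_bigr => j _; rewrite dotZr.
    have mg' s : measurable_fun setT (fun w => g' (B s w)).
      by apply: measurableT_comp => //; exact: continuous_measurable_fun.
    apply: measurable_sum => i; apply: measurable_sum => j.
    by apply: measurable_funM => //; exact: measurable_funM.
  under eq_fun do rewrite expr2; rewrite expr2.
  by apply: (@cvgM R _ eventually); apply: cvg_norm; exact: cu.
by rewrite (expE_fin iu) ltry.
Qed.

Let Zbound := 2 * M + M * (t `^ q / 2).
Let Zmeas := measurable_ito_remainder hHK hB dg cg'' gM'' tT.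
Let ZM := ito_remainder_bound hHK hB cg'' gM gM'' tT.

Let mF n (G : 'rV[R]_n -> R) (phi : 'I_n -> V) : Cb_infty G ->
  measurable_fun setT (smooth W G phi).
Proof.
move=> hG; apply: measurable_row_continuous; first by move=> i; exact: W_meas.
exact: Cb_infty_continuous.
Qed.

Let iFZ n (G : 'rV[R]_n -> R) (phi : 'I_n -> V) : Cb_infty G ->
  integ P (fun w => smooth W G phi w * ito_remainder H K B g g'' t w).
Proof.
move=> hG; have [N hN] := Cb_infty_bounded hG.
apply: (integMb _ Zmeas ZM); apply: (integ_bounded P (M := N)) => [|w]; first exact: mF.
exact: hN.
Qed.

Lemma integrand_duality n (G : 'rV[R]_n -> R) (phi : 'I_n -> V) : Cb_infty G ->
  ('E_P[fun w => (smooth W G phi w * ito_remainder H K B g g'' t w)%R] =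
   'E_P[fun w => dot V (malliavinD W G phi w) (integrand B V g' t w)])%E.
Proof.
move=> hG.
have [iD e] := duality_identity hH hK hHK hT hB hW dg dg' cg'' gM gM' gM'' ug'' tT phi hG.
by rewrite (expE_fin (iFZ phi hG)) (expE_fin iD) e.
Qed.

(** The estimate is read off the duality: E<DF, u> = E[F Z] with [Z] bounded by [Zbound], and E|F|
    is at most the L^2 norm of F. *)
Lemma integrand_Dom : Dom_delta B W (integrand B V g' t).
Proof.
split; first exact: integrand_L2.
exists Zbound => n G phi hG.
rewrite -integrand_duality// (expE_fin (iFZ phi hG)) abse_EFin.
have [N hN] := Cb_infty_bounded hG.
have F2 : integ P (fun w => smooth W G phi w ^+ 2).
  apply: (integ_bounded P (M := N ^+ 2)) => [|w]; first by apply: measurable_funX; exact: mF.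
  by rewrite normrX lerXn2r// ?nnegrE ?(le_trans (normr_ge0 _) (hN 0))//; exact: hN.
have Z0 : 0 <= Zbound by exact: le_trans (normr_ge0 _) (ZM point).
rewrite Lnorm2E// -EFinM lee_fin.
have iF := integ_sqr (mF phi hG) F2.
apply: (@le_trans _ _ (E (fun w => Zbound * `|smooth W G phi w|))).
  apply: E_abs_le => [||w].
  - exact: integ_meas (iFZ phi hG).
  - by apply: integZ; exact: integ_norm.
  - by rewrite normrM mulrC ler_wpM2r.
rewrite E_Z; last exact: integ_norm.
rewrite ler_wpM2l//; apply: E_abs_le_sqrt => //; first exact: mF.
by rewrite sqr_sqrtr// E_ge0// => w; exact: sqr_ge0.
Qed.

Lemma ito_remainder_divergence :
  is_divergence B W (integrand B V g' t) (ito_remainder H K B g g'' t).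
Proof.
split; first exact: ito_remainder_L2.
by move=> n G phi hG; exact: integrand_duality.
Qed.

End divergence_of_integrand.

(** The combinations a cos + b sin are closed under differentiation, which makes the induction over
    iterated partial derivatives work. They provide the test functionals for uniqueness. *)
Lemma Cb_infty_trig (R : realType) (f : R -> R) (a b : R) :
  f = (fun x => a * cos x + b * sin x) -> Cb_infty (fun x : 'rV[R]_1 => f (x 0 0)).
Proof.
move=> fE s; elim: s a b f fE => [|i s ih] a b f fE /=; last first.
  suff -> : partial (fun x : 'rV[R]_1 => f (x 0 0)) i =
      (fun x => b * cos (x 0 0) + (- a) * sin (x 0 0)).
    exact: (ih b (- a) (fun x => b * cos x + (- a) * sin x)).
  apply/funext => x; rewrite /partial.
  have d1 : is_derive (x 0 0 : R) 1 f (b * cos (x 0 0) + (- a) * sin (x 0 0)).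
    rewrite fE; have h1 := derivZ a (is_derive_cos (x 0 0)).
    have h2 := derivZ b (is_derive_sin (x 0 0)).
    by apply: (is_derive_eq (derivD h1 h2)); ring.
  rewrite -[RHS](@derive_val _ _ _ _ _ _ _ d1) /derive.
  apply: (congr1 (fun u : R -> R => lim (u h @[h --> 0^']))); apply/funext => h /=.
  by rewrite !mxE (ord1 i) !eqxx.
have df (x : R) : is_derive x 1 f (b * cos x + (- a) * sin x).
  rewrite fE; have h1 := derivZ a (is_derive_cos x).
  have h2 := derivZ b (is_derive_sin x).
  by apply: (is_derive_eq (derivD h1 h2)); ring.
split.
- move=> x; apply: (continuous_comp (f := fun x : 'rV[R]_1 => x 0 0)).
    exact: coord_continuous.
  exact: deriv_continuous (df _).
- move=> i x; have [dd _] := df (x 0 0); move: dd; rewrite /derivable.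
  suff -> : (fun h : R => h^-1 *: (((fun x => f (x 0 0)) \o shift x) (h *: delta_mx 0 i) - f (x 0 0))) =
     (fun h => h^-1 *: ((f \o shift (x 0 0)) (h *: 1) - f (x 0 0))) by [].
  by apply/funext => h /=; rewrite !mxE (ord1 i) !eqxx.
- exists (`|a| + `|b|) => x; rewrite fE (le_trans (ler_normD _ _))// !normrM.
  by rewrite lerD// ler_piMr// ler_norml ?cos_geN1 ?cos_le1 ?sin_geN1 ?sin_le1.
Qed.

(** * Uniqueness of the divergence *)

Section divergence_uniqueness.
Context d (Omega : measurableType d) (R : realType) (P : probability Omega R).
Context (H K T : R) (B : R -> {RV P >-> R}).
Context (V : bif_hilbert H K T) (W : V -> {RV P >-> R}).
Hypothesis hW : is_isonormal B W.
Local Notation E X := (\int[P]_w X w).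

Lemma L2_real_meas (Z : Omega -> R) : L2_real T B Z -> measurable_fun setT Z.
Proof.
by move=> [mZ _] _ Y mY; rewrite setTI; exact: sigmaB_measurable (mZ Y mY).
Qed.

Lemma L2_real_integ (Z : Omega -> R) : L2_real T B Z -> integ P Z.
Proof.
move=> LZ; have mZ := L2_real_meas LZ; have [_ nZ] := LZ.
apply: integ_sqr => //; apply/integrableP; split.
  by apply/measurable_EFinP; exact: measurable_funX.
apply: (@le_lt_trans _ _ ('N[P]_2%:E[EFin \o Z] `^ 2)%E); last by rewrite poweR_lty.
rewrite poweR_Lnorm// le_eqVlt; apply/orP; left; apply/eqP; apply: eq_integral => w _.
by rewrite [in RHS]abse_EFin poweR_EFin /= powR_mulrn// normrX.
Qed.

(** The test functionals cos (W h) and sin (W h) make the difference [D] null for the whole space,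
    so [D] integrates to 0 over each event of [sigmaB]. As [L2_real] imposes measurability for this
    sigma-algebra, the sets [D >= 0] and [D < 0] are among these events, and E|D| = 0. *)
Lemma divergence_unique (u : Omega -> V) (Z Z' : Omega -> R) :
  is_divergence B W u Z -> is_divergence B W u Z' -> {ae P, forall w, Z w = Z' w}.
Proof.
move=> [LZ dZ] [LZ' dZ'].
have mZ := L2_real_meas LZ; have mZ' := L2_real_meas LZ'.
have iZ := L2_real_integ LZ; have iZ' := L2_real_integ LZ'.
pose D w := Z w - Z' w.
have mD : measurable_fun setT D by exact: measurable_funB.
have iD : integ P D by exact: integB.
have trig (f : R -> R) (a b : R) h : f = (fun x => a * cos x + b * sin x) ->
    E (fun w => D w * f (W h w)) = 0.
  move=> fE; pose G (x : 'rV[R]_1) := f (x 0 0).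
  have hG : Cb_infty G by exact: Cb_infty_trig fE.
  have [N hN] := Cb_infty_bounded hG.
  have FE : smooth W G (fun=> h) = (fun w => f (W h w)).
    by apply/funext => w; rewrite /smooth /G mxE.
  have mF : measurable_fun setT (fun w => f (W h w)).
    rewrite -FE; apply: measurable_row_continuous; first by move=> i; exact: W_meas.
    exact: Cb_infty_continuous.
  have FN w : `|f (W h w)| <= N by have := hN (\row_i W h w); rewrite /G mxE.
  have i1 := integMb iZ mF FN; have i2 := integMb iZ' mF FN.
  have e := etrans (dZ 1%N G (fun=> h) hG) (esym (dZ' 1%N G (fun=> h) hG)).
  have eZ X : (fun w => smooth W G (fun=> h) w * X w) = (fun w => X w * f (W h w)).
    by apply/funext => w; rewrite FE mulrC.
  move: e; rewrite !eZ (expE_fin i1) (expE_fin i2) => -[e].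
  have -> : (fun w => D w * f (W h w)) = (fun w => Z w * f (W h w) - Z' w * f (W h w)).
    by apply/funext => w; rewrite mulrBl.
  by rewrite E_B// e subrr.
have nD : fourier_null P (fun h w => W h w) (fun=> True) D.
  split => // h _; split.
    by apply: (trig _ 1 0); apply/funext => x; rewrite mul1r mul0r addr0.
  by apply: (trig _ 0 1); apply/funext => x; rewrite mul1r mul0r add0r.
have sig A : sigmaB T B A -> E (fun w => \1_A w * D w) = 0.
  move=> sA.
  pose X (j : {s : R | s \in `[0, T]}) : Omega -> R := B (sval j).
  have XW j : exists2 h, True & {ae P, forall w, W h w = X j w}.
    by exists (ind V (sval j)) => //; exact: (W_ind hW (svalP j)).
  have sA' : <<s [set A | exists j, exists2 Y : set R, measurable Y & A = X j @^-1` Y] >> A.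
    apply: sub_sigma_algebra2 sA => _ [s sT [Y mY ->]].
    by exists (exist _ s sT); exists Y.
  have [mA] := @fourier_null_sigma _ _ _ P V (fun h w => W h w) (fun h => W_meas W h)
    (isonormal_linear hW) (fun=> True) I (fun _ _ _ _ _ => I) _ X D
    (fun j => B_meas B _) XW nD A sA'.
  by rewrite integral_in_indic// => -[].
pose A := [set w | 0 <= D w].
have mDB : measurable_fun [set: g_sigma_algebraType [set A : set Omega | exists2 t, t \in `[0, T] &
    exists2 Y : set R, measurable Y & A = B t @^-1` Y]] D.
  apply: measurable_funB => _ Y mY; rewrite setTI; first exact: LZ.1.
  exact: LZ'.1.
have sA : sigmaB T B A.
  have := mDB measurableT _ (measurable_itv `[0, +oo[); rewrite setTI.
  by congr (sigmaB T B _); apply/seteqP; split => w; rewrite /A /= in_itv /= andbT.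
have sAC : sigmaB T B (~` A).
  have := mDB measurableT _ (measurable_itv `]-oo, 0[); rewrite setTI.
  congr (sigmaB T B _); apply/seteqP; split => w; rewrite /A /= in_itv /= ltNge; first by move/negP.
  by move/negP.
have mA := sigmaB_measurable sA.
have absE w : `|D w| = \1_A w * D w - \1_(~` A) w * D w.
  rewrite !indicE in_setC; have [D0|D0] := leP 0 (D w).
    by rewrite (mem_set (_ : A w))//= mul1r mul0r subr0 ger0_norm.
  rewrite memNset /=; last by rewrite /A /= leNgt D0.
  by rewrite mul0r mul1r sub0r ltr0_norm.
have ED : E (fun w => `|D w|) = 0.
  have i1 X : measurable X -> integ P (fun w => \1_X w * D w).
    move=> mX; apply: (integ_le _ (integ_norm iD)).
      by apply: measurable_funM => //; exact: measurable_indic.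
    move=> w; rewrite normrM ler_piMl// indicE.
    by case: (_ \in _); rewrite ?normr1 ?normr0.
  rewrite (_ : (fun w => `|D w|) = (fun w => \1_A w * D w - \1_(~` A) w * D w)).
    rewrite E_B; [by rewrite !sig// subrr|exact: i1|].
    by apply: i1; exact: measurableC.
  by apply/funext.
have D0 : (\int[P]_w `|(D w)%:E| = 0)%E.
  have iN := integ_norm iD.
  suff -> : (\int[P]_w `|(D w)%:E|)%E = (E (fun w => `|D w|))%:E by rewrite ED.
  by rewrite /Rintegral fineK//; exact: (integrable_fin_num measurableT iN).
have mED : measurable_fun setT (EFin \o D) by exact/measurable_EFinP.
have [h _] := @ae_eq_integral_abs _ Omega R P setT measurableT (EFin \o D) mED.
apply: filterS (h D0) => w /(_ I) /= [] /eqP; rewrite subr_eq0 => /eqP.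
by [].
Qed.

Lemma divergenceE (u : Omega -> V) (Z : Omega -> R) : is_divergence B W u Z ->
  {ae P, forall w, Z w = divergence B W u w}.
Proof.
move=> dZ; apply: (divergence_unique dZ).
exact: (@xgetPex _ (cst 0) [set Z | is_divergence B W u Z] (ex_intro _ Z dZ)).
Qed.

End divergence_uniqueness.

(** * Cutoffs and localization *)

Section twice_differentiable.
Context (R : realType).
Implicit Types (f g : R -> R).

Definition C2_derivatives f (f' f'' : R -> R) :=
  [/\ forall x : R, is_derive x 1 f (f' x), forall x : R, is_derive x 1 f' (f'' x)
    & continuous f''].

Lemma C2P f : C2 f -> C2_derivatives f (derive1 f) (derive1 (derive1 f)).
Proof.
move=> [df df' cf'']; split; last exact: cf''.
  by move=> x; rewrite derive1E; apply/derivableP; exact: df.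
by move=> x; rewrite derive1E; apply/derivableP; exact: df'.
Qed.

Lemma C2_derivativesE f f' f'' : C2_derivatives f f' f'' ->
  C2 f /\ derive1 f = f' /\ derive1 (derive1 f) = f''.
Proof.
move=> [df df' cf''].
have e1 : derive1 f = f' by apply/funext => x; rewrite derive1E; have [_ ->] := df x.
have e2 : derive1 (derive1 f) = f''.
  by rewrite e1; apply/funext => x; rewrite derive1E; have [_ ->] := df' x.
split; last by [].
by split; [move=> x; have [] := df x|rewrite e1 => x; have [] := df' x|rewrite e2].
Qed.

Lemma C2_derivativesM f f' f'' g g' g'' : C2_derivatives f f' f'' ->
  C2_derivatives g g' g'' -> C2_derivatives (fun x => f x * g x)
    (fun x => f' x * g x + f x * g' x)
    (fun x => f'' x * g x + f' x * g' x + (f' x * g' x + f x * g'' x)).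
Proof.
move=> [df df' cf] [dg dg' cg]; split => [x|x|].
- exact: derivM.
- by apply: derivD; exact: derivM.
have cont (u u' : R -> R) : (forall x : R, is_derive x 1 u (u' x)) -> continuous u.
  by move=> du x; exact: deriv_continuous (du x).
by move=> x; apply: (@cvgD _ R^o); apply: (@cvgD _ R^o); apply: cvgM; do ?[exact: cf|exact: cg|exact: (cont _ _ df)|exact: (cont _ _ df')|exact: (cont _ _ dg)|exact: (cont _ _ dg')].
Qed.

Lemma C2_derivatives_comp_affine f f' f'' (a b : R) : C2_derivatives f f' f'' ->
  C2_derivatives (fun x => f (a + x * b)) (fun x => f' (a + x * b) * b)
    (fun x => f'' (a + x * b) * b * b).
Proof.
move=> [df df' cf]; split => [x|x|].
- by apply: (@deriv_comp R f _ x) => //; exact: deriv_affine.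
- have h := derivM (@deriv_comp R f' (fun y => a + y * b) x _ _ (df' (a + x * b))
    (deriv_affine a b x)) (deriv_cst b x).
  by apply: (is_derive_eq h); ring.
have cab : continuous (fun x : R => a + x * b).
  by move=> x; exact: (@deriv_continuous R (fun y => a + y * b) x b (deriv_affine a b x)).
have cst_c : continuous (fun _ : R => b) by move=> x; exact: cvg_cst.
apply: continuous_mulr => //; apply: continuous_mulr => //.
by move=> x; apply: (cvg_comp _ f''); [exact: cab|exact: cf].
Qed.

Let deriv_sqr_norm (x : R) : is_derive x 1 (fun y => y * `|y|) (2 * `|x|).
Proof.
apply: (@is_derive_quadratic_bound _ _ _ _ 2) => y.
have s1 := sqr_ge0 (y - x); have s2 := sqr_ge0 x; have s3 := sqr_ge0 y.
have [x0|/ltW x0] := leP 0 x; have [y0|/ltW y0] := leP 0 y.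
- by rewrite (ger0_norm x0) (ger0_norm y0) ler_norml; apply/andP; split; lra.
- have xy := mulr_ge0_le0 x0 y0; rewrite (ger0_norm x0) (ler0_norm y0) ler_norml.
  by apply/andP; split; lra.
- have xy := mulr_le0_ge0 x0 y0; rewrite (ler0_norm x0) (ger0_norm y0) ler_norml.
  by apply/andP; split; lra.
- by rewrite (ler0_norm x0) (ler0_norm y0) ler_norml; apply/andP; split; lra.
Qed.

(** x^2 |x| has second derivative 6 |x|, which is continuous: a building block for splines of class
    C^2. *)
Let cube x : R := x * (x * `|x|).

Let C2_cube : C2_derivatives cube (fun x => 3 * (x * `|x|)) (fun x => 3 * (2 * `|x|)).
Proof.
split => [x|x|x].
- by apply: (is_derive_eq (derivM (deriv_id x) (deriv_sqr_norm x))); ring.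
- exact: derivZ.
- by apply: cvgM; [exact: cvg_cst|apply: cvgM; [exact: cvg_cst|exact: norm_continuous]].
Qed.

Let diff3 (u : R -> R) x := u x - 3 * u (x - 1) + 3 * u (x - 2) - u (x - 3).

Let deriv_diff3 (u u' : R -> R) (x : R) : (forall x : R, is_derive x 1 u (u' x)) ->
  is_derive x 1 (diff3 u) (diff3 u' x).
Proof.
move=> du; have sh (c : R) : is_derive x 1 (fun y => u (y - c)) (u' (x - c)).
  have d1 : is_derive x 1 (fun y => y - c) 1.
    by apply: (is_derive_eq (derivB (deriv_id x) (deriv_cst c x))); ring.
  by apply: (is_derive_eq (@deriv_comp R u (fun y => y - c) x _ _ (du (x - c)) d1)); ring.
exact: (derivB (derivD (derivB (du x) (derivZ 3 (sh 1))) (derivZ 3 (sh 2))) (sh 3)).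
Qed.

Let continuous_diff3 (u : R -> R) : continuous u -> continuous (diff3 u).
Proof.
move=> cu; have sh (c : R) : continuous (fun y => u (y - c)).
  move=> x; apply: (cvg_comp _ u); last exact: cu.
  by apply: (@cvgB _ R^o); [exact: cvg_id|exact: cvg_cst].
move=> x; apply: (@cvgB _ R^o); last exact: sh.
apply: (@cvgD _ R^o); last by apply: cvgM; [exact: cvg_cst|exact: sh].
by apply: (@cvgB _ R^o); [exact: cu|apply: cvgM; [exact: cvg_cst|exact: sh]].
Qed.

(* The third difference of y^2 |y| is -6 for x <= 0 and 6 for 3 <= x. *)
Definition smooth_step x : R := 2^-1 + 12^-1 * diff3 cube x.

Lemma smooth_step0 x : x <= 0 -> smooth_step x = 0.
Proof.
move=> x0; rewrite /smooth_step /diff3 /cube !ler0_norm; [by field|lra|lra|lra|lra].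
Qed.

Lemma smooth_step1 x : 3 <= x -> smooth_step x = 1.
Proof.
move=> x0; rewrite /smooth_step /diff3 /cube !ger0_norm; [by field|lra|lra|lra|lra].
Qed.

Lemma smooth_step_C2 : exists s' s'', C2_derivatives smooth_step s' s''.
Proof.
have [d1 d2 cc] := C2_cube.
exists (fun x => 12^-1 * diff3 (fun x => 3 * (x * `|x|)) x),
  (fun x => 12^-1 * diff3 (fun x => 3 * (2 * `|x|)) x); split => [x|x|x].
- have := derivD (deriv_cst 2^-1 x) (derivZ 12^-1 (deriv_diff3 x d1)).
  by move=> /is_derive_eq; apply; rewrite add0r.
- exact: (derivZ 12^-1 (deriv_diff3 x d2)).
- by apply: cvgM; [exact: cvg_cst|exact: continuous_diff3].
Qed.

Lemma C2_cutoff f (k : R) : 0 <= k -> C2 f -> exists g, [/\ C2 g, compact_support g &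
  forall x, x \in `[- k, k] -> g x = f x].
Proof.
move=> k0 /C2P cf; have [s' [s'' cs]] := smooth_step_C2.
(* The cutoff is s(k + 3 + x) s(k + 3 - x) with s = [smooth_step]: both arguments are at least 3 on
   [-k, k], and one of them is at most 0 once |x| >= k + 3. *)
have c1 := C2_derivatives_comp_affine (k + 3) 1 cs.
have c2 := C2_derivatives_comp_affine (k + 3) (-1) cs.
have [cg _] := C2_derivativesE (C2_derivativesM cf (C2_derivativesM c1 c2)).
eexists; split; first exact: cg.
  have cI : closed [set` `[- (k + 3), k + 3]] by exact: itv_closed.
  apply: (subclosed_compact _ (@segment_compact R (- (k + 3)) (k + 3))).
    exact: closed_closure.
  have [cI' _] := closure_id [set` `[- (k + 3), k + 3]].
  rewrite (cI' cI); apply: closureS => x /= fx; rewrite in_itv /=.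
  apply: contrapT => /negP; rewrite negb_and -!ltNge => h; apply: fx.
  case/orP: h => h; first by rewrite smooth_step0 ?mul0r ?mulr0//; lra.
  by rewrite [X in _ * (_ * X)]smooth_step0 ?mulr0//; lra.
move=> x; rewrite in_itv /= => /andP[x1 x2].
by rewrite !smooth_step1 ?mulr1//; lra.
Qed.

(** Inside the interval derivatives are local. The end points, which a path with supremum exactly
    [k] may reach, are settled by continuity of the second derivatives, and this takes [k > 0]. *)
Lemma C2_eq_derive2 f g (k : R) : 0 < k -> C2 f -> C2 g ->
  (forall x, x \in `[- k, k] -> g x = f x) ->
  forall x, x \in `[- k, k] -> derive1 (derive1 g) x = derive1 (derive1 f) x.
Proof.
move=> k0 cf cg fg.
have e1 (u v : R -> R) : (forall x, x \in `]- k, k[ -> u x = v x) ->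
    forall x, x \in `]- k, k[ -> derive1 u x = derive1 v x.
  move=> uv x xk; rewrite !derive1E; apply: near_eq_derive.
  by apply: filterS (near_in_itvoo xk) => y /uv.
have e2 x : x \in `]- k, k[ -> derive1 (derive1 g) x = derive1 (derive1 f) x.
  move: x; apply: (e1 (derive1 g) (derive1 f)); apply: (e1 g f) => x; rewrite in_itv /= => /andP[x1 x2].
  by apply: fg; rewrite in_itv /= !ltW.
have [_ _ cf''] := cf; have [_ _ cg''] := cg.
move=> x; rewrite in_itv /= => /andP[x1 x2].
pose u y := derive1 (derive1 g) y - derive1 (derive1 f) y.
suff u0 : `|u x| <= 0 by apply/eqP; rewrite -subr_eq0 -normr_le0.
apply/ler_addgt0Pr => e e0; rewrite add0r.
have c : u y @[y --> x] --> u x.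
  by apply: (@cvgB _ R^o); [exact: cg''|exact: cf''].
have /cvgrPdist_le/(_ e e0)/nbhs_ballP[r /= r0 hr] := c.
(* [x] is moved towards 0 by the factor [1 - eta]: it enters the open interval while staying within
   distance [r], because [eta * k <= r / 2]. *)
pose eta := Num.min (2^-1) (r / (2 * k)).
have eta0 : 0 < eta by rewrite lt_min invr_gt0 ltr0n divr_gt0// mulr_gt0.
have eta1 : eta <= 2^-1 by rewrite ge_min lexx.
have eta2 : eta * k <= r / 2.
  rewrite -ler_pdivlMr// (_ : r / 2 / k = r / (2 * k)); last by field; rewrite gt_eqF.
  by rewrite ge_min lexx orbT.
have xk : `|x| <= k by rewrite ler_norml x1.
have e1k : `|x * (1 - eta)| < k.
  rewrite normrM (ger0_norm (_ : 0 <= 1 - eta)); last lra.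
  by nra.
have uy : u (x * (1 - eta)) = 0.
  by apply/eqP; rewrite subr_eq0; apply/eqP/e2; rewrite in_itv /= -ltr_norml.
have hy : ball x r (x * (1 - eta)).
  rewrite /ball /= (_ : x - x * (1 - eta) = x * eta); last by ring.
  rewrite normrM (gtr0_norm eta0).
  have : `|x| * eta <= k * eta by rewrite ler_wpM2r// ltW.
  by lra.
by have := hr _ hy; rewrite uy subr0.
Qed.

Lemma C2_compact_support_bounds f : C2 f -> compact_support f -> exists M : R,
  [/\ forall x, `|f x| <= M, forall x, `|derive1 f x| <= M,
      forall x, `|derive1 (derive1 f) x| <= M &
      forall e, 0 < e -> exists2 k, 0 <= k & forall x y,
       `|derive1 (derive1 f) y - derive1 (derive1 f) x| <= e + k * (y - x) ^+ 2].
Proof.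
move=> cf sf; have [df df' cf''] := C2P cf.
have [A A0 fA] : exists2 A, 0 <= A & forall x, x \notin `[- A, A] -> f x = 0.
  have [N [_ hN]] := compact_bounded sf.
  exists (`|N| + 1); first by rewrite addr_ge0.
  move=> x xN; apply: contrapT => fx; move/negP: xN; apply; rewrite in_itv /= -ler_norml.
  apply: hN; first by rewrite (le_lt_trans (ler_norm N))// ltrDl.
  exact: subset_closure.
have der0 (u : R -> R) : (forall x, x \notin `[- A, A] -> u x = 0) ->
    forall x, x \notin `[- A, A] -> derive1 u x = 0.
  move=> u0 x xA; rewrite derive1E -(derive_cst (0 : R) x 1).
  apply: near_eq_derive.
  have oA : open (~` [set` `[- A, A]]) by apply: closed_openC; exact: itv_closed.
  have : nbhs x (~` [set` `[- A, A]]).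
    by apply: open_nbhs_nbhs; split => //; exact/negP.
  by apply: filterS => y /= /negP; exact: u0.
have bnd (u : R -> R) : continuous u -> (forall x, x \notin `[- A, A] -> u x = 0) ->
    exists M, forall x, `|u x| <= M.
  move=> cu u0; have AA : - A <= A by rewrite (le_trans _ A0)// oppr_le0.
  have cnu : {within `[- A, A], continuous (fun x => `|u x|)}.
    by apply: continuous_subspaceT => x; apply: cvg_norm; exact: cu.
  have [c _ hc] := EVT_max AA cnu.
  exists `|u c| => x; have [xA|xA] := boolP (x \in `[- A, A]); first exact: hc.
  by rewrite u0// normr0.
have fA' := der0 _ fA; have fA'' := der0 _ fA'.
have [M1 h1] := bnd _ (fun x => deriv_continuous (df x)) fA.
have [M2 h2] := bnd _ (fun x => deriv_continuous (df' x)) fA'.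
have [M3 h3] := bnd _ cf'' fA''.
exists (Num.max M1 (Num.max M2 M3)); split => [x|x|x|e e0].
- by rewrite le_max h1.
- by rewrite !le_max h2 orbT.
- by rewrite !le_max h3 !orbT.
- exact: compact_uniform_modulus h3 fA'' e0.
Qed.

End twice_differentiable.

Section ito_formula.
Context d (Omega : measurableType d) (R : realType) (P : probability Omega R).
Context (H K T : R) (B : R -> {RV P >-> R}).
Context (V : bif_hilbert H K T) (W : V -> {RV P >-> R}).
Hypotheses (hH : 0 < H < 1) (hK : 0 < K <= 1) (hHK : 1 <= 2 * H * K) (hT : 0 < T).
Hypothesis hB : is_bifBm H K T B.
Hypothesis hW : is_isonormal B W.
Local Notation E X := (\int[P]_w X w).
Local Notation "<| x , y |>" := (dot V x y) (format "<| x ,  y |>").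
Variable t : R.
Hypothesis tT : t \in `[0, T].

Lemma path_sup w s : s \in `[0, T] -> `|B s w| <= sup [set `|B s w| | s in `[0, T]].
Proof.
move=> sT; apply: ub_le_sup; last by exists s.
have cB : {within `[0, T], continuous (fun s => `|B s w|)}.
  have cw := @bifBm_continuous _ _ _ _ _ _ _ _ hB w.
  by move=> x; apply: cvg_norm; exact: cw.
have [c _ hc] := EVT_max (ltW hT) cB.
by exists `|B c w| => _ [r rT <-]; exact: hc.
Qed.

(** Disposes of the level [k = 0] of the localization: there the cutoff agrees with [f] at a single
    point, which says nothing of second derivatives, but a path with supremum 0 has [B T w = 0]. The
    law of [B T] has no atom at 0 since its variance is positive. *)
Lemma bifBm_neq0 : {ae P, forall w, B T w != 0}.
Proof.
have TT : T \in `[0, T] by rewrite in_itv /= lexx ltW.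
have sT : is_step (ind V T).
  exists [:: (1, T)]; first by move=> p; rewrite inE => /eqP ->.
  by rewrite /step_elt big_seq1 scale1r.
have v0 : 0 < <|ind V T, ind V T|>.
  by rewrite dot_ind// bif_cov_diag ?powR_gt0// ltW.
have h0 : P (W (ind V T) @^-1` [set 0]) = 0%E.
  have [m [s ms]] := W_step_law hB hW sT.
  rewrite ms//; have [s0|s0] := eqVneq s 0; last first.
    have /null_content_dominatesP := @normal_prob_dominates R m s.
    by apply; [exact: measurable_set1|exact: lebesgue_measure_set1].
  have Wm : {ae P, forall w, W (ind V T) w = m}.
    have mC : measurable (~` [set m]) by apply: measurableC; exact: measurable_set1.
    exists (W (ind V T) @^-1` (~` [set m])); split => //.
      by rewrite -[X in measurable X]setTI; exact: W_meas.
    by rewrite ms// s0 eqxx diracE memNset//=; exact.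
  have m0 : m = 0.
    rewrite -(W_step_mean hB hW sT) -[LHS](E_cst P); apply: E_ae => //.
    by apply: filterS Wm => w ->.
  have := W_isometry hW (ind V T) (ind V T).
  have -> : E (fun w => W (ind V T) w * W (ind V T) w) = 0.
    rewrite -[RHS](E_cst P); apply: E_ae => //; first exact: measurable_funM.
    by apply: filterS Wm => w ->; rewrite m0 mul0r.
  by move=> e; move: v0; rewrite -e ltxx.
have mW : measurable (W (ind V T) @^-1` [set 0]).
  by rewrite -[X in measurable X]setTI; exact: W_meas.
have : {ae P, forall w, W (ind V T) w != 0}.
  exists (W (ind V T) @^-1` [set 0]); split => // w /= /negP; rewrite negbK.
  by move/eqP.
by apply: filterS2 (W_ind hW TT) => w ->.
Qed.

Lemma cutoff_divergence fk : C2 fk -> compact_support fk ->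
  Dom_delta B W (integrand B V (derive1 fk) t) /\
  {ae P, forall w, ito_remainder H K B fk (derive1 (derive1 fk)) t w =
     divergence B W (integrand B V (derive1 fk) t) w}.
Proof.
move=> ck sk; have [M [h1 h2 h3 h4]] := C2_compact_support_bounds ck sk.
have [d1 d2 c2] := C2P ck; split.
  exact: (integrand_Dom hH hK hHK hT hB hW d1 d2 c2 h1 h2 h3 h4 tT).
apply: divergenceE => //.
exact: (ito_remainder_divergence hH hK hHK hT hB hW d1 d2 c2 h1 h2 h3 h4 tT).
Qed.

Lemma ito_remainder_local f g (k : R) w : 0 < k -> C2 f -> C2 g ->
  (forall x, x \in `[- k, k] -> g x = f x) ->
  sup [set `|B s w| | s in `[0, T]] <= k ->
  ito_remainder H K B g (derive1 (derive1 g)) t w =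
  ito_remainder H K B f (derive1 (derive1 f)) t w.
Proof.
move=> k0 cf cg fg supk.
have Bk s : s \in `[0, T] -> B s w \in `[- k, k].
  by move=> sT; rewrite in_itv /= -ler_norml (le_trans (path_sup w sT)).
have gf := C2_eq_derive2 k0 cf cg fg.
move: (derive1 (derive1 g)) (derive1 (derive1 f)) gf => g'' f'' gf.
have eI : \int[lebesgue_measure]_(s in `[0, t]) (g'' (B s w) * s `^ (2 * H * K - 1)) =
    \int[lebesgue_measure]_(s in `[0, t]) (f'' (B s w) * s `^ (2 * H * K - 1)).
  apply: eq_Rintegral => s; rewrite inE /= in_itv /= => /andP[s0 st].
  have sT : s \in `[0, T].
    by rewrite in_itv /= s0 (le_trans st)//; move: tT; rewrite in_itv => /andP[].
  by rewrite (gf _ (Bk _ sT)).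
have g0 : g 0 = f 0 by apply: fg; rewrite in_itv /= oppr_le0 !ltW.
by rewrite /ito_remainder /ito_correction eI g0 (fg _ (Bk _ tT)).
Qed.

(** A general [f] has no bounded derivatives. Its remainder is the limit of those of the cutoffs,
    eventually constant for each [w] once the level exceeds the supremum of the path. *)
Lemma measurable_ito_remainder_C2 f : C2 f ->
  measurable_fun setT (ito_remainder H K B f (derive1 (derive1 f)) t).
Proof.
move=> cf.
have /choice[fk hk] : forall k : nat, exists g, [/\ C2 g, compact_support g &
    forall x, x \in `[- k.+1%:R, k.+1%:R] -> g x = f x].
  by move=> k; exact: C2_cutoff.
apply: (measurable_fun_cvg (h := fun k => ito_remainder H K B (fk k) (derive1 (derive1 (fk k))) t)).
  move=> k; have [ck sk _] := hk k.
  have [M [h1 h2 h3 h4]] := C2_compact_support_bounds ck sk.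
  have [d1 d2 c2] := C2P ck.
  exact: (measurable_ito_remainder hHK hB d1 c2 h3 tT).
move=> w _; apply: cvg_near_cst.
pose S := sup [set `|B s w| | s in `[0, T]].
near=> k; have [ck _ fgk] := hk k; apply: (ito_remainder_local _ cf ck fgk) => //.
rewrite (@le_trans _ _ k%:R)//; last by rewrite ler_nat.
near: k; exact: nbhs_infty_ger.
Unshelve. all: by end_near. Qed.

End ito_formula.

Theorem theorem1 (R : realType) (d : measure_display)
    (Omega : measurableType d) (P : probability Omega R) (H K T : R)
    (hH : 0 < H < 1) (hK : 0 < K <= 1) (hHK : 1 <= 2 * H * K) (hT : 0 < T)
    (B : R -> {RV P >-> R}) (hB : is_bifBm H K T B)
    (V : bif_hilbert H K T) (W : V -> {RV P >-> R}) (hW : is_isonormal B W)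
    (f : R -> R) (hf : C2 f) (t : R) (ht : t \in `[0, T]) :
  (exists Z : {RV P >-> R}, is_skorohod_integral B W f t Z) /\
  (forall Z : {RV P >-> R}, is_skorohod_integral B W f t Z ->
     {ae P, forall w,
        f (B t w) = f 0 + Z w +
          H * K * \int[lebesgue_measure]_(s in `[0, t])
                    (derive1 (derive1 f) (B s w) * s `^ (2 * H * K - 1))}).
Proof.
have mZ := measurable_ito_remainder_C2 hHK hT hB ht hf.
split.
  (* The witness is the remainder for [f] itself, which coincides with that of each cutoff on the
     corresponding event. *)
  pose mixi := isMeasurableFun.Build _ _ Omega R _ mZ.
  pose Z : {mfun Omega >-> R} := HB.pack (ito_remainder H K B f (derive1 (derive1 f)) t) mixi.
  exists Z => k fk ck sk fkf; have [hD hd] := cutoff_divergence hH hK hHK hT hB hW ht ck sk.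
  split => //; apply: filterS2 hd (bifBm_neq0 hHK hT hB hW) => w <- BT supk.
  (* At level 0 the event is null, since it forces [B T w = 0]. *)
  case: k => [|k] in fkf supk *.
    have TT : T \in `[0, T] by rewrite in_itv /= lexx ltW.
    exfalso; move/negP: BT; apply; rewrite -normr_le0.
    exact: le_trans (path_sup hT hB w TT) supk.
  have k0 : 0 < k.+1%:R :> R by rewrite ltr0n.
  exact: esym (ito_remainder_local hT hB ht k0 hf ck fkf supk).
move=> Z hZ.
(* One cutoff for each positive level is enough: countably many levels leave a single null set, and
   every path is below some level. *)
have ae k : {ae P, forall w, sup [set `|B s w| | s in `[0, T]] <= k.+1%:R ->
    Z w = ito_remainder H K B f (derive1 (derive1 f)) t w}.
  have [fk [ck sk fkf]] := C2_cutoff (ler0n _ k.+1) hf.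
  have [_ h1] := hZ k.+1 fk ck sk fkf.
  have [_ h2] := cutoff_divergence hH hK hHK hT hB hW ht ck sk.
  apply: filterS2 h1 h2 => w h1 h2 supk.
  have k0 : 0 < k.+1%:R :> R by rewrite ltr0n.
  exact: etrans (h1 supk) (etrans (esym h2) (ito_remainder_local hT hB ht k0 hf ck fkf supk)).
have := ae_foralln ae; apply: filterS => w h.
have [k supk] : exists k : nat, sup [set `|B s w| | s in `[0, T]] <= k.+1%:R.
  exists (Num.truncn (sup [set `|B s w| | s in `[0, T]])).
  exact/ltW/truncnS_gt.
rewrite (h k supk) /ito_remainder /ito_correction.
by move: (_ * _) => c; ring.
Qed.
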